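(* Let $k$ be a difference field, let $\bar{k}$ be a separable closure of $k$ (with a chosen lift $\bar{\sigma}$ of $\sigma_k$), and let $G=(\mathrm{Gal}(\lfloor\bar{k}\rfloor/\lfloor k\rfloor),()^{\bar{\sigma}})$ be the difference profinite absolute Galois group. The anti-equivalence of categories $$A\mapsto(\lfloor k\rfloor\text{-}\mathbf{Alg}(\lfloor A\rfloor,\lfloor\bar{k}\rfloor),()^{\bar{\sigma}})$$ between difference locally étale $k$-algebras and difference profinite sets with an action of $G$ restricts to anti-equivalences between the following full subcategories: (1) finitely $\boldsymbol{\sigma}$-generated étale $k$-algebras and finitely $\boldsymbol{\sigma}$-generated $G$-profinite sets; (2) finitely $\boldsymbol{\sigma}$-presented étale $k$-algebras and finitely $\boldsymbol{\sigma}$-presented $G$-profinite sets.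
   Context: All rings are commutative and unital. $\boldsymbol{\sigma}\text{-}\mathcal{C}$ is the category of pairs $(X,\sigma_X)$, $X\in\mathcal{C}$, $\sigma_X\in\mathcal{C}(X,X)$, with morphisms commuting with the $\sigma$'s; $\lfloor X\rfloor$ is the underlying object. A difference field is a field with an endomorphism; a $k$-algebra is a difference ring $A$ with a difference ring morphism $k\to A$. $\mathbf{Prof}$: profinite spaces. A $k$-algebra $A$ over a difference field is difference locally étale if $\lfloor A\rfloor$ is ind-étale over $\lfloor k\rfloor$, i.e. every $a\in A$ satisfies a separable polynomial over $\lfloor k\rfloor$. Étale algebras over a field are finite-dimensional. For a $\lfloor k\rfloor$-algebra $A_0$, $\lceil A_0|^k$ is the free $k$-algebra on $A_0$ (value at $A_0$ of the left adjoint of the forgetful functor $k\text{-}\mathbf{Alg}\to\lfloor k\rfloor\text{-}\mathbf{Alg}$). A cocorrespondence $A_0\xrightarrow{p}C_0\xleftarrow{s}A_0$ of $\lfloor k\rfloor$-algebras consists of a $\lfloor k\rfloor$-algebra homomorphism $p$ and a ring homomorphism $s$ with $s(\lambda a)=\sigma_k(\lambda)s(a)$; $\lceil A_0;C_0|^k$ is the $k$-algebra representing $B\mapsto\{c\in\lfloor k\rfloor\text{-}\mathbf{Alg}(C_0,\lfloor B\rfloor):\sigma_B\circ c\circ p=c\circ s\}$ on $k$-algebras $B$. A $k$-algebra $A$ is finitely $\boldsymbol{\sigma}$-generated étale if it is difference locally étale and a quotient of $\lceil A_0|^k$ for some finitely generated étale $\lfloor k\rfloor$-algebra $A_0$; it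 is finitely $\boldsymbol{\sigma}$-presented étale if $A\simeq\lceil A_0;C_0|^k$ for some cocorrespondence $A_0\to C_0\leftarrow A_0$ of étale $\lfloor k\rfloor$-algebras. A separable closure $\bar{k}$ of $k$ is a separable algebraic closure of $\lfloor k\rfloor$ with an endomorphism $\bar{\sigma}$ extending $\sigma_k$. The endomorphism $()^{\bar{\sigma}}$ of the Galois group is determined by $g\circ\bar{\sigma}=\bar{\sigma}\circ g^{\bar{\sigma}}$, and the self-map $()^{\bar{\sigma}}$ of $\lfloor k\rfloor\text{-}\mathbf{Alg}(\lfloor A\rfloor,\lfloor\bar{k}\rfloor)$ by $\bar{\sigma}\circ h^{\bar{\sigma}}=h\circ\sigma_A$; this set has its profinite topology (limit of the finite sets $\lfloor k\rfloor\text{-}\mathbf{Alg}(A_\lambda,\lfloor\bar{k}\rfloor)$ for $\lfloor A\rfloor=\mathrm{colim}\,A_\lambda$ with $A_\lambda$ finite-dimensional), and $G$ acts by composition. A $G$-profinite set is an object of $[G,\boldsymbol{\sigma}\text{-}\mathbf{Prof}]$: a difference profinite space $X$ with a continuous $\lfloor G\rfloor$-action such that $\sigma_X(g.x)=\sigma_G(g).\sigma_X(x)$. For a finite (discrete) set $X_0$ with continuous $\lfloor G\rfloor$-action, $|X_0\rceil_G=\prod_{i\in\mathbb{N}}X_i$, where $X_i$ is a copy of $X_0$ with $\lfloor G\rfloor$-action twisted via $\sigma_G^i$, with the left shift as difference operator. Objects of the form $|X_0\rceil_G$ with $X_0$ finite are called finitely freely $\boldsymbol{\sigma}$-generated. A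 $G$-profinite set is finitely $\boldsymbol{\sigma}$-generated if it is a subobject of a finitely freely $\boldsymbol{\sigma}$-generated one, and finitely $\boldsymbol{\sigma}$-presented if it is an equaliser, in $[G,\boldsymbol{\sigma}\text{-}\mathbf{Prof}]$, of a pair of morphisms between two finitely freely $\boldsymbol{\sigma}$-generated ones. *)

(* Defs.v *)
From HB Require Import structures.
From mathcomp Require Import all_boot all_order all_algebra separable.
From mathcomp Require Import all_classical all_reals topology.

Set Implicit Arguments.
Unset Strict Implicit.
Unset Printing Implicit Defensive.

Import GRing.Theory.
Local Open Scope classical_set_scope.
Local Open Scope ring_scope.

Record category := Category {
  obj :> Type;
  mor : obj -> obj -> Type;
  idm : forall x, mor x x;
  comp : forall x y z, mor y z -> mor x y -> mor x z;
  comp_idl : forall x y (f : mor x y), comp (idm y) f = f;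
  comp_idr : forall x y (f : mor x y), comp f (idm x) = f;
  comp_assoc : forall x y z t (h : mor z t) (g : mor y z) (f : mor x y),
    comp h (comp g f) = comp (comp h g) f }.
Arguments idm {c} x.
Arguments comp {c x y z} g f.

Definition op (C : category) : category :=
  @Category C (fun x y => mor y x) (fun x => idm x)
    (fun x y z g f => comp f g)
    (fun x y f => comp_idr f) (fun x y f => comp_idl f)
    (fun x y z t h g f => esym (comp_assoc f g h)).

Definition full_subcategory (C : category) (P : C -> Prop) : category :=
  @Category {x : C | P x} (fun x y => mor (sval x) (sval y))
    (fun x => idm (sval x)) (fun x y z g f => comp g f)
    (fun x y f => comp_idl f) (fun x y f => comp_idr f)
    (fun x y z t h g f => comp_assoc h g f).

Definition mutually_inverse (C : category) (x y : C)
    (f : mor x y) (g : mor y x) :=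
  comp g f = idm x /\ comp f g = idm y.

Definition isomorphic (C : category) (x y : C) :=
  exists (f : mor x y) (g : mor y x), mutually_inverse f g.

Definition monomorphism (C : category) (x y : C) (m : mor x y) :=
  forall (z : C) (f g : mor z x), comp m f = comp m g -> f = g.

Definition is_equaliser (C : category) (x y : C) (f g : mor x y)
    (e : C) (i : mor e x) :=
  comp f i = comp g i /\
  forall (z : C) (j : mor z x), comp f j = comp g j ->
    exists! u : mor z e, comp i u = j.

Record functor (C D : category) := Functor {
  fobj :> C -> D;
  fmor : forall x y, mor x y -> mor (fobj x) (fobj y);
  fmor_id : forall x, fmor (idm x) = idm (fobj x);
  fmor_comp : forall x y z (g : mor y z) (f : mor x y),
    fmor (comp g f) = comp (fmor g) (fmor f) }.
Arguments fmor {C D} _ {x y} _.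

Definition functor_id (C : category) : functor C C :=
  @Functor C C id (fun x y f => f) (fun x => erefl) (fun x y z g f => erefl).

Program Definition functor_comp (C D E : category)
    (G : functor D E) (F : functor C D) : functor C E :=
  @Functor C E (fun x => G (F x)) (fun x y f => fmor G (fmor F f)) _ _.
Next Obligation. by move=> C D E G F x /=; rewrite !fmor_id. Qed.
Next Obligation. by move=> C D E G F x y z g f /=; rewrite !fmor_comp. Qed.

Definition naturally_isomorphic (C D : category) (F G : functor C D) :=
  exists (a : forall x, mor (F x) (G x)) (b : forall x, mor (G x) (F x)),
    (forall x, mutually_inverse (a x) (b x)) /\
    (forall x y (f : mor x y), comp (a y) (fmor F f) = comp (fmor G f) (a x)).

Definition is_equivalence (C D : category) (F : functor C D) :=
  exists G : functor D C,
    naturally_isomorphic (functor_comp G F) (functor_id C) /\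
    naturally_isomorphic (functor_comp F G) (functor_id D).

Definition functor_restrict (C D : category) (F : functor C D)
    (P : C -> Prop) (Q : D -> Prop) (FPQ : forall x, P x -> Q (F x)) :
    functor (full_subcategory P) (full_subcategory Q) :=
  @Functor (full_subcategory P) (full_subcategory Q)
    (fun x => exist Q (F (sval x)) (FPQ (sval x) (svalP x)))
    (fun x y f => fmor F f)
    (fun x => fmor_id F (sval x)) (fun x y z g f => fmor_comp F g f).

Definition restricts_to_equivalence (C D : category) (F : functor C D)
    (P : C -> Prop) (Q : D -> Prop) :=
  exists FPQ : (forall x, P x -> Q (F x)),
    is_equivalence (functor_restrict FPQ).

Record algebra (k : fieldType) := Algebra {
  alg_ring :> comPzRingType;
  alg_in : {rmorphism k -> alg_ring} }.

Record alg_hom (k : fieldType) (A B : algebra k) := AlgHom {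
  alg_fun :> {rmorphism A -> B};
  alg_fun_in : forall c, alg_fun (alg_in A c) = alg_in B c }.

Lemma rmorphism_ext (R S : pzSemiRingType) (f g : {rmorphism R -> S}) :
  f =1 g -> f = g.
Proof.
case: f g => [f [[f1] [f2]]] [g [[g1] [g2]]] /= /funext efg.
case: g / efg in g1 g2 *.
by rewrite (Prop_irrelevance f1 g1) (Prop_irrelevance f2 g2).
Qed.

Lemma alg_hom_ext (k : fieldType) (A B : algebra k) (f g : alg_hom A B) :
  f =1 g -> f = g.
Proof.
case: f g => [f fc] [g gc] /= /rmorphism_ext efg.
by case: g / efg in gc *; rewrite (Prop_irrelevance fc gc).
Qed.

Definition mk_rmorphism (R S : pzRingType) (f : R -> S)
    (fB : zmod_morphism f) (fM : monoid_morphism f) : {rmorphism R -> S} :=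
  HB.pack f (GRing.isZmodMorphism.Build R S f fB)
            (GRing.isMonoidMorphism.Build R S f fM).

Definition alg_id (k : fieldType) (A : algebra k) : alg_hom A A :=
  @AlgHom k A A idfun (fun c => erefl).

Program Definition alg_comp (k : fieldType) (A B C : algebra k)
    (g : alg_hom B C) (f : alg_hom A B) : alg_hom A C :=
  @AlgHom k A C (g \o f) _.
Next Obligation. by move=> k A B C g f c /=; rewrite !alg_fun_in. Qed.

(* [{poly A}] is not available when [A] may be the zero ring. *)
Definition alg_eval (k : fieldType) (A : algebra k) (p : {poly k}) (a : A) : A :=
  \sum_(i < size p) alg_in A p`_i * a ^+ i.

Definition separable_elt (k : fieldType) (A : algebra k) (a : A) :=
  exists p : {poly k}, separable_poly p /\ alg_eval p a = 0.

Definition ind_etale (k : fieldType) (A : algebra k) :=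
  forall a : A, separable_elt a.

Definition lin_span (k : fieldType) (A : algebra k) (s : seq A) : set A :=
  [set a | exists c : nat -> k, a = \sum_(i < size s) alg_in A (c i) * s`_i].

Definition finite_dim (k : fieldType) (A : algebra k) :=
  exists s : seq A, lin_span s = setT.

Definition field_algebra (k L : fieldType) (j : {rmorphism k -> L}) :
  algebra k := @Algebra k L j.

(* A finite product of finite separable field extensions. *)
Definition etale (k : fieldType) (A : algebra k) :=
  exists (n : nat) (L : 'I_n -> fieldType)
         (j : forall i, {rmorphism k -> L i})
         (pr : forall i, alg_hom A (field_algebra (j i))),
    (forall i, finite_dim (field_algebra (j i)) /\
               ind_etale (field_algebra (j i))) /\
    (forall x : (forall i, L i), exists! a : A, forall i, pr i a = x i).

Definition fd_subalgebra (k : fieldType) (A : algebra k) (B : set A) :=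
  [/\ forall c, B (alg_in A c),
      forall a b, B a -> B b -> B (a + b),
      forall a b, B a -> B b -> B (a * b)
    & exists s : seq A, B = lin_span s].

Record diff_field := DiffField {
  df_field :> fieldType;
  df_sigma : {rmorphism df_field -> df_field} }.

(* The coercion [da_alg] is the forgetful functor from difference k-algebras
   to algebras over the underlying field. *)
Record diff_algebra (k : diff_field) := DiffAlgebra {
  da_alg :> algebra k;
  da_sigma : {rmorphism da_alg -> da_alg};
  da_sigma_in : forall c,
    da_sigma (alg_in da_alg c) = alg_in da_alg (df_sigma k c) }.

Record da_hom (k : diff_field) (A B : diff_algebra k) := DaHom {
  da_fun :> alg_hom A B;
  da_fun_sigma : forall a, da_fun (da_sigma A a) = da_sigma B (da_fun a) }.

Lemma da_hom_ext (k : diff_field) (A B : diff_algebra k) (f g : da_hom A B) :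
  f =1 g -> f = g.
Proof.
case: f g => [f fc] [g gc] /= /alg_hom_ext efg.
by case: g / efg in gc *; rewrite (Prop_irrelevance fc gc).
Qed.

Definition da_id (k : diff_field) (A : diff_algebra k) : da_hom A A :=
  @DaHom k A A (alg_id A) (fun a => erefl).

Program Definition da_comp (k : diff_field) (A B C : diff_algebra k)
    (g : da_hom B C) (f : da_hom A B) : da_hom A C :=
  @DaHom k A C (alg_comp g f) _.
Next Obligation. by move=> k A B C g f a /=; rewrite !da_fun_sigma. Qed.

Program Definition diff_alg_cat (k : diff_field) : category :=
  @Category (diff_algebra k) (@da_hom k) (@da_id k) (@da_comp k) _ _ _.
Next Obligation. by move=> k A B f; apply: da_hom_ext. Qed.
Next Obligation. by move=> k A B f; apply: da_hom_ext. Qed.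
Next Obligation. by move=> k A B C D h g f; apply: da_hom_ext. Qed.

Definition diff_locally_etale (k : diff_field) (A : diff_algebra k) :=
  ind_etale A.

(* F is a free k-algebra on A0: the universal property of the left adjoint of
   the forgetful functor at A0, with unit eta. *)
Definition is_free_diff_algebra (k : diff_field) (A0 : algebra k)
    (F : diff_algebra k) (eta : alg_hom A0 F) :=
  forall (B : diff_algebra k) (f : alg_hom A0 B),
    exists! u : da_hom F B, alg_comp u eta = f.

Record cocorrespondence (k : diff_field) := Cocorrespondence {
  cc_A : algebra k;
  cc_C : algebra k;
  cc_p : alg_hom cc_A cc_C;
  cc_s : {rmorphism cc_A -> cc_C};
  cc_s_semilinear : forall (c : k) (a : cc_A),
    cc_s (alg_in cc_A c * a) = alg_in cc_C (df_sigma k c) * cc_s a }.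

Definition cc_point (k : diff_field) (E : cocorrespondence k)
    (B : diff_algebra k) (c : alg_hom (cc_C E) B) :=
  forall a, da_sigma B (c (cc_p E a)) = c (cc_s E a).

(* R, with the universal point r, represents B |-> {c | cc_point c}. *)
Definition represents_cc (k : diff_field) (E : cocorrespondence k)
    (R : diff_algebra k) (r : alg_hom (cc_C E) R) :=
  cc_point r /\
  forall (B : diff_algebra k) (c : alg_hom (cc_C E) B), cc_point c ->
    exists! u : da_hom R B, alg_comp u r = c.

Definition fin_sigma_generated_etale (k : diff_field) (A : diff_algebra k) :=
  diff_locally_etale A /\
  exists (A0 : algebra k) (F : diff_algebra k) (eta : alg_hom A0 F)
         (q : da_hom F A),
    [/\ etale A0, is_free_diff_algebra eta & forall a, exists b, q b = a].

Definition fin_sigma_presented_etale (k : diff_field) (A : diff_algebra k) :=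
  exists (E : cocorrespondence k) (R : diff_algebra k)
         (r : alg_hom (cc_C E) R),
    [/\ etale (cc_A E), etale (cc_C E), represents_cc r
      & isomorphic (A : diff_alg_cat k) (R : diff_alg_cat k)].

Definition profinite (X : topologicalType) :=
  [/\ compact [set: X], hausdorff_space X & totally_disconnected [set: X]].

Lemma zero_dimensional_hausdorff (X : topologicalType) :
  zero_dimensional X -> hausdorff_space X.
Proof.
move=> zX; rewrite open_hausdorff => x y xy.
have [U [[oU cU] Ux nUy]] := zX x y xy.
exists (U, ~` U); first by rewrite !inE.
by split=> //=; [exact: closed_openC | rewrite setICr].
Qed.

Lemma zero_dimensional_profinite (X : topologicalType) :
  compact [set: X] -> zero_dimensional X -> profinite X.
Proof.
by move=> cX zX; split=> //; [exact: zero_dimensional_hausdorff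
  | exact: zero_dimension_totally_disconnected].
Qed.

Record diff_profinite_group := DiffProfiniteGroup {
  gp_space :> topologicalType;
  gp_profinite : profinite gp_space;
  gp_one : gp_space;
  gp_mul : gp_space -> gp_space -> gp_space;
  gp_inv : gp_space -> gp_space;
  gp_mulA : associative gp_mul;
  gp_mul1 : left_id gp_one gp_mul;
  gp_mulV : left_inverse gp_one gp_inv gp_mul;
  gp_mul_continuous : continuous (fun u : gp_space * gp_space => gp_mul u.1 u.2);
  gp_inv_continuous : continuous gp_inv;
  gp_sigma : gp_space -> gp_space;
  gp_sigma_mul : forall g h, gp_sigma (gp_mul g h) = gp_mul (gp_sigma g) (gp_sigma h);
  gp_sigma_continuous : continuous gp_sigma }.

Record Gprofinite (G : diff_profinite_group) := GProfinite {
  gs_space :> topologicalType;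
  gs_profinite : profinite gs_space;
  gs_act : G -> gs_space -> gs_space;
  gs_act1 : forall x, gs_act (gp_one G) x = x;
  gs_actM : forall g h x, gs_act (gp_mul g h) x = gs_act g (gs_act h x);
  gs_act_continuous : continuous (fun u : G * gs_space => gs_act u.1 u.2);
  gs_sigma : gs_space -> gs_space;
  gs_sigma_continuous : continuous gs_sigma;
  gs_sigma_act : forall g x,
    gs_sigma (gs_act g x) = gs_act (gp_sigma g) (gs_sigma x) }.

Record gs_hom (G : diff_profinite_group) (X Y : Gprofinite G) := GsHom {
  gs_fun :> X -> Y;
  gs_fun_continuous : continuous gs_fun;
  gs_fun_act : forall g x, gs_fun (gs_act g x) = gs_act g (gs_fun x);
  gs_fun_sigma : forall x, gs_fun (gs_sigma x) = gs_sigma (gs_fun x) }.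

Lemma gs_hom_ext (G : diff_profinite_group) (X Y : Gprofinite G)
  (f g : gs_hom X Y) : f =1 g -> f = g.
Proof.
case: f g => [f f1 f2 f3] [g g1 g2 g3] /= /funext efg.
case: g / efg in g1 g2 g3 *.
by rewrite (Prop_irrelevance f1 g1) (Prop_irrelevance f2 g2)
           (Prop_irrelevance f3 g3).
Qed.

Program Definition gs_id (G : diff_profinite_group) (X : Gprofinite G) :
  gs_hom X X := @GsHom G X X id _ _ _.
Next Obligation. by move=> G X x; apply: cvg_id. Qed.
Next Obligation. by []. Qed.
Next Obligation. by []. Qed.

Program Definition gs_comp (G : diff_profinite_group) (X Y Z : Gprofinite G)
    (g : gs_hom Y Z) (f : gs_hom X Y) : gs_hom X Z :=
  @GsHom G X Z (g \o f) _ _ _.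
Next Obligation.
move=> G X Y Z g f x.
by apply: continuous_comp; apply: gs_fun_continuous.
Qed.
Next Obligation. by move=> G X Y Z g f h x /=; rewrite !gs_fun_act. Qed.
Next Obligation. by move=> G X Y Z g f x /=; rewrite !gs_fun_sigma. Qed.

Program Definition Gprofinite_cat (G : diff_profinite_group) : category :=
  @Category (Gprofinite G) (@gs_hom G) (@gs_id G) (@gs_comp G) _ _ _.
Next Obligation. by move=> G A B f; apply: gs_hom_ext. Qed.
Next Obligation. by move=> G A B f; apply: gs_hom_ext. Qed.
Next Obligation. by move=> G A B C D h g f; apply: gs_hom_ext. Qed.

Record finite_Gset (G : diff_profinite_group) := FiniteGset {
  fg_set :> finType;
  fg_act : G -> fg_set -> fg_set;
  fg_act1 : forall x, fg_act (gp_one G) x = x;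
  fg_actM : forall g h x, fg_act (gp_mul g h) x = fg_act g (fg_act h x);
  fg_act_continuous : continuous
    (fun u : G * discrete_topology fg_set =>
       fg_act u.1 u.2 : discrete_topology fg_set) }.

Section SigmaFree.
Variables (G : diff_profinite_group) (X0 : finite_Gset G).

Definition sfree_space : topologicalType :=
  prod_topology (fun _ : nat => discrete_topology X0).

Definition sfree_act (g : G) (x : sfree_space) : sfree_space :=
  fun i => fg_act (iter i (@gp_sigma G) g) (x i).

Definition sfree_sigma (x : sfree_space) : sfree_space := fun i => x i.+1.

Lemma sfree_continuous (T : topologicalType) (f : T -> sfree_space) :
  (forall i, continuous (fun t => f t i : discrete_topology X0)) ->
  continuous f.
Proof.
move=> fc t; apply/cvg_sup => i A [_ [[B oB <-] Bft sBA]].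
apply: filterS sBA _; apply: (fc i t B).
exact: open_nbhs_nbhs.
Qed.

Lemma sfree_proj_continuous i :
  continuous (fun x : sfree_space => x i : discrete_topology X0).
Proof. exact: (@proj_continuous nat (fun _ => discrete_topology X0) i). Qed.

Lemma sfree_profinite : profinite sfree_space.
Proof.
apply: zero_dimensional_profinite; last first.
  apply: (@zero_dimension_prod nat (fun _ => discrete_topology X0)) => i.
  exact: discrete_zero_dimension.
have := @tychonoff nat (fun _ => discrete_topology X0) (fun _ => setT).
move=> /(_ _)/wrap[].
  move=> i; apply: finite_compact.
  exact: (@finite_finset X0).
by congr compact; rewrite predeqE.
Qed.

Lemma iter_gp_sigma1 i : iter i (@gp_sigma G) (gp_one G) = gp_one G.
Proof.
have s1 : gp_sigma (gp_one G) = gp_one G.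
  have e := gp_sigma_mul (gp_one G) (gp_one G); rewrite gp_mul1 in e.
  move: (gp_sigma _) e => s e.
  by rewrite -[LHS]gp_mul1 -(gp_mulV s) -gp_mulA -e.
by elim: i => //= i ->.
Qed.

Lemma iter_gp_sigma_continuous i : continuous (iter i (@gp_sigma G)).
Proof.
elim: i => [|i IH] g; first exact: cvg_id.
by apply: (continuous_comp (IH g)); apply: gp_sigma_continuous.
Qed.

Program Definition sfree : Gprofinite G :=
  @GProfinite G sfree_space sfree_profinite sfree_act _ _ _ sfree_sigma _ _.
Next Obligation.
by move=> x; apply: funext => i; rewrite /sfree_act iter_gp_sigma1 fg_act1.
Qed.
Next Obligation.
move=> g h x; apply: funext => i; rewrite /sfree_act -fg_actM; congr fg_act.
by elim: i => //= i ->; rewrite gp_sigma_mul.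
Qed.
Next Obligation.
apply: sfree_continuous => i [g x].
apply: (@continuous_comp _ _ _
  (fun u : G * sfree_space => (iter i (@gp_sigma G) u.1,
                               u.2 i : discrete_topology X0))
  (fun u => fg_act u.1 u.2 : discrete_topology X0)); last exact: fg_act_continuous.
have h1 : {for (g, x), continuous (fun u : G * sfree_space => iter i (@gp_sigma G) u.1)}.
  apply: (@continuous_comp _ _ _ fst); first exact: cvg_fst.
  exact: iter_gp_sigma_continuous.
have h2 : {for (g, x), continuous (fun u : G * sfree_space => u.2 i : discrete_topology X0)}.
  apply: (@continuous_comp _ _ _ snd (fun x : sfree_space => x i : discrete_topology X0)).
    exact: cvg_snd.
  exact: sfree_proj_continuous.
exact: (cvg_pair h1 h2).
Qed.
Next Obligation. by apply: sfree_continuous => i; exact: sfree_proj_continuous. Qed.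
Next Obligation.
by move=> g x; apply: funext => i; rewrite /sfree_sigma /sfree_act /= -iterSr.
Qed.

End SigmaFree.

Definition fin_sigma_generated (G : diff_profinite_group) (X : Gprofinite G) :=
  exists (X0 : finite_Gset G)
         (m : mor (X : Gprofinite_cat G) (sfree X0 : Gprofinite_cat G)),
    monomorphism m.

Definition fin_sigma_presented (G : diff_profinite_group) (X : Gprofinite G) :=
  exists (X0 Y0 : finite_Gset G)
         (f g : mor (sfree X0 : Gprofinite_cat G) (sfree Y0 : Gprofinite_cat G))
         (i : mor (X : Gprofinite_cat G) (sfree X0 : Gprofinite_cat G)),
    is_equaliser f g i.

Section Span.
Variables (k : fieldType) (A : algebra k).
Implicit Types (s t : seq A) (W B : set A).

Definition submodule W :=
  [/\ W 0, forall a b, W a -> W b -> W (a + b)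
    & forall c a, W a -> W (alg_in A c * a)].

Lemma span_submodule s : submodule (lin_span s).
Proof.
split.
- by exists (fun=> 0); rewrite big1 // => i _; rewrite rmorph0 mul0r.
- move=> _ _ [c ->] [d ->]; exists (fun i => c i + d i).
  by rewrite -big_split; apply: eq_bigr => i _; rewrite rmorphD mulrDl.
- move=> e _ [c ->]; exists (fun i => e * c i).
  by rewrite mulr_sumr; apply: eq_bigr => i _; rewrite rmorphM mulrA.
Qed.

Lemma span_mem s x : x \in s -> lin_span s x.
Proof.
move=> xs; exists (fun i => (i == index x s)%:R).
have lt_xs : (index x s < size s)%N by rewrite index_mem.
rewrite (bigD1 (Ordinal lt_xs)) //= eqxx rmorph1 mul1r nth_index //.
rewrite big1 ?addr0 // => i /negPf; rewrite -val_eqE /= => ->.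
by rewrite rmorph0 mul0r.
Qed.

Lemma span_sub s W : submodule W -> (forall x, x \in s -> W x) ->
  forall a, lin_span s a -> W a.
Proof.
move=> [W0 WD WZ] sW _ [c ->].
elim/big_ind: _ => // i _; apply: WZ; apply: sW; exact: mem_nth.
Qed.

Lemma span_mul s t W : submodule W ->
  (forall x y, x \in s -> y \in t -> W (x * y)) ->
  forall a b, lin_span s a -> lin_span t b -> W (a * b).
Proof.
move=> [W0 WD WZ] stW a b sa tb.
apply: (span_sub _ _ sa (W := fun a => W (a * b))) => [|x xs].
  split=> [|a1 a2|c a1]; rewrite ?mul0r ?mulrDl -?mulrA; [by []|exact: WD|exact: WZ].
apply: (span_sub _ _ tb (W := fun b => W (x * b))) => [|y yt]; last exact: stW.
by split=> [|a1 a2|c a1]; rewrite ?mulr0 ?mulrDr 1?mulrCA; [by []|exact: WD|exact: WZ].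
Qed.

Lemma fd_subalgebra1 B : fd_subalgebra B -> B 1.
Proof. by case=> Bin _ _ _; rewrite -(rmorph1 (alg_in A)). Qed.

Lemma fd_subalgebraU B1 B2 : fd_subalgebra B1 -> fd_subalgebra B2 ->
  exists B, [/\ fd_subalgebra B, B1 `<=` B & B2 `<=` B].
Proof.
move=> fB1 fB2; have [B11 B21] := (fd_subalgebra1 fB1, fd_subalgebra1 fB2).
case: fB1 fB2 => B1in _ B1M [s1 E1] [_ _ B2M [s2 E2]].
set s := [seq x * y | x <- s1, y <- s2].
have sM := span_submodule s; have [_ sD sZ] := sM.
have mulB a b : B1 a -> B2 b -> lin_span s (a * b).
  rewrite E1 E2; apply: span_mul => // x y xs ys.
  by apply: span_mem; apply/allpairsP; exists (x, y).
exists (lin_span s); split; first split=> //.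
- by move=> c; rewrite -[alg_in A c]mulr1; apply: mulB.
- move=> a b; apply: span_mul => // ? ? /allpairsP[[x y] /= [xs ys ->]].
  move=> /allpairsP[[x' y'] /= [xs' ys' ->]].
  rewrite mulrACA; apply: mulB; [apply: B1M; rewrite E1|apply: B2M; rewrite E2];
    exact: span_mem.
- by exists s.
- by move=> b Bb; rewrite -[b]mulr1; apply: mulB.
- by move=> b Bb; rewrite -[b]mul1r; apply: mulB.
Qed.

Lemma fd_subalgebra0 : fd_subalgebra (range (alg_in A)).
Proof.
split=> [c|_ _ [c _ <-] [d _ <-]|_ _ [c _ <-] [d _ <-]|].
- by exists c.
- by exists (c + d); rewrite ?rmorphD.
- by exists (c * d); rewrite ?rmorphM.
exists [:: 1]; rewrite predeqE => a; split=> [[c _ <-]|[c ->]].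
  by exists (fun=> c); rewrite big_ord1 mulr1.
by exists (c 0); rewrite // big_ord1 mulr1.
Qed.

Lemma fd_subalgebra_adjoin a : separable_elt a ->
  exists B, fd_subalgebra B /\ B a.
Proof.
case=> p [sep_p pa0]; have p0 := separable_poly_neq0 sep_p.
set d := (size p).-1.
have Ep : size p = d.+1 by rewrite prednK // lt0n size_poly_eq0.
set s := [seq a ^+ i | i <- iota 0 d].
have sM := span_submodule s; have [s0 sD sZ] := sM.
have sX i : (i < d)%N -> lin_span s (a ^+ i).
  by move=> ltid; apply: span_mem; apply: map_f; rewrite mem_iota.
have sXd : lin_span s (a ^+ d).
  move: pa0; rewrite /alg_eval Ep big_ord_recr /= => /eqP.
  rewrite addrC addr_eq0 => /eqP /(congr1 ( *%R (alg_in A (lead_coef p)^-1))).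
  rewrite mulrA -rmorphM mulVf ?lead_coef_eq0 // rmorph1 mul1r => ->.
  apply: (sZ); rewrite -mulN1r -(rmorphN1 (alg_in A)); apply: (sZ).
  by elim/big_ind: _ => // i _; apply: sZ; apply: sX.
have sXn i : lin_span s (a ^+ i).
  elim: i => [|i IH].
    case: (posnP d) => [d0|/sX//].
    by have -> : a ^+ 0 = a ^+ d by rewrite d0.
  rewrite exprS; apply: (span_sub _ _ IH (W := fun b => lin_span s (a * b))).
    by split=> [|a1 a2|c a1]; rewrite ?mulr0 ?mulrDr 1?mulrCA; [by []|exact: sD|exact: sZ].
  move=> _ /mapP[j + ->]; rewrite mem_iota /= add0n -exprS leq_eqVlt.
  by case/orP => [/eqP->|/sX].
exists (lin_span s); split; last by rewrite -[a]expr1.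
split=> //; last by exists s.
  by move=> c; rewrite -[alg_in A c]mulr1; apply: sZ; apply: (sXn 0).
move=> x y; apply: span_mul => // ? ? /mapP[i _ ->] /mapP[j _ ->].
by rewrite -exprD.
Qed.

End Span.

Lemma fd_subalgebra_image (k : fieldType) (A A' : algebra k)
    (f : {rmorphism A -> A'}) (B : set A) :
  (forall c, exists d, f (alg_in A c) = alg_in A' d) -> fd_subalgebra B ->
  exists B', fd_subalgebra B' /\ (forall b, B b -> B' (f b)).
Proof.
move=> fc fB; have B1 := fd_subalgebra1 fB; case: fB => _ _ BM [s E].
set t := map f s; have [t0 tD tZ] := span_submodule t.
have ft b : B b -> lin_span t (f b).
  rewrite E => sb.
  apply: (span_sub _ _ sb (W := fun b => lin_span t (f b))) => [|x xs]; last by apply: span_mem; apply: map_f.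
  split=> [|x y|c x]; rewrite ?rmorph0 ?rmorphD; [by []|exact: tD|].
  by rewrite rmorphM; have [d ->] := fc c; apply: tZ.
exists (lin_span t); split=> //; split=> //; last by exists t.
  by move=> c; rewrite -[alg_in A' c]mulr1; apply: tZ; rewrite -(rmorph1 f); apply: ft.
move=> x y; apply: span_mul => // ? ? /mapP[x' sx ->] /mapP[y' sy ->].
by rewrite -rmorphM; apply: ft; apply: BM; rewrite E; apply: span_mem.
Qed.

Section HomTopology.
Variables (k : fieldType) (A B : algebra k).

HB.instance Definition _ := gen_eqMixin (alg_hom A B).
HB.instance Definition _ := gen_choiceMixin (alg_hom A B).

(* Limit of the discrete sets of homomorphisms A' -> B, over the
   finite-dimensional subalgebras A' of A: a neighbourhood of h contains every
   h' that has the same restriction as h to one of the A'. *)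
Definition alg_hom_nbhs (h : alg_hom A B) : set_system (alg_hom A B) :=
  [set U | exists A', fd_subalgebra A' /\
     forall h' : alg_hom A B, (forall a, A' a -> h' a = h a) -> U h'].

HB.instance Definition _ := hasNbhs.Build (alg_hom A B) alg_hom_nbhs.

Lemma alg_hom_nbhs_filter (h : alg_hom A B) : ProperFilter (nbhs h).
Proof.
split=> [[A' [_ /(_ h)]]|]; first exact.
split=> [|P Q [A1 [f1 P1]] [A2 [f2 Q2]]|P Q sPQ [A1 [f1 P1]]].
- by exists (range (alg_in A)); split=> //; exact: fd_subalgebra0.
- have [A' [f' s1 s2]] := fd_subalgebraU f1 f2.
  by exists A'; split=> // h' e; split; [apply: P1|apply: Q2] => a Aa;
    apply: e; [apply: s1|apply: s2].
- by exists A1; split=> // h' /P1 /sPQ.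
Qed.

Lemma alg_hom_nbhs_singleton (h : alg_hom A B) (U : set (alg_hom A B)) :
  nbhs h U -> U h.
Proof. by case=> A' [_ /(_ h)]; apply. Qed.

Lemma alg_hom_nbhs_nbhs (h : alg_hom A B) (U : set (alg_hom A B)) :
  nbhs h U -> nbhs h (nbhs^~ U).
Proof.
case=> A' [f' sU]; exists A'; split=> // h' e; exists A'; split=> // h'' e'.
by apply: sU => a Aa; rewrite e' // e.
Qed.

HB.instance Definition _ := Nbhs_isNbhsTopological.Build (alg_hom A B)
  alg_hom_nbhs_filter alg_hom_nbhs_singleton alg_hom_nbhs_nbhs.

Lemma alg_hom_eval_clopen (a : A) (b : B) : ind_etale A ->
  clopen [set h : alg_hom A B | h a = b].
Proof.
move=> /(_ a)/fd_subalgebra_adjoin [A' [f' A'a]].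
split; rewrite ?closedC; last rewrite -openC.
  rewrite openE => h /= <-; exists A'; split=> // h' /(_ a A'a) //.
rewrite openE => h /= hab; exists A'; split=> // h' /(_ a A'a) /= ->.
exact: hab.
Qed.

Lemma alg_hom_zero_dimensional : ind_etale A ->
  zero_dimensional (alg_hom A B).
Proof.
move=> iA x y xy; have [a xya] : exists a, x a <> y a.
  apply: contrapT => nxy; move/eqP: xy; apply; apply: alg_hom_ext => a.
  by apply: contrapT => xya; apply: nxy; exists a.
exists [set h : alg_hom A B | h a = x a]; split=> //; first exact: alg_hom_eval_clopen.
by move=> /= /esym.
Qed.

End HomTopology.

Lemma alg_comp_continuous (k : fieldType) (A B C : algebra k) :
  continuous (fun u : alg_hom B C * alg_hom A B => alg_comp u.1 u.2).
Proof.
move=> [g h] U [A' [f' sU]].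
have [B' [fB' hB']] : exists B', fd_subalgebra B' /\ (forall a, A' a -> B' (h a)).
  by apply: fd_subalgebra_image f' => c; exists c; rewrite alg_fun_in.
exists ([set g' : alg_hom B C | forall b, B' b -> g' b = g b], [set h' : alg_hom A B | forall a, A' a -> h' a = h a]).
  by split; [exists B'|exists A'].
by move=> [g' h'] /= [e1 e2]; apply: sU => a Aa /=; rewrite e2 // e1 //; exact: hB'.
Qed.

Lemma precomp_continuous (k : fieldType) (A A1 B : algebra k) (f : alg_hom A A1) :
  continuous (fun h : alg_hom A1 B => alg_comp h f).
Proof.
move=> h U [A' [f' sU]].
have [B' [fB' hB']] : exists B', fd_subalgebra B' /\ (forall a, A' a -> B' (f a)).
  by apply: fd_subalgebra_image f' => c; exists c; rewrite alg_fun_in.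
exists B'; split=> // h' e; apply: sU => a Aa /=; apply: e; exact: hB'.
Qed.

(* A separable closure of the difference field k, with a lift of its
   endomorphism. *)
Record sep_closure (k : diff_field) := SepClosure {
  sc_field :> fieldType;
  sc_in : {rmorphism k -> sc_field};
  sc_algebraic : ind_etale (field_algebra sc_in);
  sc_closed : forall p : {poly sc_field},
    separable_poly p -> (1 < size p)%N -> exists x, root p x;
  sc_sigma : {rmorphism sc_field -> sc_field};
  sc_sigma_in : forall c, sc_sigma (sc_in c) = sc_in (df_sigma k c) }.

Section SepClosure.
Variables (k : diff_field) (K : sep_closure k).

Definition sc_algebra : diff_algebra k :=
  @DiffAlgebra k (field_algebra (sc_in K)) (sc_sigma K) (@sc_sigma_in k K).

Lemma sc_split (p : {poly K}) : separable_poly p ->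
  exists rs : seq K, p = lead_coef p *: \prod_(r <- rs) ('X - r%:P).
Proof.
move: {2}(size p) (leqnn (size p)) => n; elim: n p => [|n IH] p.
  by rewrite size_poly_leq0 => /eqP->; exists [::]; rewrite lead_coef0 scale0r.
move=> le_p sep_p; case: (leqP (size p) 1) => [le_p1|lt1p].
  exists [::]; rewrite big_nil [in LHS](size1_polyC le_p1) alg_polyC.
  by rewrite [in RHS](size1_polyC le_p1) lead_coefC.
have [x] := sc_closed sep_p lt1p.
move=> /factor_theorem [q Ep].
have p0 := separable_poly_neq0 sep_p.
have q0 : q != 0 by apply: contra_neq p0 => q0; rewrite Ep q0 mul0r.
have sep_q : separable_poly q.
  by apply: dvdp_separable sep_p; rewrite Ep dvdp_mulr.
have [|rs Eq] := IH q _ sep_q.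
  by move: le_p; rewrite Ep size_Mmonic ?monicXsubC // size_XsubC addn2.
exists (x :: rs); rewrite big_cons Ep lead_coefM lead_coefXsubC mulr1.
by rewrite mulrC {1}Eq scalerAr.
Qed.

Lemma alg_eval_hom (A : algebra k) (h : alg_hom A sc_algebra) p a :
  h (alg_eval p a) = (map_poly (sc_in K) p).[h a].
Proof.
rewrite /alg_eval rmorph_sum (@horner_coef_wide _ (size p)) ?size_poly //.
apply: eq_bigr => i _.
by rewrite rmorphM rmorphXn alg_fun_in coef_map.
Qed.

Lemma alg_hom_finite_values (A : algebra k) (a : A) : ind_etale A ->
  exists rs : seq K, forall h : alg_hom A sc_algebra, (h a : K) \in rs.
Proof.
move=> /(_ a) [p [sep_p pa0]].
have := sep_p; rewrite -(separable_map (sc_in K)) => sep_q.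
have [rs Eq] := sc_split sep_q; exists rs => h.
have : root (map_poly (sc_in K) p) (h a).
  by apply/eqP; rewrite -alg_eval_hom pa0 rmorph0.
rewrite Eq rootZ ?root_prod_XsubC // lead_coef_eq0.
exact: separable_poly_neq0.
Qed.

Lemma alg_hom_compact (A : algebra k) : ind_etale A ->
  compact [set: alg_hom A sc_algebra].
Proof.
move=> iA; rewrite compact_ultra => F FU _.
have valF a : {b : K | F [set h : alg_hom A sc_algebra | (h a : K) = b]}.
  apply: cid; have [rs hrs] := alg_hom_finite_values a iA.
  have : F [set h : alg_hom A sc_algebra | (h a : K) \in rs].
    by apply: filterS filterT => h _; exact: hrs.
  elim: rs {hrs} => [|r rs IH]; first by move/filter_ex => [].
  case: (in_ultra_setVsetC [set h : alg_hom A sc_algebra | (h a : K) = r] FU).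
    by move=> ? _; exists r.
  move=> Fn Fr; apply: IH; apply: filterS (filterI Fn Fr) => h /=.
  by case=> nr; rewrite inE => /orP[/eqP|].
pose v a := sval (valF a).
have vF a : F [set h : alg_hom A sc_algebra | (h a : K) = v a] := svalP (valF a).
have vB : zmod_morphism v.
  move=> a b; have [h [[/= <- <-] <-]] := filter_ex (filterI (filterI (vF a) (vF b)) (vF (a - b))).
  exact: rmorphB.
have vM : monoid_morphism v.
  split=> [|a b]; first by have [h /= <-] := filter_ex (vF 1); exact: rmorph1.
  have [h [[/= <- <-] <-]] := filter_ex (filterI (filterI (vF a) (vF b)) (vF (a * b))).
  exact: rmorphM.
have vin c : mk_rmorphism vB vM (alg_in A c) = alg_in sc_algebra c.
  have [h /= e] := filter_ex (vF (alg_in A c)).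
  by rewrite -[LHS]e alg_fun_in.
exists (@AlgHom k A sc_algebra (mk_rmorphism vB vM) vin); split=> //.
move=> U [A' [[_ _ _ [s Es]] sU]].
have : F [set h : alg_hom A sc_algebra | forall x, x \in s -> (h x : K) = v x].
  elim: s {Es} => [|x s IH]; first by apply: filterS filterT.
  apply: filterS (filterI (vF x) IH) => h /= [ex es] y.
  by rewrite inE => /orP[/eqP->//|/es].
move=> Fs; apply: filterS Fs => h /= es; apply: sU => a; rewrite Es => -[c ->].
rewrite !rmorph_sum; apply: eq_bigr => i _; rewrite !rmorphM alg_fun_in vin.
by congr (_ * _); exact/es/mem_nth.
Qed.

Lemma alg_hom_profinite (A : algebra k) : ind_etale A ->
  profinite (alg_hom A sc_algebra).
Proof.
by move=> iA; apply: zero_dimensional_profinite;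
  [exact: alg_hom_compact|exact: alg_hom_zero_dimensional].
Qed.

Lemma sc_twist_value (A : diff_algebra k) (h : alg_hom A sc_algebra) a :
  ind_etale A -> exists b : K, sc_sigma K b = h (da_sigma A a).
Proof.
move=> /(_ a) [p [sep_p pa0]].
have := sep_p; rewrite -(separable_map (sc_in K)) => sep_q.
have [rs Eq] := sc_split sep_q.
have : root (map_poly (sc_sigma K) (map_poly (sc_in K) p)) (h (da_sigma A a)).
  apply/eqP; have /(congr1 (h \o da_sigma A)) /= := pa0.
  rewrite !rmorph0 => <-; rewrite /alg_eval !rmorph_sum.
  rewrite (@horner_coef_wide _ (size p)) ?size_map_poly //.
  apply: eq_bigr => i _; rewrite !rmorphM !rmorphXn da_sigma_in alg_fun_in.
  by rewrite !coef_map /= sc_sigma_in.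
rewrite Eq map_polyZ rmorph_prod rootZ; last first.
  by rewrite fmorph_eq0 lead_coef_eq0 separable_poly_neq0.
under eq_bigr do rewrite /= map_polyXsubC.
rewrite -(big_map (sc_sigma K) xpredT (fun r => 'X - r%:P)) root_prod_XsubC.
by case/mapP=> b _ ->; exists b.
Qed.

Lemma sc_twist_exists (A : diff_algebra k) (h : alg_hom A sc_algebra) :
  ind_etale A ->
  exists h' : alg_hom A sc_algebra,
    forall a, sc_sigma K (h' a) = h (da_sigma A a).
Proof.
move=> iA; have vP a := cid (sc_twist_value h a iA).
pose v a := sval (vP a).
have vE a : sc_sigma K (v a) = h (da_sigma A a) := svalP (vP a).
have vB : zmod_morphism v.
  by move=> a b; apply: (fmorph_inj (sc_sigma K)); rewrite rmorphB !vE !rmorphB.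
have vM : monoid_morphism v.
  split=> [|a b]; apply: (fmorph_inj (sc_sigma K)).
    by rewrite rmorph1 vE !rmorph1.
  by rewrite rmorphM !vE !rmorphM.
have vin c : mk_rmorphism vB vM (alg_in A c) = alg_in sc_algebra c.
  apply: (fmorph_inj (sc_sigma K)).
  by rewrite [LHS]vE da_sigma_in alg_fun_in /= sc_sigma_in.
by exists (@AlgHom k A sc_algebra (mk_rmorphism vB vM) vin).
Qed.

End SepClosure.

Section Galois.
Variables (k : diff_field) (K : sep_closure k).
Local Notation KA := (sc_algebra K).

(* h^sigma, determined by sigma o h^sigma = h o sigma_A, see [sc_twistE]. *)
Definition sc_twist (A : diff_algebra k) (iA : ind_etale A)
  (h : alg_hom A KA) : alg_hom A KA := sval (cid (sc_twist_exists h iA)).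

Lemma sc_twistE (A : diff_algebra k) (iA : ind_etale A) (h : alg_hom A KA) a :
  sc_sigma K (sc_twist iA h a) = h (da_sigma A a).
Proof. exact: svalP (cid (sc_twist_exists h iA)) a. Qed.

Lemma sc_sigma_inj (x y : K) : sc_sigma K x = sc_sigma K y -> x = y.
Proof. exact: fmorph_inj. Qed.

Lemma sc_twist_continuous (A : diff_algebra k) (iA : ind_etale A) :
  continuous (@sc_twist A iA).
Proof.
move=> h U [A' [f' sU]].
have [B' [fB' hB']] : exists B', fd_subalgebra B' /\
    (forall a, A' a -> B' (da_sigma A a)).
  by apply: fd_subalgebra_image f' => c; exists (df_sigma k c); rewrite da_sigma_in.
exists B'; split=> // h' e; apply: sU => a Aa; apply: sc_sigma_inj.
by rewrite !sc_twistE; apply: e; exact: hB'.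
Qed.

Lemma sc_endo_bij (g : alg_hom KA KA) : bijective g.
Proof.
have g_inj : injective g by apply: (@fmorph_inj K K).
have g_surj (y : K) : exists x : K, g x = y.
  have [p [sep_p py0]] := sc_algebraic y.
  have p'0 : map_poly (sc_in K) p != 0.
    by rewrite map_poly_eq0 separable_poly_neq0.
  have groot (x : K) : root (map_poly (sc_in K) p) x ->
      root (map_poly (sc_in K) p) (g x).
    move=> /eqP px0; apply/eqP; have e := alg_eval_hom (alg_id KA) p x.
    apply: (etrans (esym (alg_eval_hom g p x))).
    by apply: (etrans (congr1 g (etrans e px0))); rewrite rmorph0.
  have := sep_p; rewrite -(separable_map (sc_in K)) => sep_q.
  have [rs Eq] := sc_split sep_q.
  have rsE x : root (map_poly (sc_in K) p) x = (x \in undup rs).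
    by rewrite mem_undup Eq rootZ ?root_prod_XsubC // lead_coef_eq0.
  have [||| _ /(_ y)] := @uniq_min_size _ (map g (undup rs)) (undup rs).
  - by rewrite map_inj_uniq ?undup_uniq.
  - by move=> _ /mapP[x xrs ->]; rewrite -rsE; apply: groot; rewrite rsE.
  - by rewrite size_map.
  rewrite -rsE.
  have -> : root (map_poly (sc_in K) p) y.
    by apply/eqP; apply: (etrans (esym (alg_eval_hom (alg_id KA) p y))).
  by case/mapP=> x _ ->; exists x.
have gP (y : K) := cid (g_surj y).
by exists (fun y => sval (gP y)) => x; [apply: g_inj|]; exact: (svalP (gP _)).
Qed.

(* Gal(K/k) with the Krull topology, as a subspace of the endomorphisms. *)
Definition galois_space : topologicalType :=
  [set g : alg_hom KA KA | bijective g] : Type.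

Definition gal_fun (g : galois_space) : alg_hom KA KA := set_val g.

Definition gal_of (g : alg_hom KA KA) : galois_space :=
  exist _ g (mem_set (sc_endo_bij g)).

Lemma gal_ext (g h : galois_space) : gal_fun g =1 gal_fun h -> g = h.
Proof. by move=> /alg_hom_ext egh; apply: val_inj. Qed.

Lemma gal_fun_continuous : continuous gal_fun.
Proof. exact: initial_continuous. Qed.

Lemma gal_continuous (T : topologicalType) (f : T -> galois_space) :
  continuous (gal_fun \o f) -> continuous f.
Proof.
move=> fc t A [_ [[B oB <-] Bft sBA]].
apply: filterS sBA _; apply: (fc t B).
exact: open_nbhs_nbhs.
Qed.

Lemma gal_profinite : profinite galois_space.
Proof.
have iK : ind_etale KA by exact: sc_algebraic.
apply: zero_dimensional_profinite; last first.
  move=> g h gh; have gh' : gal_fun g != gal_fun h.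
    by apply: contra_neq gh => e; apply: gal_ext => x; rewrite e.
  have [U [cU Ug nUh]] := alg_hom_zero_dimensional iK gh'.
  exists (gal_fun @^-1` U); split=> //; apply: preimage_clopen => //.
  exact: gal_fun_continuous.
have cof : continuous gal_of by apply: gal_continuous => g; exact: cvg_id.
have := continuous_compact (continuous_subspaceT cof) (alg_hom_compact iK).
congr compact; rewrite eqEsubset; split=> // g _; exists (gal_fun g) => //.
exact: gal_ext.
Qed.

Definition gal_mul (g h : galois_space) : galois_space :=
  gal_of (alg_comp (gal_fun g) (gal_fun h)).

Lemma gal_inv_exists (g : galois_space) :
  exists g' : galois_space, cancel (gal_fun g) (gal_fun g').
Proof.
have [f fK Kf] := sc_endo_bij (gal_fun g).
have g_inj := can_inj fK.
have vB : zmod_morphism f.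
  by move=> a b; apply: g_inj; rewrite rmorphB !Kf.
have vM : monoid_morphism f.
  split=> [|a b]; apply: g_inj; first by rewrite rmorph1 Kf.
  by rewrite rmorphM !Kf.
have vin c : mk_rmorphism vB vM (alg_in KA c) = alg_in KA c.
  by apply: g_inj; rewrite [LHS]Kf alg_fun_in.
by exists (gal_of (@AlgHom k KA KA (mk_rmorphism vB vM) vin)).
Qed.

Definition gal_inv (g : galois_space) : galois_space :=
  sval (cid (gal_inv_exists g)).

Lemma gal_invK g : cancel (gal_fun g) (gal_fun (gal_inv g)).
Proof. exact: svalP (cid (gal_inv_exists g)). Qed.

Lemma gal_invKV g : cancel (gal_fun (gal_inv g)) (gal_fun g).
Proof.
move=> x; have [f fK Kf] := sc_endo_bij (gal_fun (gal_inv g)).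
by apply: (can_inj fK); rewrite gal_invK.
Qed.

Lemma gal_inv_continuous : continuous gal_inv.
Proof.
apply: gal_continuous => g U [A' [f' sU]].
have [B' [fB' hB']] : exists B', fd_subalgebra B' /\
    (forall a, A' a -> B' (gal_fun (gal_inv g) a)).
  by apply: fd_subalgebra_image f' => c; exists c; rewrite alg_fun_in.
apply: (@filterS _ _ _ (gal_fun @^-1` [set g' : alg_hom KA KA |
    forall b, B' b -> g' b = gal_fun g b])); last first.
  by apply: gal_fun_continuous; exists B'.
move=> g' /= e; apply: sU => a /hB' /e e'.
by rewrite -{1}(gal_invKV g a) -e' gal_invK.
Qed.

Definition gal_sigma (g : galois_space) : galois_space :=
  gal_of (@sc_twist KA (@sc_algebraic k K) (gal_fun g)).

Lemma gal_sigmaE g (x : K) :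
  sc_sigma K (gal_fun (gal_sigma g) x) = gal_fun g (sc_sigma K x).
Proof. exact: (@sc_twistE KA). Qed.

Program Definition galois_group : diff_profinite_group :=
  @DiffProfiniteGroup galois_space gal_profinite (gal_of (alg_id KA))
    gal_mul gal_inv _ _ _ _ gal_inv_continuous gal_sigma _ _.
Next Obligation. by move=> f g h; apply: gal_ext. Qed.
Next Obligation. by move=> g; apply: gal_ext. Qed.
Next Obligation. by move=> g; apply: gal_ext => x; apply: gal_invK. Qed.
Next Obligation.
apply: gal_continuous => -[g h].
apply: (@continuous_comp _ _ _ (fun u : galois_space * galois_space =>
  (gal_fun u.1, gal_fun u.2)) (fun u => alg_comp u.1 u.2)); last first.
  exact: alg_comp_continuous.
have h1 : {for (g, h), continuous (fun u : galois_space * galois_space => gal_fun u.1)}.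
  by apply: (@continuous_comp _ _ _ fst); [exact: cvg_fst|exact: gal_fun_continuous].
have h2 : {for (g, h), continuous (fun u : galois_space * galois_space => gal_fun u.2)}.
  by apply: (@continuous_comp _ _ _ snd); [exact: cvg_snd|exact: gal_fun_continuous].
exact: (cvg_pair h1 h2).
Qed.
Next Obligation.
move=> g h; apply: gal_ext => x; apply: sc_sigma_inj.
by rewrite gal_sigmaE /= -!gal_sigmaE.
Qed.
Next Obligation.
apply: gal_continuous => g.
apply: (@continuous_comp _ _ _ gal_fun (@sc_twist KA (@sc_algebraic k K))).
  exact: gal_fun_continuous.
exact: sc_twist_continuous.
Qed.

Definition dle_cat : category :=
  full_subcategory (@diff_locally_etale k : diff_alg_cat k -> Prop).

Section Points.
Variables (A : diff_algebra k) (iA : diff_locally_etale A).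

Definition points_act (g : galois_group) (h : alg_hom A KA) : alg_hom A KA :=
  alg_comp (gal_fun g) h.

Program Definition points : Gprofinite galois_group :=
  @GProfinite galois_group (alg_hom A KA) (alg_hom_profinite K iA)
    points_act _ _ _ (sc_twist iA) (@sc_twist_continuous A iA) _.
Next Obligation. by move=> h; apply: alg_hom_ext. Qed.
Next Obligation. by move=> f g h; apply: alg_hom_ext. Qed.
Next Obligation.
move=> [g h].
apply: (@continuous_comp _ _ _ (fun u : galois_space * alg_hom A KA =>
  (gal_fun u.1, u.2)) (fun u => alg_comp u.1 u.2)); last first.
  exact: alg_comp_continuous.
have h1 : {for (g, h), continuous (fun u : galois_space * alg_hom A KA => gal_fun u.1)}.
  by apply: (@continuous_comp _ _ _ fst); [exact: cvg_fst|exact: gal_fun_continuous].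
have h2 : {for (g, h), continuous (fun u : galois_space * alg_hom A KA => u.2)}.
  exact: cvg_snd.
exact: (cvg_pair h1 h2).
Qed.
Next Obligation.
move=> g h; apply: alg_hom_ext => a; apply: sc_sigma_inj.
by rewrite sc_twistE /= gal_sigmaE sc_twistE.
Qed.

End Points.

Program Definition points_mor (A B : dle_cat) (f : mor A B) :
    gs_hom (points (svalP B)) (points (svalP A)) :=
  @GsHom galois_group (points (svalP B)) (points (svalP A))
    (fun h : alg_hom (sval B) KA => alg_comp h (f : da_hom (sval A) (sval B))) _ _ _.
Next Obligation. by move=> A B f; apply: precomp_continuous. Qed.
Next Obligation. by move=> A B f g h; apply: alg_hom_ext. Qed.
Next Obligation.
move=> A B f h; apply: alg_hom_ext => a; apply: sc_sigma_inj.
by rewrite /= !sc_twistE /= da_fun_sigma.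
Qed.

Program Definition points_functor :
    functor (op dle_cat) (Gprofinite_cat galois_group) :=
  @Functor (op dle_cat) (Gprofinite_cat galois_group)
    (fun A => points (svalP A)) (fun A B f => points_mor f) _ _.
Next Obligation. by move=> A; apply: gs_hom_ext => h; apply: alg_hom_ext. Qed.
Next Obligation.
by move=> A B C g f; apply: gs_hom_ext => h; apply: alg_hom_ext.
Qed.

End Galois.

(* Main.v *)
(* The quasi-inverse of A |-> Hom(A, K) sends a G-profinite set X to the algebra
   C_G(X, K) of locally constant equivariant functions, with difference operator
   sigma_K o f o sigma_X.  Two facts make this work.  Equivariant functions
   separate the points of X, and by Zorn's lemma a homomorphism C_G(X, K) -> K
   is the evaluation at a point up to an automorphism of K, which evaluation at a
   translate absorbs.  Conversely, by a Stone-Weierstrass argument followed by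
   Galois descent, every k-subalgebra of C_G(X, K) that separates points is
   everything; this gives A = C_G(Hom(A, K), K), and also that injections of
   spaces induce surjections of algebras.

   The finiteness conditions are matched by universal properties.  Maps out of an
   etale algebra into any k-algebra B land in the separable part of B, which is
   locally etale, so freeness or representability of C_G(X, K) is a statement
   about maps of spaces into X.  Since the etale algebras are the C_G(X0, K) with
   X0 finite, free algebras correspond to the |X0], and cocorrespondences to
   correspondences of finite G-sets; an equaliser of maps between |X0] and |Y0]
   is given by a correspondence because, by compactness, the maps only look at
   finitely many coordinates. *)
Require Import Defs.
From HB Require Import structures.
From mathcomp Require Import all_boot all_algebra separable.
From mathcomp Require Import all_classical topology.

Set Implicit Arguments.
Unset Strict Implicit.
Unset Printing Implicit Defensive.

Import GRing.Theory.
Local Open Scope classical_set_scope.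
Local Open Scope ring_scope.

(** * Extending homomorphisms to the separable closure *)

(** Homomorphisms to [K] are built without forming quotients: inside [R * K] one extends a graph
    that kills a given prime ideal until it is total. The same extension result gives enough points
    of an ind-etale algebra, the fixed field of the Galois group, and the automorphism that relates
    a homomorphism on equivariant functions to an evaluation. It works because a separable equation
    makes every element regular in the sense of von Neumann, so that prime ideals behave like
    maximal ones. A test algebra [B] may have nilpotents, so sums and products of separable elements
    cannot be studied through the points of [B]; interpolation at pairs of roots replaces them. A
    point of [A] is only an algebra homomorphism and [sc_sigma] need not be onto; a universal
    property is therefore applied to the sequence of its composites with the powers of [da_sigma],
    which is a difference homomorphism. The zero algebra has to be set apart before any polynomial
    over the carrier is written. *)

Lemma nz_algebra (k : fieldType) (A : algebra k) : (1 : A) != 0 ->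
  exists (R : comNzRingType) (j : {rmorphism k -> R}), A = @Algebra k R j.
Proof.
case: A => R j /= nz.
pose S : comNzRingType :=
  HB.pack (GRing.ComPzRing.sort R) (GRing.PzSemiRing_isNonZero.Build R nz).
by exists S; rewrite /S; case: R j nz @S => /= T [] *; eexists.
Qed.

Lemma bigcup_chain2 T (F : set (set T)) z w : total_on F subset ->
  (\bigcup_(X in F) X) z -> (\bigcup_(X in F) X) w ->
  exists X, [/\ F X, X z & X w].
Proof.
move=> totF [X FX Xz] [Y FY Yw].
by have [XY|YX] := totF _ _ FX FY; [exists Y|exists X]; split=> //; auto.
Qed.

(** Zorn's lemma is applied to the sets whose union with [S0] satisfies [Q]. This forces everything
    above [S0] and settles the empty chain, so that only nonempty chains are left to the
    hypothesis. *)
Lemma Zorn_above T (Q : set (set T)) S0 : Q S0 ->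
  (forall F, F !=set0 -> F `<=` Q -> total_on F subset -> Q (\bigcup_(X in F) X)) ->
  exists M, [/\ Q M, S0 `<=` M & forall M', Q M' -> M `<=` M' -> M' `<=` M].
Proof.
move=> QS0 QU; have [F FQ totF|M [QM maxM]] := @Zorn_bigcup _ (fun S => Q (S `|` S0)).
  have [->|/set0P[X0 FX0]] := eqVneq F set0; first by rewrite bigcup_set0 set0U.
  suff -> : \bigcup_(X in F) X `|` S0 = \bigcup_(X in [set X `|` S0 | X in F]) X.
    apply: QU => [|_ [X FX <-]|_ _ [X FX <-] [Y FY <-]]; last 2 first.
    - exact: FQ.
    - by have [?|?] := totF _ _ FX FY; [left|right]; exact: setSU.
    by exists (X0 `|` S0), X0.
  rewrite eqEsubset; split=> [z [[X FX Xz]|Sz]|z [_ [X FX <-]] [Xz|Sz]].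
  - by exists (X `|` S0); [exists X|left].
  - by exists (X0 `|` S0); [exists X0|right].
  - by left; exists X.
  - by right.
exists (M `|` S0); split=> // M' QM' sM; apply: contrapT => nsM.
apply: (maxM M'); last by rewrite (_ : _ `|` _ = M') // setUidl // => z ?; apply: sM; right.
split; first by move=> z ?; apply: sM; left.
by move=> sM'; apply: nsM => z /sM' ?; left.
Qed.

Lemma size_sub_lead (F : fieldType) (p q : {poly F}) : p != 0 ->
  size q = size p -> lead_coef q = lead_coef p -> (size (p - q)%R < size p)%N.
Proof.
rewrite -size_poly_gt0 => p0 e; rewrite !lead_coefE e => el.
rewrite -(prednK p0) ltnS; apply/leq_sizeP => i.
rewrite leq_eqVlt coefB => /orP[/eqP<-|lt_i]; first by rewrite el subrr.
by move: lt_i; rewrite prednK // => le_i; rewrite !nth_default ?subrr ?e.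
Qed.

Section PairPoly.
Variables (R S : comNzRingType) (w : {poly R * S}).

(** A polynomial over [R * S] is a pair of polynomials; [partial_hom_step] uses this to follow a
    relation over [R] and its image over [K] at once. *)
Lemma horner_fst z : (w.[z]).1 = (map_poly fst w).[z.1].
Proof. exact: (esym (horner_map fst w z)). Qed.

Lemma horner_snd z : (w.[z]).2 = (map_poly snd w).[z.2].
Proof. exact: (esym (horner_map snd w z)). Qed.

Lemma coef_fst i : (w`_i).1 = (map_poly fst w)`_i.
Proof. exact: (esym (coef_map fst w i)). Qed.

Lemma coef_snd i : (w`_i).2 = (map_poly snd w)`_i.
Proof. exact: (esym (coef_map snd w i)). Qed.

End PairPoly.

Lemma alg_evalE (k : fieldType) (R : comNzRingType) (j : {rmorphism k -> R})
    (p : {poly k}) (a : R) :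
  alg_eval (A := @Algebra k R j) p a = (map_poly j p).[a].
Proof.
rewrite (@horner_coef_wide _ (size p)) ?size_poly //.
by apply: eq_bigr => i _; rewrite coef_map.
Qed.

(** A double root at 0 would contradict the coprimality of the factors of a separable product. The
    nonzero constant coefficient of [q] is what later produces inverses and idempotents. *)
Lemma separable_coprimeX (k : fieldType) (p : {poly k}) : separable_poly p ->
  exists n (q : {poly k}), [/\ (n <= 1)%N, q`_0 != 0 & p = 'X^n * q].
Proof.
move=> sp; have [p0|p0] := eqVneq p`_0 0; last by exists 0%N, p; split=> //; rewrite mul1r.
have /factor_theorem[q Ep] : root p 0 by rewrite /root horner_coef0 p0.
rewrite subr0 in Ep; exists 1%N, q; rewrite expr1 mulrC; split=> //.
apply/negP => /eqP q0.
have /factor_theorem[q' Eq] : root q 0 by rewrite /root horner_coef0 q0.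
rewrite subr0 in Eq; move: sp; rewrite Ep Eq separable_mul => /and3P[_ _].
by rewrite coprimepMl !coprimepX rootX eqxx andbF.
Qed.

Section Extension.
Variables (k : diff_field) (K : sep_closure k).
Variables (R : comNzRingType) (j : {rmorphism k -> R}).
Local Notation A := (@Algebra k R j).
Implicit Types (P : set R) (Gam : set (R * K)).

Definition prime_ideal P :=
  [/\ P 0, forall x y, P x -> P y -> P (x - y), forall a x, P x -> P (a * x), ~ P 1
    & forall x y, P (x * y) -> P x \/ P y].

(* The graph of a homomorphism to K, defined on a subalgebra of R and killing
   the elements of P. *)
Definition partial_hom P Gam :=
  [/\ forall c, Gam (j c, sc_in K c), forall z w, Gam z -> Gam w -> Gam (z - w),
      forall z w, Gam z -> Gam w -> Gam (z * w)
    & forall z, Gam z -> P z.1 -> z.2 = 0].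

Lemma partial_hom0 P Gam : partial_hom P Gam -> Gam 0.
Proof. by move=> [Gin GB _ _]; have := GB _ _ (Gin 0) (Gin 0); rewrite subrr. Qed.

Lemma partial_homD P Gam z w : partial_hom P Gam -> Gam z -> Gam w -> Gam (z + w).
Proof.
move=> hG zG wG; have [_ GB _ _] := hG; have G0 := partial_hom0 hG.
by rewrite -[w]opprK -[- w]sub0r; apply: (GB) => //; apply: GB.
Qed.

Lemma partial_hom_poly P Gam p z : partial_hom P Gam -> Gam z ->
  Gam ((map_poly j p).[z.1], (map_poly (sc_in K) p).[z.2]).
Proof.
move=> hG zG; have [Gin _ GM _] := hG.
elim/poly_ind: p => [|p c IH]; first by rewrite !rmorph0 !horner0; exact: partial_hom0 hG.
rewrite !rmorphD !rmorphM /= !map_polyX !map_polyC !hornerMXaddC.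
exact: (partial_homD hG (GM _ _ IH zG) (Gin c)).
Qed.

Lemma prime_ideal_exp P x n : prime_ideal P -> P (x ^+ n) -> P x.
Proof.
move=> [_ _ _ P1 PM]; elim: n => [/P1//|n IH]; rewrite exprS => /PM[//|/IH//].
Qed.

Lemma prime_idealD P x y : prime_ideal P -> P x -> P y -> P (x + y).
Proof.
by move=> [P0 PB _ _ _] Px Py; rewrite -[y]opprK -[- y]sub0r; apply: (PB) => //; apply: PB.
Qed.

Hypothesis iA : ind_etale A.
Variable P : set R.
Hypothesis hP : prime_ideal P.

(** When [z.1] is killed by [X^n * q], primality puts in [P] either [z.1] or the value of [q] at
    [z.1]; the latter would map to the nonzero constant coefficient of [q]. Hence the kernel
    consists exactly of what lies in [P]. *)
Lemma partial_hom_inj Gam z : partial_hom P Gam -> Gam z -> z.2 = 0 -> P z.1.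
Proof.
move=> hG zG z0; have [P0 _ _ _ PM] := hP.
have [p [sp]] := iA z.1; have [n [q [_ q0 ->]]] := separable_coprimeX sp.
rewrite alg_evalE rmorphM rmorphXn /= map_polyX hornerM hornerXn => pz.
have [|/(prime_ideal_exp hP)//|Pq] := PM (z.1 ^+ n) (map_poly j q).[z.1].
  by rewrite pz.
have [_ _ _ /(_ _ (partial_hom_poly q hG zG) Pq)/=] := hG.
by rewrite z0 horner_coef0 coef_map /= => /eqP; rewrite fmorph_eq0 (negPf q0).
Qed.

(** The image is a field: with [q = q' * X + q(0)], the relation [q(z.2) = 0] exhibits the inverse
    as a polynomial in [z.2] over [k]. *)
Lemma partial_homV Gam z : partial_hom P Gam -> Gam z -> z.2 != 0 ->
  exists2 w, Gam w & w.2 = (z.2)^-1.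
Proof.
move=> hG zG z0; have [P0 _ _ _ PM] := hP.
have [p [sp]] := iA z.1; have [n [q [_ q0 ->]]] := separable_coprimeX sp.
rewrite alg_evalE => pz; have [_ _ _ GP] := hG.
have /GP/= := partial_hom_poly ('X^n * q) hG zG; rewrite pz => /(_ P0) {pz}.
rewrite rmorphM rmorphXn /= map_polyX hornerM hornerXn => /eqP.
rewrite mulf_eq0 expf_eq0 (negPf z0) andbF /= => /eqP qz.
have /factor_theorem[q' Eq] : root (q - (q`_0)%:P) 0.
  by rewrite /root hornerD hornerN hornerC horner_coef0 subrr.
rewrite subr0 in Eq.
exists ((map_poly j (- (q`_0)^-1 *: q')).[z.1],
        (map_poly (sc_in K) (- (q`_0)^-1 *: q')).[z.2]) => /=.
  exact: partial_hom_poly hG zG.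
apply: (mulIf z0); rewrite mulVf //.
have {}Eq : q = q' * 'X + (q`_0)%:P by rewrite -Eq subrK.
move: qz; rewrite {1}Eq rmorphD rmorphM /= map_polyX map_polyC hornerMXaddC /=.
move=> /eqP; rewrite addr_eq0 => /eqP e.
rewrite map_polyZ hornerZ -mulrA e rmorphN fmorphV mulrNN mulVf //.
by rewrite fmorph_eq0.
Qed.

(** The polynomials over [Gam] whose value at [c] lies in [P] form [I]. Among their nonzero images
    in [K[X]], one of least size, [v w0], divides all the others: it plays the role of the minimal
    polynomial of [c] modulo [P], and any root of it is an admissible value for [c]. *)
Lemma partial_hom_step Gam c : partial_hom P Gam ->
  exists2 Gam', partial_hom P Gam' & Gam `<=` Gam' /\ exists y, Gam' (c, y).
Proof.
move=> hG; have [P0 PB PMl P1 PM] := hP; have [Gin GB GM GP] := hG.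
have G0 := partial_hom0 hG.
pose F (w : {poly R * K}) := forall i, Gam w`_i.
have FB w w' : F w -> F w' -> F (w - w') by move=> h h' i; rewrite coefB; exact: GB.
have FM w w' : F w -> F w' -> F (w * w').
  move=> h h' i; rewrite coefM; elim/big_ind: _ => // [x y ? ?|l _].
    exact: partial_homD hG _ _.
  exact: GM.
have FC z : Gam z -> F z%:P by move=> Gz i; rewrite coefC; case: ifP.
have G1 : Gam 1 by have := Gin 1; rewrite !rmorph1.
have FX n : F 'X^n by move=> i; rewrite coefXn; case: eqP.
pose v := map_poly (snd : R * K -> K).
(* The second component 0 is a placeholder: by [IE] the first component of the value depends on [c]
   only. *)
pose I w := F w /\ P (w.[(c, 0)]).1.
have IE (w : {poly R * K}) (y : K) : (w.[(c, y)]).1 = (w.[(c, 0)]).1.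
  by rewrite !horner_fst.
have [p [sp pc]] := iA c.
pose wp := \poly_(i < size p) (j p`_i, sc_in K p`_i).
have vwp : v wp = map_poly (sc_in K) p.
  apply/polyP => i; rewrite !coef_map /= coef_poly; case: ltnP => //= le.
  by rewrite nth_default ?rmorph0.
have Iwp : I wp.
  split=> [i|]; first by rewrite coef_poly; case: ifP.
  rewrite horner_fst.
  suff -> : map_poly fst wp = map_poly j p by rewrite -alg_evalE pc.
  apply/polyP => i; rewrite !coef_map /= coef_poly; case: ltnP => //= le.
  by rewrite nth_default ?rmorph0.
have p0 := separable_poly_neq0 sp.
have exn : exists n, `[< exists w, [/\ I w, v w != 0 & size (v w) = n] >].
  exists (size (v wp)); apply/asboolP; exists wp; split=> //.
  by rewrite vwp map_poly_eq0.
case: (ex_minnP exn) => m /asboolP[w0 [Iw0 v0 <-]] min.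
(* Euclidean division by [w0]: its leading coefficient need not be invertible in [Gam], but some [z]
   in [Gam] maps to the inverse of its image, and this is enough to lower the size of [v w]. *)
have div w : I w -> v w0 %| v w.
  move: {2}(size (v w)) (leqnn (size (v w))) => n; elim: n w => [|n IH] w.
    by rewrite size_poly_leq0 => /eqP->; rewrite dvdp0.
  move=> le_n Iw; have [->|vw] := eqVneq (v w) 0; first by rewrite dvdp0.
  have le0 : (size (v w0) <= size (v w))%N by apply: min; apply/asboolP; exists w.
  have [Fw Pw] := Iw; have [Fw0 Pw0] := Iw0.
  have [z Gz z2] : exists2 z, Gam z & z.2 = (lead_coef (v w0))^-1.
    have -> : lead_coef (v w0) = (w0`_(size (v w0)).-1).2.
      by rewrite lead_coefE coef_snd.
    apply: partial_homV => //; rewrite coef_snd.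
    by rewrite -lead_coefE lead_coef_eq0.
  pose z' := w`_(size (v w)).-1 * z.
  have Gz' : Gam z' by apply: GM.
  have z'2 : z'.2 = lead_coef (v w) / lead_coef (v w0).
    by rewrite /= z2 lead_coefE coef_snd.
  pose q := z'%:P * 'X^(size (v w) - size (v w0)).
  have Iw' : I (w - q * w0).
    split; first by apply: (FB) => //; apply: (FM) => //; apply: (FM) => //; apply: (FC).
    by rewrite hornerD hornerN hornerM; apply: (PB) => //; apply: (PMl).
  have vq : v q = z'.2%:P * 'X^(size (v w) - size (v w0)).
    by rewrite /v rmorphM /= map_polyC map_polyXn.
  have vw' : v (w - q * w0) = v w - v q * v w0 by rewrite /v rmorphB rmorphM.
  suff /IH/(_ Iw') : (size (v (w - q * w0)%R) <= n)%N.
    by rewrite vw' dvdp_subl // dvdp_mull.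
  rewrite -ltnS; apply: leq_trans le_n.
  rewrite vw'; apply: size_sub_lead => //.
    rewrite vq -mulrA mul_polyC size_scale.
      by rewrite size_monicM ?monicXn // size_polyXn addSn subnK.
    by rewrite z'2 mulf_neq0 ?invr_eq0 ?lead_coef_eq0.
  by rewrite vq !lead_coefM lead_coefC lead_coefXn mulr1 z'2 divfK ?lead_coef_eq0.
have [Fw0 Pw0] := Iw0.
have v0p : v w0 %| map_poly (sc_in K) p by rewrite -vwp; apply: div.
have sv0 : separable_poly (v w0).
  by apply: dvdp_separable v0p _; rewrite separable_map.
(* If [v w0] were constant, the higher coefficients of [w0] would lie in [P], hence the constant one
   too, and [v w0] would vanish. *)
have [|y y0] := sc_closed sv0.
  rewrite ltnNge; apply/negP => le1; apply/negP: v0; rewrite negbK; apply/eqP.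
  rewrite (size1_polyC le1) -coef_snd; apply/eqP; rewrite polyC_eq0; apply/eqP.
  apply: (GP _ (Fw0 0)); have Pi i : P (w0`_i.+1).1.
    apply: (partial_hom_inj hG (Fw0 _)).
    rewrite coef_snd -/(v w0) nth_default //.
    exact: leq_trans le1 _.
  have -> : (w0`_0).1 = (w0.[(c, 0)]).1 - ((w0 - (w0`_0)%:P).[(c, 0)]).1.
    by rewrite hornerD hornerN hornerC opprB addrCA subrr addr0.
  apply: (PB) => //; rewrite horner_fst.
  rewrite horner_coef; elim/big_ind: _ => // [x x' ? ?|[i /= _] _].
    exact: prime_idealD.
  rewrite mulrC; apply: (PMl); rewrite -coef_fst coefB coefC.
  by case: i => [|i] /=; rewrite ?subrr // subr0.
have vw (w : {poly R * K}) z : (w.[z]).2 = (v w).[z.2].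
  by rewrite horner_snd.
exists [set w.[(c, y)] | w in [set w | F w]]; last split.
- split=> [d|_ _ [w Fw <-] [w' Fw' <-]|_ _ [w Fw <-] [w' Fw' <-]|_ [w Fw <-]].
  + by exists (j d, sc_in K d)%:P; [exact: FC|rewrite hornerC].
  + by exists (w - w'); [exact: FB|rewrite hornerD hornerN].
  + by exists (w * w'); [exact: FM|rewrite hornerM].
  rewrite IE => Pw; have /dvdpP[q e] : v w0 %| v w by apply: div.
  by rewrite vw e hornerM (eqP y0) mulr0.
- by move=> z Gz; exists z%:P; [exact: FC|rewrite hornerC].
- by exists y, 'X; [rewrite -['X]expr1; exact: FX|rewrite hornerX].
Qed.

(** A maximal graph is total by [partial_hom_step], and single-valued because a pair [(0, y)] in it
    forces [y = 0]. *)
Lemma partial_hom_extend Gam : partial_hom P Gam ->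
  exists h : alg_hom A (sc_algebra K),
    (forall x y, Gam (x, y) -> h x = y) /\ (forall x, P x -> h x = 0).
Proof.
move=> hG.
have [|F [X0 FX0] FQ totF|M [QM GM maxM]] := @Zorn_above _ (partial_hom P) Gam.
- exact: hG.
- split=> [d|z w Uz Uw|z w Uz Uw|z [X FX Xz]].
  + by exists X0 => //; have [] := FQ _ FX0.
  + have [X [FX Xz Xw]] := bigcup_chain2 totF Uz Uw.
    by exists X => //; have [_ XB _ _] := FQ _ FX; exact: XB.
  + have [X [FX Xz Xw]] := bigcup_chain2 totF Uz Uw.
    by exists X => //; have [_ _ XM _] := FQ _ FX; exact: XM.
  + by have [_ _ _ XP] := FQ _ FX; exact: XP.
have totM c : {y | M (c, y)}.
  apply: cid; have [G' hG' [sG' [y Gy]]] := partial_hom_step c QM.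
  by exists y; exact: (maxM G').
pose h c := sval (totM c); have hM c : M (c, h c) := svalP (totM c).
have [Min MB MM MP] := QM; have [P0 _ _ _ _] := hP.
have hE x y : M (x, y) -> h x = y.
  move=> Mxy; apply/eqP; rewrite -subr_eq0; apply/eqP.
  by apply: (MP _ (MB _ _ (hM x) Mxy)); rewrite /= subrr.
have hB : zmod_morphism h by move=> a b; apply: hE; exact: (MB _ _ (hM a) (hM b)).
have hMM : monoid_morphism h.
  split=> [|a b]; apply: hE; last exact: (MM _ _ (hM a) (hM b)).
  by have := Min 1; rewrite !rmorph1.
have hin c : mk_rmorphism hB hMM (alg_in A c) = alg_in (sc_algebra K) c.
  exact: hE (Min c).
exists (@AlgHom k A (sc_algebra K) (mk_rmorphism hB hMM) hin); split.
  by move=> x y Gxy; apply: hE; exact: GM.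
by move=> x Px; exact: (MP _ (hM x) Px).
Qed.

End Extension.

(** * Von Neumann regularity, enough points, and Galois-fixed elements *)

Lemma separable_eltP (k : fieldType) (R : comNzRingType) (j : {rmorphism k -> R}) a :
  separable_elt (A := @Algebra k R j) a <->
  exists p : {poly k}, separable_poly p /\ (map_poly j p).[a] = 0.
Proof. by split=> -[p [sp pa]]; exists p; move: pa; rewrite alg_evalE. Qed.

Lemma zero_algebra (k : fieldType) (A : algebra k) (a b : A) : (1 : A) = 0 -> a = b.
Proof. by move=> e; rewrite -[a]mul1r -[b]mul1r e !mul0r. Qed.

Lemma poly_split0 (k : nzRingType) (q : {poly k}) : exists q', q = q' * 'X + (q`_0)%:P.
Proof.
have /factor_theorem[q' Eq] : root (q - (q`_0)%:P) 0.
  by rewrite /root hornerD hornerN hornerC horner_coef0 subrr.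
by exists q'; rewrite subr0 in Eq; rewrite -Eq subrK.
Qed.

(** Since 0 is at most a simple root, [a * q(a) = 0] with [q(0)] nonzero; solving for the constant
    term writes [a] as a multiple of its square. Then [a * s] is an idempotent that generates the
    same ideal as [a]. *)
Lemma separable_elt_regular (k : fieldType) (A : algebra k) (a : A) :
  separable_elt a -> exists s, a * a * s = a.
Proof.
have [e _|nz] := eqVneq (1 : A) 0; first by exists 0; exact: zero_algebra.
have [R [j EA]] := nz_algebra nz; subst A.
move=> /separable_eltP[p [sp]]; have [n [q [n1 q0 ->]]] := separable_coprimeX sp.
rewrite rmorphM rmorphXn /= map_polyX hornerM hornerXn => pz.
have {}pz : a * (map_poly j q).[a] = 0.
  by case: n n1 pz => [|[|//]] _; rewrite ?mul1r ?expr1 // => ->; rewrite mulr0.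
have [q' Eq] := poly_split0 q.
pose u := - (q`_0)^-1; have uq : - u * q`_0 = 1 by rewrite opprK mulVf.
exists (j u * (map_poly j q').[a]).
move: pz; rewrite {1}Eq rmorphD rmorphM /= map_polyX map_polyC hornerMXaddC /=.
rewrite mulrDr => /eqP; rewrite addr_eq0 => /eqP e.
have -> : a * a * (j u * (map_poly j q').[a]) =
    j u * (a * ((map_poly j q').[a] * a)).
  by rewrite mulrCA; congr (_ * _); rewrite -!mulrA; congr (_ * _); rewrite mulrC.
by rewrite e mulrN -mulNr -rmorphN mulrCA -rmorphM uq rmorph1 mulr1.
Qed.

Lemma prime_ideal0 (F : fieldType) : prime_ideal [set (0 : F)].
Proof.
split=> //= [x y -> ->|a x ->||x y /eqP]; rewrite ?subrr ?mulr0 //.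
  exact/eqP/oner_neq0.
by rewrite mulf_eq0 => /orP[/eqP|/eqP]; [left|right].
Qed.

Section Separation.
Variables (k : diff_field) (K : sep_closure k).
Local Notation KA := (sc_algebra K).

(** An ideal maximal among those missing the idempotent [e = a * s] is prime, and it contains
    [1 - e]. A homomorphism killing it sends [e] to 1, hence [a] to a nonzero value. *)
Lemma alg_hom_separates (A : algebra k) (a : A) : ind_etale A -> a <> 0 ->
  exists h : alg_hom A KA, (h a : K) <> 0.
Proof.
move=> iA a0; have nz : (1 : A) != 0.
  by apply/negP => /eqP e; apply: a0; exact: zero_algebra.
have [R [j EA]] := nz_algebra nz; subst A; rewrite /= in a a0 *.
have [s es] := separable_elt_regular (iA a); pose e := a * s.
have ee : e * e = e by rewrite /e mulrACA mulrA es.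
have e0 : e <> 0 by move=> h; apply: a0; rewrite -es -mulrA [a * s]h mulr0.
pose Q (S : set R) := [/\ S 0, forall x y, S x -> S y -> S (x - y),
  forall b x, S x -> S (b * x) & ~ S e].
have [|F [X0 FX0] FQ totF|P [[P0 PB PM Pe] _ maxP]] := @Zorn_above _ Q [set 0].
- split=> // [x y -> ->|b x ->]; first by rewrite subrr.
  by rewrite mulr0.
- split=> [|z w Uz Uw|b z [X FX Xz]|[X FX Xe]].
  + by exists X0 => //; have [] := FQ _ FX0.
  + have [X [FX Xz Xw]] := bigcup_chain2 totF Uz Uw.
    by exists X => //; have [_ XB _ _] := FQ _ FX; exact: XB.
  + by exists X => //; have [_ _ XM _] := FQ _ FX; exact: XM.
  + by have [_ _ _] := FQ _ FX.
have Padd x y : P x -> P y -> P (x + y).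
  by move=> Px Py; rewrite -[y]opprK -[- y]sub0r; apply: (PB) => //; exact: PB.
have adj x : ~ P x -> exists r q, P r /\ e = r + q * x.
  move=> nPx; apply: contrapT => ne; apply: nPx.
  apply: (maxP [set r + q * x | r in P & q in setT]).
  - split=> [|_ _ [r Pr [q _ <-]] [r' Pr' [q' _ <-]]|b _ [r Pr [q _ <-]]|[r Pr [q _ E]]].
    + by exists 0 => //; exists 0; rewrite // mul0r addr0.
    + exists (r - r'); first exact: PB.
      by exists (q - q') => //; rewrite mulrBl opprD addrACA.
    + by exists (b * r); [exact: PM|exists (b * q); rewrite // mulrDr mulrA].
    + by apply: ne; exists r, q.
  - by move=> r Pr; exists r => //; exists 0; rewrite // mul0r addr0.
  - by exists 0 => //; exists 1; rewrite // mul1r add0r.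
have hP : prime_ideal P.
  split=> // [P1|x y Pxy]; first by apply: Pe; rewrite -[e]mulr1; exact: PM.
  apply: contrapT => /not_orP[/adj[r [q [Pr Er]]] /adj[r' [q' [Pr' Er']]]].
  apply: Pe; rewrite -ee {1}Er mulrDl; apply: (Padd); first by rewrite mulrC; exact: PM.
  rewrite Er' mulrDr; apply: (Padd); first exact: PM.
  by rewrite mulrACA; exact: PM.
have [|h [_ hP0]] := @partial_hom_extend _ K R j iA P hP (range (fun c => (j c, sc_in K c))).
  split=> [c|_ _ [c _ <-] [d _ <-]|_ _ [c _ <-] [d _ <-]|_ [c _ <-] /= Pc].
  - by exists c.
  - by exists (c - d); rewrite ?rmorphB.
  - by exists (c * d); rewrite ?rmorphM.
  have [->|c0] := eqVneq c 0; first by rewrite rmorph0.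
  by case: Pe; rewrite -[e]mulr1 -(rmorph1 j) -(mulVf c0) rmorphM mulrA; exact: PM.
have [_ _ _ _ /(_ e (1 - e))] := hP.
rewrite mulrBr mulr1 ee subrr => /(_ P0)[//|/hP0]; rewrite rmorphB rmorph1 => he.
exists h => ha; move: he; rewrite rmorphM ha mul0r subr0; exact/eqP/oner_neq0.
Qed.

(** Otherwise the minimal polynomial of [c], being separable, has a second root [c']. Sending [c] to
    [c'] extends to an endomorphism of [K], which [sc_endo_bij] makes an automorphism, and it moves
    [c]. *)
Lemma sc_fixed (c : K) : (forall g : galois_space K, gal_fun g c = c) ->
  exists d, c = sc_in K d.
Proof.
move=> fix_c.
have exn : exists n, `[< exists p : {poly k},
    [/\ p != 0, root (map_poly (sc_in K) p) c & size p = n] >].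
  have [p [sp pc]] := (@separable_eltP k K (sc_in K) c).1 (@sc_algebraic k K c).
  exists (size p); apply/asboolP; exists p; split=> //; first exact: separable_poly_neq0.
  exact/eqP.
case: (ex_minnP exn) => _ /asboolP[p [p0 pc <-]] min.
have dvd_p f : root (map_poly (sc_in K) f) c -> p %| f.
  move=> fc; apply/negPn/negP => npf.
  suff : (size p <= size (f %% p)%R)%N by rewrite leqNgt ltn_modp p0.
  apply: min; apply/asboolP; exists (f %% p); split=> //.
  move: fc; rewrite {1}(divp_eq f p) /root rmorphD rmorphM hornerD hornerM.
  by rewrite (eqP pc) mulr0 add0r.
have [q [sq qc]] := (@separable_eltP k K (sc_in K) c).1 (@sc_algebraic k K c).
have sp : separable_poly p by apply: dvdp_separable sq; apply: dvd_p; exact/eqP.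
have := sp; rewrite -(separable_map (sc_in K)) => spK.
have /factor_theorem[r Er] := pc.
have r0 : r != 0 by apply: contra_neq p0 => r0; move/eqP: Er; rewrite r0 mul0r map_poly_eq0 => /eqP.
have size_p : size p = (size r).+1.
  by rewrite -(size_map_poly (sc_in K)) Er size_Mmonic ?monicXsubC // size_XsubC addn2.
have [|lt1] := leqP (size r) 1.
  move=> le1; have : size p = 2%N by apply/eqP; rewrite size_p eqSS eqn_leq le1 size_poly_gt0.
  move=> p2; have p1 : p`_1 != 0 by rewrite -[1%N]/(2.-1) -p2 -lead_coefE lead_coef_eq0.
  exists (- p`_0 / p`_1); move: pc; rewrite /root (@horner_coef_wide _ 2) ?size_map_poly ?p2 //.
  rewrite big_ord_recl big_ord1 /= expr0 mulr1 expr1 !coef_map /= addrC addr_eq0 => /eqP e.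
  apply: (mulfI (x := sc_in K p`_1)); first by rewrite fmorph_eq0.
  by rewrite e -rmorphM mulrCA mulfV // mulr1 rmorphN.
move: spK; rewrite Er separable_mul => /and3P[sr _ cop].
have [c' rc'] := sc_closed sr lt1.
have c'c : c' != c.
  apply: contraTneq cop => e; rewrite coprimep_XsubC -e negbK //.
have pc' : root (map_poly (sc_in K) p) c' by rewrite Er rootM rc'.
have [|h [hE _]] := @partial_hom_extend _ K K (sc_in K) (@sc_algebraic k K) _ (prime_ideal0 K)
    (range (fun f => ((map_poly (sc_in K) f).[c], (map_poly (sc_in K) f).[c']))).
  split=> [d|_ _ [f _ <-] [f' _ <-]|_ _ [f _ <-] [f' _ <-]|_ [f _ <-] /= /eqP fc].
  - by exists d%:P; rewrite // map_polyC !hornerC.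
  - by exists (f - f'); rewrite // rmorphB !hornerD !hornerN.
  - by exists (f * f'); rewrite // rmorphM !hornerM.
  by have /dvdpP[q' ->] := dvd_p _ fc; rewrite rmorphM hornerM (eqP pc') mulr0.
case/eqP: c'c; rewrite -[RHS](fix_c (gal_of h)); apply/esym/hE.
by exists 'X; rewrite // map_polyX !hornerX.
Qed.

End Separation.

(** * The separable part of an algebra *)

Lemma prod_XsubC_stable (F : fieldType) (g : {rmorphism F -> F}) (V : seq F) :
  uniq V -> (forall v, v \in V -> g v \in V) ->
  map_poly g (\prod_(v <- V) ('X - v%:P)) = \prod_(v <- V) ('X - v%:P).
Proof.
move=> uV gV; rewrite rmorph_prod /=; under eq_bigr do rewrite map_polyXsubC.
rewrite -(big_map g xpredT (fun v => 'X - v%:P)); apply: perm_big.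
have ugV : uniq (map g V) by rewrite map_inj_uniq //; exact: fmorph_inj.
have sgV : {subset map g V <= V} by move=> _ /mapP[v vV ->]; exact: gV.
apply: uniq_perm => //.
by have [] := uniq_min_size ugV sgV _; rewrite ?size_map.
Qed.

Section Bivariate.
Variables (k : comNzRingType).

(** The inner variable ['X%:P] goes to [a] and the outer variable ['X] to [b]. *)
Definition eval2 (R : comNzRingType) (j : {rmorphism k -> R}) (a b : R) :
    {rmorphism {poly {poly k}} -> R} :=
  horner_eval b \o map_poly (horner_eval a \o map_poly j).

Lemma eval2E (R : comNzRingType) (j : {rmorphism k -> R}) a b f :
  eval2 j a b f = (map_poly (horner_eval a \o map_poly j) f).[b].
Proof. by []. Qed.

Lemma eval2_map (R S : comNzRingType) (j : {rmorphism k -> R})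
    (j' : {rmorphism k -> S}) (h : {rmorphism R -> S}) a b f :
  (forall c, h (j c) = j' c) -> h (eval2 j a b f) = eval2 j' (h a) (h b) f.
Proof.
move=> hj; rewrite !eval2E -horner_map -map_poly_comp /=.
congr (_.[_]); apply: eq_map_poly => q /=; rewrite -horner_map -map_poly_comp.
by congr (_.[_]); apply: eq_map_poly.
Qed.

Lemma eval2_C (R : comNzRingType) (j : {rmorphism k -> R}) a b p :
  eval2 j a b p%:P = (map_poly j p).[a].
Proof. by rewrite eval2E map_polyC hornerC. Qed.

Lemma eval2_map_polyC (R : comNzRingType) (j : {rmorphism k -> R}) a b q :
  eval2 j a b (map_poly polyC q) = (map_poly j q).[b].
Proof.
rewrite eval2E -map_poly_comp; congr (_.[_]).
by apply: eq_map_poly => c /=; rewrite map_polyC /horner_eval hornerC.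
Qed.

End Bivariate.

Section SeparableElements.
Variables (k : diff_field) (K : sep_closure k).

Lemma sc_poly_fixed (r : {poly K}) :
  (forall g : galois_space K, map_poly (gal_fun g) r = r) ->
  exists r0, r = map_poly (sc_in K) r0.
Proof.
move=> fix_r; have /choice[c cE] i : exists c, r`_i = sc_in K c.
  by apply: sc_fixed => g; rewrite -[in RHS](fix_r g) coef_map.
exists (\poly_(i < size r) c i); apply/polyP => i; rewrite coef_map /= coef_poly.
by case: ltnP => [_|le]; [exact: cE|rewrite nth_default ?rmorph0].
Qed.

Lemma separable_roots (p : {poly k}) : separable_poly p ->
  exists rs : seq K, [/\ uniq rs, size p = (size rs).+1 &
    root (map_poly (sc_in K) p) =i rs].
Proof.
move=> sp; have := sp; rewrite -(separable_map (sc_in K)) => spK.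
have [rs E] := sc_split spK; exists rs.
have l0 : lead_coef (map_poly (sc_in K) p) != 0.
  by rewrite lead_coef_eq0 separable_poly_neq0.
split.
- by rewrite -separable_prod_XsubC -(eqp_separable (eqp_scale _ l0)) -E.
- by rewrite -(size_map_poly (sc_in K)) E size_scale // size_prod_XsubC.
- by move=> x; rewrite -topredE /= E rootZ // root_prod_XsubC.
Qed.

(* Modulo p(x) and q(y), a polynomial is determined by its values at the pairs
   of roots of p and q. *)
Lemma eval2_eq0 (R : comNzRingType) (j : {rmorphism k -> R}) a b (p q : {poly k}) f :
  separable_poly p -> separable_poly q ->
  (map_poly j p).[a] = 0 -> (map_poly j q).[b] = 0 ->
  (forall x y : K, root (map_poly (sc_in K) p) x -> root (map_poly (sc_in K) q) y ->
     eval2 (sc_in K) x y f = 0) ->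
  eval2 j a b f = 0.
Proof.
move=> sp sq pa qb f0.
have lq : lead_coef q != 0 by rewrite lead_coef_eq0 separable_poly_neq0.
pose Q : {poly {poly k}} := map_poly polyC ((lead_coef q)^-1 *: q).
have monQ : Q \is monic.
  by rewrite map_monic /= monicE lead_coefZ mulVf.
have QE (S : comNzRingType) (i : {rmorphism k -> S}) (x y : S) : (map_poly i q).[y] = 0 -> eval2 i x y Q = 0.
  by move=> e; rewrite /Q eval2_map_polyC map_polyZ hornerZ e mulr0.
(* Reduction by [Q] in the outer variable, then by [p] in each coefficient, leaves a polynomial
   whose degree in each variable is below the number of available roots. Vanishing at all pairs then
   kills it one variable at a time. *)
pose f1 := Pdiv.Ring.rmodp f Q.
have sf1 : (size f1 < size q)%N.
  have -> : size q = size Q by rewrite size_map_inj_poly ?size_scale ?invr_eq0 //; exact: polyC_inj.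
  by apply: Pdiv.Ring.ltn_rmodpN0; exact: monic_neq0.
have f1E (S : comNzRingType) (i : {rmorphism k -> S}) (x y : S) : (map_poly i q).[y] = 0 ->
    eval2 i x y f = eval2 i x y f1.
  move=> e; rewrite {1}(Pdiv.RingMonic.rdivp_eq monQ f) rmorphD rmorphM.
  by rewrite (QE _ _ _ _ e) mulr0 add0r.
pose f2 := map_poly (fun c => c %% p) f1.
have m0 : 0 %% p = 0 by rewrite mod0p.
have d0 : 0 %/ p = 0 by rewrite div0p.
have f2E (S : comNzRingType) (i : {rmorphism k -> S}) (x y : S) : (map_poly i p).[x] = 0 ->
    eval2 i x y f1 = eval2 i x y f2.
  move=> e; have -> : f1 = map_poly (fun c => c %/ p) f1 * p%:P + f2.
    by apply/polyP => n; rewrite coefD coefMC !coef_map_id0 // -divp_eq.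
  by rewrite rmorphD rmorphM eval2_C e mulr0 add0r.
rewrite f1E // f2E //; suff -> : f2 = 0 by rewrite rmorph0.
have [ra [ua za ea]] := separable_roots sp; have [rb [ub zb eb]] := separable_roots sq.
have f2x x : x \in ra -> map_poly (horner_eval x \o map_poly (sc_in K)) f2 = 0.
  move=> xa; apply: (roots_geq_poly_eq0 (rs := rb)) => //.
    apply/allP => y yb; move: xa yb; rewrite -ea -eb => px qy.
    by rewrite /root -eval2E -f2E ?(eqP px) // -f1E ?(eqP qy) // f0.
  rewrite -ltnS -zb; apply: leq_ltn_trans sf1; apply: leq_trans (size_poly _ _) _.
  exact: size_poly.
apply/polyP => i; rewrite coef0; apply/eqP; rewrite -(map_poly_eq0 (sc_in K)); apply/eqP.
apply: (roots_geq_poly_eq0 (rs := ra)) => //.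
  apply/allP => x xa; rewrite /root.
  by have := congr1 (fun h : {poly K} => h`_i) (f2x x xa); rewrite coef0 coef_map /= => e; apply/eqP; exact: e.
rewrite -ltnS -za size_map_poly coef_map_id0 //; apply: ltn_modpN0.
exact: separable_poly_neq0.
Qed.

(** The values of [f] at pairs of roots form a finite Galois-stable set [V], so the product of the
    [X - v] descends to [k]. It is separable because [V] has no repetition, and it kills the element
    by [eval2_eq0]. *)
Lemma separable_elt_eval2 (R : comNzRingType) (j : {rmorphism k -> R}) (a b : R) f :
  separable_elt (A := @Algebra k R j) a -> separable_elt (A := @Algebra k R j) b ->
  separable_elt (A := @Algebra k R j) (eval2 j a b f).
Proof.
move=> /separable_eltP[p [sp pa]] /separable_eltP[q [sq qb]].
have [ra [ua za ea]] := separable_roots sp; have [rb [ub zb eb]] := separable_roots sq.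
pose V := undup [seq eval2 (sc_in K) x y f | x <- ra, y <- rb].
have [|r Er] := @sc_poly_fixed (\prod_(v <- V) ('X - v%:P)).
  move=> g; apply: prod_XsubC_stable; first exact: undup_uniq.
  move=> v; rewrite !mem_undup => /allpairsP[[x y] /= [xa yb ->]].
  have groot (s : {poly k}) (z : K) : root (map_poly (sc_in K) s) z ->
      root (map_poly (sc_in K) s) (gal_fun g z).
    move=> /eqP sz; apply/eqP; have := congr1 (gal_fun g) sz.
    rewrite rmorph0 -horner_map -map_poly_comp => <-; congr (_.[_]).
    by apply: eq_map_poly => c; rewrite /= alg_fun_in.
  apply/allpairsP; exists (gal_fun g x, gal_fun g y); split=> /=.
  - by rewrite -ea; apply: groot; move: xa; rewrite -ea.
  - by rewrite -eb; apply: groot; move: yb; rewrite -eb.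
  - by apply: eval2_map => c; rewrite alg_fun_in.
apply/separable_eltP; exists r; split.
  by rewrite -(separable_map (sc_in K)) -Er separable_prod_XsubC undup_uniq.
pose F := (map_poly (polyC \o polyC) r).[f].
have FE (S : comNzRingType) (i : {rmorphism k -> S}) (x y : S) : eval2 i x y F = (map_poly i r).[eval2 i x y f].
  rewrite /F -horner_map -map_poly_comp; congr (_.[_]); apply: eq_map_poly => c.
  by apply: (etrans (eval2_C _ _ _ _)); rewrite map_polyC hornerC.
rewrite -FE; apply: eval2_eq0 sp sq pa qb _ => x y px qy.
rewrite FE -Er; apply/eqP; rewrite -/(root _ _) root_prod_XsubC mem_undup.
by apply/allpairsP; exists (x, y); rewrite -ea -eb.
Qed.

Variable A : algebra k.
Implicit Types a b : A.

Lemma separable_elt_zero a : (1 : A) = 0 -> separable_elt a.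
Proof.
move=> e; exists 1; split; last exact: zero_algebra.
by have := @separable_prod_XsubC k [::]; rewrite big_nil.
Qed.

Lemma separable_elt_in (c : k) : separable_elt (alg_in A c).
Proof.
have [e|nz] := eqVneq (1 : A) 0; first exact: separable_elt_zero.
have [R [j EA]] := nz_algebra nz; move: A EA => _ -> /=.
apply/separable_eltP; exists ('X - c%:P); split.
  by have := @separable_prod_XsubC k [:: c]; rewrite big_seq1.
by rewrite map_polyXsubC hornerXsubC subrr.
Qed.

Lemma separable_eltB a b : separable_elt a -> separable_elt b -> separable_elt (a - b).
Proof.
have [e|nz] := eqVneq (1 : A) 0; first by move=> _ _; exact: separable_elt_zero.
have [R [j EA]] := nz_algebra nz; subst A => sa sb.
have := separable_elt_eval2 ('X%:P - 'X) sa sb.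
by rewrite rmorphB eval2_C eval2E !map_polyX !hornerX.
Qed.

Lemma separable_eltM a b : separable_elt a -> separable_elt b -> separable_elt (a * b).
Proof.
have [e|nz] := eqVneq (1 : A) 0; first by move=> _ _; exact: separable_elt_zero.
have [R [j EA]] := nz_algebra nz; subst A => sa sb.
have := separable_elt_eval2 ('X%:P * 'X) sa sb.
by rewrite rmorphM eval2_C eval2E !map_polyX !hornerX.
Qed.

End SeparableElements.

Lemma separable_elt_hom (k : fieldType) (A B : algebra k) (f : {rmorphism A -> B})
    (s : {rmorphism k -> k}) (a : A) :
  (forall c, f (alg_in A c) = alg_in B (s c)) -> separable_elt a -> separable_elt (f a).
Proof.
move=> fin [p [sp pa]]; exists (map_poly s p); split; first by rewrite separable_map.
have <- : f (alg_eval p a) = 0 by rewrite pa rmorph0.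
rewrite /alg_eval size_map_poly rmorph_sum; apply: eq_bigr => i _.
by rewrite rmorphM rmorphXn fin coef_map.
Qed.

Lemma alg_hom_ind_etale (k : fieldType) (A B : algebra k) (f : alg_hom A B) :
  (forall b, exists a, f a = b) -> ind_etale A -> ind_etale B.
Proof.
move=> fs iA b; have [a <-] := fs b.
by apply: (@separable_elt_hom _ _ _ f idfun) => // c; rewrite alg_fun_in.
Qed.

Section SeparablePart.
Variables (k : diff_field) (K : sep_closure k) (B : diff_algebra k).

(* K only serves the proof that the separable elements form a subring. *)
Definition sep_pred (_ : sep_closure k) : {pred B} :=
  [pred b | `[< separable_elt b >]].

Lemma sep_predP b : b \in sep_pred K <-> separable_elt b.
Proof. by rewrite unfold_in /=; split=> /asboolP. Qed.

Lemma sep_subring_closed : subring_closed (sep_pred K).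
Proof.
split=> [|a b /sep_predP sa /sep_predP sb|a b /sep_predP sa /sep_predP sb];
  apply/sep_predP.
- by rewrite -(rmorph1 (alg_in B)); exact: separable_elt_in.
- exact: (separable_eltB K).
- exact: (separable_eltM K).
Qed.

Record sep_part := SepPart { sep_val : B; sep_valP : sep_val \in sep_pred K }.

HB.instance Definition _ := [isSub for sep_val].
HB.instance Definition _ := [Choice of sep_part by <:].
HB.instance Definition _ := GRing.SubChoice_isSubComPzRing.Build
  B (sep_pred K) sep_part sep_subring_closed.

Definition sep_in (c : k) : sep_part :=
  SepPart ((sep_predP _).2 (separable_elt_in B c)).

Lemma sep_in_zmod : zmod_morphism sep_in.
Proof. by move=> a b; apply: val_inj; exact: rmorphB. Qed.

Lemma sep_in_monoid : monoid_morphism sep_in.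
Proof. by split=> [|a b]; apply: val_inj; [exact: rmorph1|exact: rmorphM]. Qed.

Definition sep_algebra : algebra k :=
  @Algebra k sep_part (mk_rmorphism sep_in_zmod sep_in_monoid).

Lemma sep_sigma_subproof (b : sep_part) : da_sigma B (val b) \in sep_pred K.
Proof.
apply/sep_predP; apply: (@separable_elt_hom _ _ _ (da_sigma B) (df_sigma k)).
  exact: da_sigma_in.
by apply/sep_predP; exact: valP.
Qed.

Definition sep_sigma (b : sep_part) : sep_part := SepPart (sep_sigma_subproof b).

Lemma sep_sigma_zmod : zmod_morphism sep_sigma.
Proof. by move=> a b; apply: val_inj; exact: rmorphB. Qed.

Lemma sep_sigma_monoid : monoid_morphism sep_sigma.
Proof. by split=> [|a b]; apply: val_inj; [exact: rmorph1|exact: rmorphM]. Qed.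

Program Definition sep_diff_algebra : diff_algebra k :=
  @DiffAlgebra k sep_algebra (mk_rmorphism sep_sigma_zmod sep_sigma_monoid) _.
Next Obligation. by move=> c; apply: val_inj; exact: da_sigma_in. Qed.

Definition sep_incl_rmorphism : {rmorphism sep_diff_algebra -> B} :=
  (val : sep_part -> B).

Program Definition sep_incl_alg : alg_hom sep_diff_algebra B :=
  @AlgHom k sep_diff_algebra B sep_incl_rmorphism _.
Next Obligation. by []. Qed.

Program Definition sep_incl : da_hom sep_diff_algebra B :=
  @DaHom k sep_diff_algebra B sep_incl_alg _.
Next Obligation. by []. Qed.

Lemma sep_incl_inj : injective sep_incl.
Proof. exact: val_inj. Qed.

Lemma sep_ind_etale : diff_locally_etale sep_diff_algebra.
Proof.
move=> b; case: ((sep_predP _).1 (valP b)) => p [sp pb]; exists p; split=> //.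
apply: sep_incl_inj; rewrite rmorph0 -pb /alg_eval rmorph_sum; apply: eq_bigr => i _.
by rewrite rmorphM rmorphXn.
Qed.

Lemma sep_lift (A : algebra k) (f : alg_hom A B) : ind_etale A ->
  exists f' : alg_hom A sep_diff_algebra, forall a, sep_incl (f' a) = f a.
Proof.
move=> iA.
have sf a : f a \in sep_pred K.
  apply/sep_predP; apply: (@separable_elt_hom _ _ _ f idfun) (iA a) => c.
  exact: alg_fun_in.
pose v a : sep_diff_algebra := SepPart (sf a).
have vB : zmod_morphism v by move=> a b; apply: val_inj; exact: rmorphB.
have vM : monoid_morphism v.
  by split=> [|a b]; apply: val_inj; [exact: rmorph1|exact: rmorphM].
have vin c : mk_rmorphism vB vM (alg_in A c) = alg_in sep_diff_algebra c.
  by apply: val_inj; exact: alg_fun_in.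
by exists (@AlgHom k A sep_diff_algebra (mk_rmorphism vB vM) vin).
Qed.

Lemma sep_lift_da (A : diff_algebra k) (f : da_hom A B) : ind_etale A ->
  exists f' : da_hom A sep_diff_algebra, forall a, sep_incl (f' a) = f a.
Proof.
move=> iA; have [f' f'E] := sep_lift f iA.
have f's a : f' (da_sigma A a) = da_sigma sep_diff_algebra (f' a).
  apply: sep_incl_inj; rewrite f'E da_fun_sigma -f'E.
  exact: (esym (da_fun_sigma sep_incl _)).
by exists (DaHom f's).
Qed.

End SeparablePart.

(** * Profinite spaces *)

(** If [P A] failed, the sets [B] with [P (A \ B)] would form a proper filter; at a cluster point of
    it, a neighbourhood satisfying [P] would meet its own complement. *)
Lemma compact_ind (X : topologicalType) (A : set X) (P : set (set X)) :
  compact A -> P set0 -> (forall B C, P B -> P C -> P (B `|` C)) ->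
  (forall B C, B `<=` C -> P C -> P B) ->
  (forall x, A x -> exists2 U, nbhs x U & P U) -> P A.
Proof.
move=> cA P0 PU PS locP; apply: contrapT => nPA.
pose F : set_system X := [set B | P (A `\` B)].
have FF : Filter F.
  split=> [|B C FB FC|B C BC]; rewrite /F /=.
  - by apply: PS P0; rewrite setDT.
  - by rewrite setDIr; exact: PU.
  - by apply: PS; exact: setDS.
have PF : ProperFilter F.
  by split=> // FE; apply: nPA; apply: PS FE => x Ax; split.
have [|x [Ax clx]] := cA F PF; first by apply: PS P0 => x [].
have [U xU PUx] := locP x Ax.
have FU : F (~` U) by apply: PS PUx => y [_ /contrapT].
by have [y [/= nUy Uy]] := clx _ _ FU xU.
Qed.

Definition locally_constant (X : topologicalType) (T : Type) (f : X -> T) :=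
  forall x, \forall y \near x, f y = f x.

Lemma locally_constant_finite (X : topologicalType) (T : Type) (f : X -> T) :
  compact [set: X] -> locally_constant f -> finite_set (range f).
Proof.
move=> cX lf; apply: (compact_ind (P := fun B => finite_set (f @` B)) cX).
- by rewrite image_set0; exact: finite_set0.
- by move=> B C fB fC; rewrite image_setU finite_setU.
- by move=> B C BC; apply: sub_finite_set; exact: image_subset.
move=> x _; exists [set y | f y = f x]; first exact: lf.
by apply: (sub_finite_set _ (finite_set1 (f x))) => _ [y /= -> <-].
Qed.

Lemma locally_constant_clopen (X : topologicalType) (T : Type) (f : X -> T) (V : set T) :
  locally_constant f -> clopen (f @^-1` V).
Proof.
have oV W : locally_constant f -> open (f @^-1` W).
  move=> lf; rewrite openE => x /= Wx; apply: filterS (lf x) => y /= fy.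
  by rewrite fy.
by move=> lf; split; [exact: oV|rewrite -openC preimage_setC; exact: oV].
Qed.

(** Two uses of compactness: over the complement of [D], to find around each point of [D] a member
    of [C] inside [D]; then over [D], to cover it by finitely many of these. *)
Lemma clopen_generated (X : topologicalType) (C : set (set X)) : compact [set: X] ->
  (forall A, C A -> open A) -> C setT -> (forall A, C A -> C (~` A)) ->
  (forall A B, C A -> C B -> C (A `&` B)) ->
  (forall x y, x <> y -> exists A, [/\ C A, A x & ~ A y]) ->
  forall D, clopen D -> C D.
Proof.
move=> cX Co CT CC CI Csep D [oD cD].
have CU A B : C A -> C B -> C (A `|` B).
  by move=> ? ?; rewrite -[_ `|` _]setCK setCU; apply: (CC); apply: CI; exact: CC.
have sep x : D x -> exists E, [/\ C E, E x & E `<=` D].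
  move=> Dx; have cDc : compact (~` D).
    by apply: subclosed_compact cX _ => //; rewrite closedC.
  have [|||y nDy|E [CE Ex sE]] := compact_ind
    (P := fun B => exists E, [/\ C E, E x & E `&` B = set0]) cDc.
  - by exists setT; rewrite setI0.
  - move=> B1 B2 [E1 [C1 x1 e1]] [E2 [C2 x2 e2]]; exists (E1 `&` E2); split=> //.
      exact: CI.
    rewrite setIUr -[RHS]setU0; congr (_ `|` _).
      by rewrite setIAC e1 set0I.
    by rewrite -setIA e2 setI0.
  - move=> B1 B2 sB [E [CE Ex e]]; exists E; split=> //.
    by apply/seteqP; split=> // z [Ez /sB Bz]; rewrite -e.
  - have [E [CE Ex nEy]] : exists E, [/\ C E, E x & ~ E y].
      by apply: Csep => xy; apply: nDy; rewrite -xy.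
    exists (~` E); last by exists E; rewrite setICr.
    by apply: open_nbhs_nbhs; split=> //; apply: Co; exact: CC.
  by exists E; split=> // z Ez; apply: contrapT => nDz; have : set0 z by rewrite -sE.
have [||||E [CE sDE sED]] := compact_ind
  (P := fun B => exists E, [/\ C E, B `&` D `<=` E & E `<=` D])
  (subclosed_compact cD cX (@subsetT _ _)).
- exists set0; split; rewrite ?set0I //.
  by rewrite -setCT; exact: CC.
- move=> B1 B2 [E1 [C1 x1 e1]] [E2 [C2 x2 e2]]; exists (E1 `|` E2); split.
  + exact: CU.
  + by rewrite setIUl; exact: setUSS.
  + by rewrite subUset.
- move=> B1 B2 sB [E [CE s1 s2]]; exists E; split=> //.
  by apply: subset_trans s1; exact: setSI.
- move=> x /sep[E [CE Ex sE]]; exists E.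
    by apply: open_nbhs_nbhs; split=> //; exact: Co.
  by exists E; split=> // z [].
by rewrite (_ : D = E) //; apply/seteqP; split=> // z Dz; apply: sDE.
Qed.

(* In a compact Hausdorff space the intersection of the clopen neighbourhoods
   of a point is connected. *)
Lemma profinite_zero_dimensional (X : topologicalType) :
  profinite X -> zero_dimensional X.
Proof.
move=> [cX hX tdX] x y xy.
pose Q := [set z | forall U, clopen U -> U x -> U z].
suff cQ : connected Q.
  apply: contrapT => nU; move/eqP: xy; apply; apply/esym.
  suff : connected_component [set: X] x y by rewrite tdX.
  have Qx : Q x by [].
  apply: (connected_component_max Qx (@subsetT _ _) cQ) => U cU Ux.
  by apply: contrapT => nUy; apply: nU; exists U.
have clQ : closed Q.
  rewrite (_ : Q = \bigcap_(U in [set U | clopen U /\ U x]) U); last first.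
    by apply/seteqP; split=> z h U; [move=> [cU Ux]; exact: h|move=> cU Ux; exact: h].
  by apply: closed_bigI => U [[]].
move=> B [b0 Bb0] [C oC BC] [D cD BD].
have clB : closed B by rewrite BD; exact: closedI.
have nbB : set_nbhs B (~` (Q `&` ~` C)).
  apply/set_nbhsP; exists (~` (Q `&` ~` C)); split=> //.
    by apply: closed_openC; apply: closedI => //; exact: open_closedC.
  by rewrite {1}BC => z [Qz Cz] [].
have [W /set_nbhsP[U [oU BU UW]] clW] := compact_normal hX cX clB nbB.
pose V := ~` closure W.
have UV z : U z -> V z -> False by move=> /UW /(@subset_closure _ W).
have oV : open V by apply: closed_openC; exact: closed_closure.
have QUV z : Q z -> U z \/ V z.
  move=> Qz; have [Cz|nCz] := pselect (C z); first by left; apply: BU; rewrite BC.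
  by right=> /clW; apply.
have clUV : closed (~` (U `|` V)) by rewrite closedC; exact: openU.
(* By compactness some clopen [E] around [x] already lies in the union of [U] and [V]. Its traces on
   [U] and [V] are then clopen, and the one that contains [x] contains all of [Q]. *)
have [||||E [cE Ex E0]] := compact_ind
  (P := fun R => exists E, [/\ clopen E, E x & E `&` R `<=` set0])
  (subclosed_compact clUV cX (@subsetT _ _)).
- by exists setT; split; [exact: clopenT| |rewrite setI0].
- move=> B1 B2 [E1 [c1 x1 e1]] [E2 [c2 x2 e2]]; exists (E1 `&` E2); split=> //.
    exact: clopenI.
  by move=> z [[z1 z2] [zB|zB]]; [exact: (e1 z)|exact: (e2 z)].
- by move=> B1 B2 sB [E [cE Ex e]]; exists E; split=> // z [Ez /sB Bz]; exact: (e z).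
- move=> z nz; have nQz : ~ Q z by move=> /QUV.
  move/existsNP: nQz => [E /not_implyP[cE /not_implyP[Ex nEz]]].
  exists (~` E); last by exists E; split=> //; rewrite setICr.
  by apply: open_nbhs_nbhs; split=> //; exact: closed_openC cE.2.
have EUV z : E z -> U z \/ V z.
  by move=> Ez; apply: contrapT => n; apply: (E0 z); split.
have cEU : clopen (E `&` U).
  split; first exact: openI cE.1 oU.
  rewrite (_ : _ `&` _ = E `&` ~` V); first by apply: closedI; [exact: cE.2|exact: open_closedC].
  apply/seteqP; split=> z [Ez h]; split=> //; first by move=> Vz; exact: UV h Vz.
  by case: (EUV z Ez).
have cEV : clopen (E `&` V).
  split; first exact: openI cE.1 oV.
  rewrite (_ : _ `&` _ = E `&` ~` U); first by apply: closedI; [exact: cE.2|exact: open_closedC].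
  apply/seteqP; split=> z [Ez h]; split=> //; first by move=> Uz; exact: UV Uz h.
  by case: (EUV z Ez).
have [Ux|Vx] := EUV x Ex.
  apply/seteqP; split=> z; first by rewrite BC => -[].
  move=> Qz; have [_ Uz] := Qz _ cEU (conj Ex Ux).
  rewrite BC; split=> //; apply: contrapT => nCz.
  by apply: (UV z) => //= /clW; apply.
exfalso; have Qb0 : Q b0 by move: Bb0; rewrite BC => -[].
by have [_ Vb] := Qb0 _ cEV (conj Ex Vx); apply: (UV b0) => //; exact: BU.
Qed.

(** * Rings of equivariant functions *)

(** There is no difference operator here, as the duals of algebras over the underlying field carry
    none. Zero-dimensionality is the form of total disconnectedness that supplies clopen sets. *)
Record Gspace (G : diff_profinite_group) := GSpace {
  sp_space :> topologicalType;
  sp_compact : compact [set: sp_space];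
  sp_zero_dim : zero_dimensional sp_space;
  sp_act : G -> sp_space -> sp_space;
  sp_act1 : forall x, sp_act (gp_one G) x = x;
  sp_actM : forall g h x, sp_act (gp_mul g h) x = sp_act g (sp_act h x);
  sp_act_continuous : continuous (fun u : G * sp_space => sp_act u.1 u.2) }.

Section EquivariantFunctions.
Variables (k : diff_field) (K : sep_closure k).
Local Notation KA := (sc_algebra K).
Local Notation G := (galois_group K).

Lemma sp_actK (X : Gspace G) (g : G) (x : X) : sp_act (gp_inv g) (sp_act g x) = x.
Proof. by rewrite -sp_actM gp_mulV sp_act1. Qed.

Lemma gal_mulgV (g : G) : gp_mul g (gp_inv g) = gp_one G.
Proof. by apply: gal_ext => x; exact: gal_invKV. Qed.

Lemma sp_actKV (X : Gspace G) (g : G) (x : X) : sp_act g (sp_act (gp_inv g) x) = x.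
Proof. by rewrite -sp_actM gal_mulgV sp_act1. Qed.

Variable X : Gspace G.

Definition ef_pred : {pred X -> K} := [pred f : X -> K |
  `[< locally_constant f /\ forall (g : G) x, f (sp_act g x) = gal_fun g (f x) >]].

Lemma ef_predP (f : X -> K) : f \in ef_pred <->
  locally_constant f /\ forall (g : G) x, f (sp_act g x) = gal_fun g (f x).
Proof. by rewrite unfold_in /=; split=> /asboolP. Qed.

Lemma ef_subring_closed : subring_closed ef_pred.
Proof.
split=> [|f h /ef_predP[lf ef] /ef_predP[lh eh]|f h /ef_predP[lf ef] /ef_predP[lh eh]];
  apply/ef_predP; split.
- by move=> x; apply: nearW.
- by move=> g x; rewrite rmorph1.
- by move=> x; apply: filterS2 (lf x) (lh x) => y /= e1 e2; rewrite !fctE e1 e2.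
- by move=> g x; rewrite !fctE ef eh rmorphB.
- by move=> x; apply: filterS2 (lf x) (lh x) => y /= e1 e2; rewrite !fctE e1 e2.
- by move=> g x; rewrite !fctE ef eh rmorphM.
Qed.

Record eqfun := EqFun { ef_fun : X -> K; ef_funP : ef_fun \in ef_pred }.

HB.instance Definition _ := [isSub for ef_fun].
HB.instance Definition _ := [Choice of eqfun by <:].
HB.instance Definition _ := GRing.SubChoice_isSubComPzRing.Build
  (X -> K) ef_pred eqfun ef_subring_closed.

Definition mk_ef (f : X -> K) (lf : locally_constant f)
    (ef : forall (g : G) x, f (sp_act g x) = gal_fun g (f x)) : eqfun :=
  EqFun ((ef_predP f).2 (conj lf ef)).

Lemma ef_locally_constant (a : eqfun) : locally_constant (ef_fun a).
Proof. by have [] := (ef_predP _).1 (ef_funP a). Qed.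

Lemma ef_act (a : eqfun) g x : ef_fun a (sp_act g x) = gal_fun g (ef_fun a x).
Proof. by have [_] := (ef_predP _).1 (ef_funP a). Qed.

Lemma ef_ext (a b : eqfun) : ef_fun a =1 ef_fun b -> a = b.
Proof. by move=> /funext ab; apply: val_inj. Qed.

Program Definition ef_in (c : k) : eqfun := @mk_ef (fun=> sc_in K c) _ _.
Next Obligation. by move=> c x; apply: nearW. Qed.
Next Obligation. by move=> c g x /=; rewrite (alg_fun_in (gal_fun g)). Qed.

Lemma ef_in_zmod : zmod_morphism ef_in.
Proof. by move=> a b; apply: ef_ext => x; exact: rmorphB. Qed.

Lemma ef_in_monoid : monoid_morphism ef_in.
Proof. by split=> [|a b]; apply: ef_ext => x; [exact: rmorph1|exact: rmorphM]. Qed.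

Definition ef_algebra : algebra k :=
  @Algebra k eqfun (mk_rmorphism ef_in_zmod ef_in_monoid).

Definition ef_eval_fun (x : X) (a : ef_algebra) : KA := ef_fun a x.

Lemma ef_eval_zmod x : zmod_morphism (ef_eval_fun x).
Proof. by []. Qed.

Lemma ef_eval_monoid x : monoid_morphism (ef_eval_fun x).
Proof. by []. Qed.

Program Definition ef_eval (x : X) : alg_hom ef_algebra KA :=
  @AlgHom k ef_algebra KA (mk_rmorphism (ef_eval_zmod x) (ef_eval_monoid x)) _.
Next Obligation. by []. Qed.

(** By compactness a function takes finitely many values, and by equivariance the Galois group
    permutes them. The product of the [X - v] over these values descends to [k] and kills the
    function. *)
Lemma ef_ind_etale : ind_etale ef_algebra.
Proof.
move=> a; have /finite_seqP[V EV] :=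
  locally_constant_finite (@sp_compact _ X) (@ef_locally_constant a).
have memV x : ef_fun a x \in undup V.
  rewrite mem_undup; suff : [set` V] (ef_fun a x) by [].
  by rewrite -EV; exists x.
have [|r Er] := @sc_poly_fixed k K (\prod_(v <- undup V) ('X - v%:P)).
  move=> g; apply: prod_XsubC_stable; first exact: undup_uniq.
  move=> v; rewrite mem_undup => vV; have : [set` V] v by [].
  by rewrite -EV => -[x _ <-]; rewrite -ef_act.
exists r; split; first by rewrite -(separable_map (sc_in K)) -Er separable_prod_XsubC undup_uniq.
apply: ef_ext => x; have := alg_eval_hom (ef_eval x) r a; rewrite -Er => e.
apply: (etrans e); apply/eqP; rewrite -/(root _ _) root_prod_XsubC; exact: memV.
Qed.

(** The coefficients range over all of [K], so a combination need not be equivariant. The length is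
    recorded for the minimality argument of the descent. *)
Definition kspan (V : set ef_algebra) (n : nat) (f : X -> K) :=
  exists (c : 'I_n -> K) (v : 'I_n -> ef_algebra),
    (forall i, V (v i)) /\ (forall x, f x = \sum_i c i * ef_fun (v i) x).

(* If a coefficient of a shortest combination is moved by g, then subtracting
   the g-conjugate combination yields a shorter one. *)
Lemma kspan_descent (V : set ef_algebra) n (a : ef_algebra) :
  submodule V -> kspan V n (ef_fun a) -> V a.
Proof.
move=> [V0 VD VZ] san.
have exn : exists n, `[< kspan V n (ef_fun a) >] by exists n; apply/asboolP.
case: (ex_minnP exn) => {n san}n /asboolP[c [v [Vv E]]] min.
have [fix_c|] := pselect (forall i (g : G), gal_fun g (c i) = c i).
  have /choice[d dE] i : exists d, c i = sc_in K d by apply: sc_fixed.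
  suff -> : a = \sum_i alg_in ef_algebra (d i) * v i.
    by elim/big_ind: _ => // i _; exact: VZ.
  apply: ef_ext => x; rewrite E -[RHS]/(ef_eval x _) rmorph_sum; apply: eq_bigr => i _.
  by rewrite rmorphM alg_fun_in dE.
move=> /existsNP[j /existsNP[g /eqP gcj]]; exfalso.
case: n c v Vv E min j gcj => [|n] c v Vv E min j gcj; first by case: j gcj.
pose d i := gal_fun g (c i) - c i.
have dj : d j != 0 by rewrite subr_eq0.
have sd y : \sum_i d i * ef_fun (v i) y = 0.
  have -> : \sum_i d i * ef_fun (v i) y =
      \sum_i gal_fun g (c i) * ef_fun (v i) y - \sum_i c i * ef_fun (v i) y.
    by rewrite -sumrB; apply: eq_bigr => i _; rewrite mulrBl.
  apply/eqP; rewrite subr_eq0 -E; apply/eqP/esym.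
  rewrite -{1}(sp_actKV g y) ef_act E rmorph_sum; apply: eq_bigr => i _.
  by rewrite rmorphM -ef_act sp_actKV.
suff : (n.+1 <= n)%N by rewrite ltnn.
apply: min; apply/asboolP.
exists (fun i => c (lift j i) - c j * d (lift j i) / d j), (fun i => v (lift j i)).
split=> // x; rewrite E (bigD1_ord j) //=.
have := sd x; rewrite (bigD1_ord j) //= => /eqP; rewrite addr_eq0 => /eqP e.
have {}e : ef_fun (v j) x = - (d j)^-1 * \sum_(i < n) d (lift j i) * ef_fun (v (lift j i)) x.
  by apply: (mulfI dj); rewrite e mulrA mulrN mulfV // mulN1r.
rewrite e mulrA mulr_sumr -big_split /=; apply: eq_bigr => i _.
move: (d (lift j i)) (d j)^-1 (c j) (c _) (ef_fun _ x) => d1 u c1 c2 y.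
rewrite mulrBl mulrN mulNr addrC; congr (_ - _).
by rewrite -!mulrA [u * _]mulrCA.
Qed.

End EquivariantFunctions.

(** * Density of separating subalgebras *)

Lemma lagrange_indicator (F : fieldType) (S : seq F) (t : F) :
  exists p : {poly F}, p.[t] = 1 /\ forall s, s \in S -> s != t -> p.[s] = 0.
Proof.
exists (\prod_(s <- S | s != t) ((t - s)^-1 *: ('X - s%:P))); split.
  rewrite horner_prod big1_seq // => s /andP[st _].
  by rewrite hornerZ hornerXsubC mulVf // subr_eq0 eq_sym.
move=> s sS st; rewrite horner_prod; apply/eqP; rewrite prodf_seq_eq0.
by apply/hasP; exists s; rewrite //= st hornerZ hornerXsubC subrr mulr0 /=.
Qed.

Section Density.
Variables (k : diff_field) (K : sep_closure k).
Local Notation KA := (sc_algebra K).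
Local Notation G := (galois_group K).
Variable X : Gspace G.
Variable V : set (ef_algebra X).
Hypothesis Vin : forall c, V (alg_in _ c).
Hypothesis VB : forall a b, V a -> V b -> V (a - b).
Hypothesis VM : forall a b, V a -> V b -> V (a * b).
Hypothesis Vsep : forall x y : X, x <> y -> exists2 v, V v & ef_fun v x <> ef_fun v y.

Definition kcomb (f : X -> K) := exists n, kspan V n f.

Lemma kcomb_ext f h : f =1 h -> kcomb f -> kcomb h.
Proof. by move=> fh [n [c [v [Vv E]]]]; exists n, c, v; split=> // x; rewrite -fh. Qed.

Lemma kcomb_mem c v : V v -> kcomb (fun x => c * ef_fun v x).
Proof.
by move=> Vv; exists 1%N, (fun=> c), (fun=> v); split=> // x; rewrite big_ord1.
Qed.

Lemma kcombD f h : kcomb f -> kcomb h -> kcomb (fun x => f x + h x).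
Proof.
move=> [n [c [v [Vv E]]]] [m [c' [v' [Vv' E']]]].
exists (n + m)%N, (fun i : 'I_(n + m) => match fintype.split i with inl i => c i | inr i => c' i end).
exists (fun i : 'I_(n + m) => match fintype.split i with inl i => v i | inr i => v' i end).
split=> [i|x]; first by case: fintype.split.
rewrite E E' big_split_ord; congr (_ + _); apply: eq_bigr => i _.
  by case: (fintype.split _) (unsplitK (inl i : 'I_n + 'I_m)) => j // [->].
by case: (fintype.split _) (unsplitK (inr i : 'I_n + 'I_m)) => j // [->].
Qed.

Lemma kcomb0 : kcomb (fun=> 0).
Proof. by exists 0%N, (fun=> 0), (fun=> 0); split=> [[]|x] //; rewrite big_ord0. Qed.

Lemma kcomb_sum (I : Type) (r : seq I) (F : I -> X -> K) :
  (forall i, kcomb (F i)) -> kcomb (fun x => \sum_(i <- r) F i x).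
Proof.
move=> kF; elim: r => [|i r IH].
  by apply: kcomb_ext kcomb0 => x; rewrite big_nil.
by apply: kcomb_ext (kcombD (kF i) IH) => x; rewrite big_cons.
Qed.

Lemma kcombZ c f : kcomb f -> kcomb (fun x => c * f x).
Proof.
move=> [n [d [v [Vv E]]]]; exists n, (fun i => c * d i), v; split=> // x.
by rewrite E mulr_sumr; apply: eq_bigr => i _; rewrite mulrA.
Qed.

Lemma kcombM f h : kcomb f -> kcomb h -> kcomb (fun x => f x * h x).
Proof.
move=> [n [c [v [Vv E]]]] [m [c' [v' [Vv' E']]]].
apply: (@kcomb_ext (fun x => \sum_i \sum_j (c i * c' j) * ef_fun (v i * v' j) x)).
  move=> x; rewrite E mulr_suml; apply: eq_bigr => i _.
  by rewrite E' mulr_sumr; apply: eq_bigr => j _; rewrite mulrACA.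
apply: kcomb_sum => i; apply: kcomb_sum => j; apply: kcomb_mem; exact: VM.
Qed.

Lemma kcomb_cst c : kcomb (fun=> c).
Proof.
apply: kcomb_ext (kcomb_mem c (Vin 1)) => x.
by rewrite rmorph1 -[ef_fun 1 x]/(1 : K) mulr1.
Qed.

Lemma kcomb_poly (p : {poly K}) f : kcomb f -> kcomb (fun x => p.[f x]).
Proof.
move=> kf; elim/poly_ind: p => [|p c IH].
  by apply: kcomb_ext kcomb0 => x; rewrite horner0.
apply: kcomb_ext (kcombD (kcombM IH kf) (kcomb_cst c)) => x.
by rewrite hornerMXaddC.
Qed.

Lemma kcomb_locally_constant f : kcomb f -> locally_constant f.
Proof.
move=> [n [c [v [Vv E]]]] x.
have : \forall y \near x, forall i, ef_fun (v i) y = ef_fun (v i) x.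
  by apply: filter_forall => i; exact: ef_locally_constant.
by apply: filterS => y e; rewrite !E; apply: eq_bigr => i _; rewrite e.
Qed.

Definition indic (C : set X) (x : X) : K := (`[< C x >])%:R.

(** The sets whose indicator lies in the [K]-span of [V] form a Boolean algebra. A Lagrange
    polynomial in a separating [v] is the indicator of a fibre of [v], so this algebra separates
    points and [clopen_generated] applies. *)
Lemma kcomb_indic C : clopen C -> kcomb (indic C).
Proof.
have cX := @sp_compact _ X.
apply: (clopen_generated (C := fun C => kcomb (indic C))) => //.
- move=> A /kcomb_locally_constant lA.
  rewrite (_ : A = indic A @^-1` [set 1]); first by case: (locally_constant_clopen [set 1] lA).
  apply/seteqP; split=> x /=; rewrite /indic; first by move=> Ax; rewrite asboolT.
  by case: asboolP => // _ /eqP; rewrite eq_sym oner_eq0.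
- by apply: kcomb_ext (kcomb_cst 1) => x; rewrite /indic asboolT.
- move=> A kA; apply: kcomb_ext (kcombD (kcomb_cst 1) (kcombM (kcomb_cst (-1)) kA)) => x.
  rewrite /indic asbool_neg mulN1r.
  by case: asboolP => _; rewrite ?subrr ?subr0.
- move=> A B kA kB; apply: kcomb_ext (kcombM kA kB) => x.
  by rewrite /indic asbool_and; case: asboolP; case: asboolP; rewrite ?mulr0 ?mulr1.
- move=> x y /Vsep[v Vv vxy].
  have /finite_seqP[S ES] := locally_constant_finite cX (@ef_locally_constant _ _ _ v).
  have [p [p1 p0]] := lagrange_indicator S (ef_fun v x).
  exists [set z | ef_fun v z = ef_fun v x]; split=> //; last by move=> /esym.
  have kv := kcomb_mem 1 Vv.
  apply: kcomb_ext (kcomb_poly p kv) => z; rewrite mul1r /indic.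
  case: asboolP => /= [->//|/eqP ne]; apply: p0 => //.
  suff : [set` S] (ef_fun v z) by [].
  by rewrite -ES; exists z.
Qed.

(** The function [a] is a combination, with its values as coefficients, of the indicators of its
    fibres. This puts it in the [K]-span of [V], and [kspan_descent] brings it back to [V]. *)
Lemma ef_dense a : V a.
Proof.
have cX := @sp_compact _ X.
have /finite_seqP[S ES] := locally_constant_finite cX (@ef_locally_constant _ _ _ a).
have : kcomb (fun x => \sum_(s <- undup S) s * indic (ef_fun a @^-1` [set s]) x).
  apply: kcomb_sum => s; apply: kcombM; first exact: kcomb_cst.
  by apply: kcomb_indic; apply: locally_constant_clopen; exact: ef_locally_constant.
have sV : submodule V.
  have V0 : V 0 by rewrite -(rmorph0 (alg_in (ef_algebra X))).
  split=> // [b c Vb Vc|c b Vb]; last exact: VM.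
  by rewrite -[c]opprK -[- c]sub0r; apply: (VB) => //; exact: VB.
move=> /(@kcomb_ext _ (ef_fun a))[|n]; last exact: kspan_descent.
move=> x; have aS : ef_fun a x \in undup S.
  rewrite mem_undup; suff : [set` S] (ef_fun a x) by [].
  by rewrite -ES; exists x.
rewrite (bigD1_seq (ef_fun a x)) ?undup_uniq //= /indic asboolT // mulr1 big1 ?addr0 //.
move=> s sa; case: asboolP; rewrite ?mulr0 //= => e.
by rewrite e eqxx in sa.
Qed.

End Density.

Section PointsOfAlgebra.
Variables (k : diff_field) (K : sep_closure k).
Local Notation KA := (sc_algebra K).
Local Notation G := (galois_group K).

Program Definition alg_points (A : algebra k) (iA : ind_etale A) : Gspace G :=
  @GSpace G (alg_hom A KA) (alg_hom_compact iA) (alg_hom_zero_dimensional iA)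
    (fun g h => alg_comp (gal_fun g) h) _ _ _.
Next Obligation. by move=> A iA h; apply: alg_hom_ext. Qed.
Next Obligation. by move=> A iA f g h; apply: alg_hom_ext. Qed.
Next Obligation.
move=> A iA [g h].
apply: (@continuous_comp _ _ _ (fun u : galois_space K * alg_hom A KA =>
  (gal_fun u.1, u.2)) (fun u => alg_comp u.1 u.2)); last first.
  exact: alg_comp_continuous.
have h1 : {for (g, h), continuous (fun u : galois_space K * alg_hom A KA => gal_fun u.1)}.
  by apply: (@continuous_comp _ _ _ fst); [exact: cvg_fst|exact: gal_fun_continuous].
have h2 : {for (g, h), continuous (fun u : galois_space K * alg_hom A KA => u.2)}.
  exact: cvg_snd.
exact: (cvg_pair h1 h2).
Qed.

Lemma alg_hom_value_locally_constant (A : algebra k) (a : A) : ind_etale A ->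
  locally_constant (fun h : alg_hom A KA => h a : K).
Proof.
move=> iA h; have [oE _] := alg_hom_eval_clopen a (h a) iA.
by apply: open_nbhs_nbhs.
Qed.

Program Definition alg_value (A : algebra k) (iA : ind_etale A) (a : A) :
    ef_algebra (alg_points iA) :=
  @mk_ef k K (alg_points iA) (fun h : alg_hom A KA => h a : K) _ _.
Next Obligation. by move=> A iA a; exact: alg_hom_value_locally_constant. Qed.
Next Obligation. by []. Qed.

Lemma alg_value_surj (A : algebra k) (iA : ind_etale A) (f : ef_algebra (alg_points iA)) :
  exists a, forall h : alg_hom A KA, ef_fun f h = h a.
Proof.
pose V := [set f : ef_algebra (alg_points iA) |
  exists a, forall h : alg_hom A KA, ef_fun f h = h a].
suff : V f by [].
apply: ef_dense.
- by move=> c; exists (alg_in A c) => h; rewrite alg_fun_in.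
- by move=> f1 f2 [a e] [b e']; exists (a - b) => h; rewrite rmorphB -e -e'.
- by move=> f1 f2 [a e] [b e']; exists (a * b) => h; rewrite rmorphM -e -e'.
move=> x y xy; have [a xya] : exists a, (x : alg_hom A KA) a <> (y : alg_hom A KA) a.
  apply: contrapT => nxy; apply: xy; apply: alg_hom_ext => a.
  by apply: contrapT => xya; apply: nxy; exists a.
by exists (alg_value iA a) => //; exists a.
Qed.

Lemma alg_hom_eq (A : algebra k) (iA : ind_etale A) (a b : A) :
  (forall h : alg_hom A KA, h a = h b) -> a = b.
Proof.
move=> e; apply: contrapT => ab.
have [|h] := @alg_hom_separates k K A (a - b) iA.
  by move=> /eqP; rewrite subr_eq0 => /eqP.
by rewrite rmorphB e subrr.
Qed.

End PointsOfAlgebra.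

(** * Separation of points, and homomorphisms as evaluations *)

Lemma clopen_locally_constant (X : topologicalType) (D : set X) :
  clopen D -> locally_constant (fun x => `[< D x >]).
Proof.
move=> [oD cD] x; have [Dx|nDx] := pselect (D x).
  by apply: filterS (open_nbhs_nbhs (conj oD Dx)) => y Dy; rewrite !asboolT.
by apply: filterS (open_nbhs_nbhs (conj (closed_openC cD) nDx)) => y Dy; rewrite !asboolF.
Qed.

Section SeparatePoints.
Variables (k : diff_field) (K : sep_closure k).
Local Notation KA := (sc_algebra K).
Local Notation G := (galois_group K).
Variable X : Gspace G.

Lemma gal_nbhsP (g : G) (Q : set G) : nbhs g Q ->
  exists2 B : set KA, fd_subalgebra B &
    forall h : G, (forall b, B b -> gal_fun h b = gal_fun g b) -> Q h.
Proof.
move=> [_ [[O oO <-] Og sO]].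
have [B [fB sB]] : nbhs (gal_fun g) O by exact: open_nbhs_nbhs.
by exists B => // h hg; apply: sO; exact: sB.
Qed.

Lemma gal_fun_near (g : G) (B : set KA) : fd_subalgebra B ->
  \forall h \near g, forall b, B b -> gal_fun h b = gal_fun g b.
Proof.
move=> fB; apply: (@gal_fun_continuous k K g
  [set h : alg_hom KA KA | forall b, B b -> h b = gal_fun g b]).
by exists B.
Qed.

(** Continuity of the action at [(1, x)] gives such a [B] near each [x] in [U]; compactness leaves
    finitely many, which lie in a common finite-dimensional subalgebra. *)
Lemma clopen_stable (U : set X) : clopen U ->
  exists2 B : set KA, fd_subalgebra B & forall g : G,
    (forall b, B b -> gal_fun g b = b) -> forall x, U x -> U (sp_act g x).
Proof.
move=> [oU cU]; have [||||B fB sB] := compact_ind (P := fun R =>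
  exists2 B : set KA, fd_subalgebra B & forall g : G,
    (forall b, B b -> gal_fun g b = b) -> forall x, R x -> U x -> U (sp_act g x))
  (@sp_compact _ X).
- by exists (range (alg_in KA)) => //; exact: fd_subalgebra0.
- move=> R1 R2 [B1 f1 h1] [B2 f2 h2]; have [B [fB s1 s2]] := fd_subalgebraU f1 f2.
  exists B => // g gB x [R1x|R2x].
    by apply: h1 => // b /s1; exact: gB.
  by apply: h2 => // b /s2; exact: gB.
- move=> R1 R2 sR [B fB h]; exists B => // g gB x /sR; exact: h.
- move=> x _; have [Ux|nUx] := pselect (U x); last first.
    exists (~` U); first by apply: open_nbhs_nbhs; split=> //; exact: closed_openC.
    by exists (range (alg_in KA)) => [|g _ y //]; exact: fd_subalgebra0.
  have := @sp_act_continuous _ X (gp_one G, x) U; rewrite /= sp_act1.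
  case=> [|[Q1 Q2] [/= /gal_nbhsP[B fB n1] n2] sQ]; first exact: open_nbhs_nbhs.
  exists Q2 => //; exists B => // g gB y Qy _.
  by apply: (sQ (g, y)); split=> //=; apply: n1 => b /gB ->.
by exists B => // g gB x; exact: sB.
Qed.

Lemma near_seq (T : eqType) (S : seq T) (b : T -> X -> bool) x :
  (forall v, v \in S -> \forall y \near x, b v y = b v x) ->
  \forall y \near x, [seq v <- S | b v y] = [seq v <- S | b v x].
Proof.
elim: S => [_|v S IH lS]; first exact: nearW.
have := lS v (mem_head _ _); apply: filterS2; last first.
  by apply: IH => w wS; apply: lS; rewrite inE wS orbT.
by move=> y /= -> ->.
Qed.

(* With U a clopen neighbourhood of x avoiding y and r a polynomial whose
   coefficients span a finite-dimensional algebra B with Fix(B) U = U, the set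
   S z of the conjugates g(r) such that z is in g U depends continuously and
   equivariantly on z; the coefficients of prod_(v in S z) (T - v) are
   equivariant functions, and r is a root for z = x but not for z = y. *)
Lemma ef_separates (x y : X) : x <> y ->
  exists a : ef_algebra X, ef_fun a x <> ef_fun a y.
Proof.
move=> /eqP/(@sp_zero_dim _ X)[U [cU Ux nUy]].
have [B fB UB] := clopen_stable cU; have [_ _ _ [s Es]] := fB.
(* Packing a spanning family into the coefficients of one polynomial replaces a primitive element:
   an automorphism that fixes [r] fixes [B] pointwise. *)
pose r : {poly K} := Poly s.
pose cj (g : G) := map_poly (gal_fun g) r.
have conj_fix (g : G) : cj g = r -> forall b, B b -> gal_fun g b = b.
  move=> gr b; rewrite Es => -[c ->]; rewrite rmorph_sum; apply: eq_bigr => i _.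
  rewrite rmorphM alg_fun_in; congr (_ * _).
  by have := congr1 (fun p : {poly K} => p`_i) gr; rewrite coef_map coef_Poly.
have cjM (g h : G) : cj (gp_mul g h) = map_poly (gal_fun g) (cj h).
  by rewrite /cj -map_poly_comp; apply: eq_map_poly.
have lconj : locally_constant cj.
  move=> g; apply: filterS (gal_fun_near g fB) => h hg.
  apply/polyP => i; rewrite !coef_map coef_Poly; apply: hg; rewrite Es.
  have [lt_i|le_i] := ltnP i (size s); first by apply: span_mem; exact: mem_nth.
  by rewrite nth_default //; have [] := span_submodule s.
have cG : compact [set: G] by have [] := gp_profinite G.
have /finite_seqP[R0 ER] := locally_constant_finite cG lconj.
pose R := undup R0.
have memR g : cj g \in R.
  by rewrite mem_undup; suff : [set` R0] (cj g) by []; rewrite -ER; exists g.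
have Uconj (g h : G) z : cj g = cj h -> U (sp_act (gp_inv g) z) ->
    U (sp_act (gp_inv h) z).
  move=> gh Ugz; rewrite -[z](sp_actKV g) -sp_actM; apply: UB => //.
  apply: conj_fix; rewrite cjM gh -cjM gp_mulV.
  by rewrite /cj map_poly_id.
pose b v z := `[< exists2 g : G, cj g = v & U (sp_act (gp_inv g) z) >].
have bE g z : b (cj g) z = `[< U (sp_act (gp_inv g) z) >].
  apply: asbool_equiv_eq; split=> [[h hg Uh]|Ug]; first exact: Uconj hg Uh.
  by exists g.
pose S z := [seq v <- R | b v z].
pose P z : {poly {poly K}} := \prod_(v <- S z) ('X - v%:P).
have lS : locally_constant S.
  move=> z; apply: near_seq => v; rewrite mem_undup => vR.
  have [g _ <-] : range cj v by rewrite ER.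
  have cg : continuous (fun z : X => sp_act (gp_inv g) z : X).
    move=> w; have := @continuous_comp _ _ _ (fun z : X => (gp_inv g : G, z))
      (fun u : G * X => sp_act u.1 u.2) w; apply; last exact: sp_act_continuous.
    have h1 : {for w, continuous (fun _ : X => gp_inv g : G)} by exact: cvg_cst.
    have h2 : {for w, continuous (fun z : X => z)} by exact: cvg_id.
    exact: (cvg_pair h1 h2).
  have cU' : clopen ((fun z => sp_act (gp_inv g) z) @^-1` U).
    exact: preimage_clopen.
  by apply: filterS (clopen_locally_constant cU' z) => z' e; rewrite !bE.
have S_act (h : G) z : perm_eq (S (sp_act h z)) (map (map_poly (gal_fun h)) (S z)).
  have h_inj : injective (map_poly (gal_fun h)) by exact: map_poly_inj.
  apply: uniq_perm; first exact/filter_uniq/undup_uniq.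
    by rewrite map_inj_uniq //; exact/filter_uniq/undup_uniq.
  have memS v w : (v \in S w) = (v \in R) && b v w by rewrite mem_filter andbC.
  have RP v : v \in R -> exists g, v = cj g.
    rewrite mem_undup => vR; have : [set` R0] v by [].
    by rewrite -ER => -[g _ <-]; exists g.
  have act_inv g w : sp_act (gp_inv (gp_mul h g)) (sp_act h w) = sp_act (gp_inv g) w.
    have := sp_actKV g w; set u := sp_act (gp_inv g) w => <-.
    by rewrite -(sp_actM h g) sp_actK.
  move=> v; rewrite memS; apply/andP/mapP => [[/RP[g ->]]|[w]].
    rewrite bE => /asboolP Ug; exists (cj (gp_mul (gp_inv h) g)).
      rewrite memS memR bE; apply/asboolP.
      by rewrite -act_inv gp_mulA gal_mulgV gp_mul1.
    by rewrite -cjM gp_mulA gal_mulgV gp_mul1.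
  rewrite memS => /andP[/RP[g ->]]; rewrite bE => /asboolP Ug ->.
  by rewrite -cjM memR bE act_inv; split=> //; apply/asboolP.
have P_act (h : G) z : P (sp_act h z) = map_poly (map_poly (gal_fun h)) (P z).
  rewrite /P (perm_big _ (S_act h z)) big_map rmorph_prod; apply: eq_bigr => v _.
  by rewrite /= map_polyXsubC.
have coefE i j : exists a : ef_algebra X, forall z, ef_fun a z = (P z)`_i`_j.
  have l z : \forall z' \near z, (P z')`_i`_j = (P z)`_i`_j.
    by apply: filterS (lS z) => z'; rewrite /P => ->.
  have e (g : G) z : (P (sp_act g z))`_i`_j = gal_fun g (P z)`_i`_j.
    by rewrite P_act !coef_map.
  by exists (mk_ef l e).
apply: contrapT => ne; have Pxy : P x = P y.
  apply/polyP => i; apply/polyP => j; have [a aE] := coefE i j.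
  rewrite -!aE; apply: contrapT => axy; apply: ne; by exists a.
have cj1 : cj (gp_one G) = r by rewrite /cj map_poly_id.
have act1 z : sp_act (gp_inv (gp_one G)) z = z.
  by rewrite -[LHS]sp_act1 sp_actKV.
have rS z : (r \in S z) = `[< U z >].
  by rewrite mem_filter -cj1 memR bE act1 andbT.
have rP z : (r \in S z) = root (P z) r by rewrite root_prod_XsubC.
by apply: nUy; apply/asboolP; rewrite -rS rP -Pxy -rP rS; apply/asboolP.
Qed.

Lemma ef_hom_eval (h : alg_hom (ef_algebra X) KA) :
  exists x, forall a, h a = ef_fun a x.
Proof.
have reg a := separable_elt_regular (@ef_ind_etale k K X a).
pose N (a : ef_algebra X) := h a = (0 : K).
have ND a b : N a -> N b -> N (a + b) by rewrite /N rmorphD => -> ->; rewrite addr0.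
have NM a b : N a -> N (b * a) by rewrite /N rmorphM => ->; rewrite mulr0.
(* The kernel has a common zero, since otherwise it would contain 1. *)
have [x xN] : exists x, forall a, N a -> ef_fun a x = 0.
  apply: contrapT => nx.
  have [|||x _|e Ne eX] := compact_ind (P := fun R =>
    exists2 e, N e & forall x, R x -> ef_fun e x = 1) (@sp_compact _ X).
  - by exists 0 => //; rewrite /N rmorph0.
  (* This combination is 1 wherever [e1] or [e2] is. *)
  - move=> R1 R2 [e1 N1 h1] [e2 N2 h2]; exists (e1 + (1 - e1) * e2).
      by apply: ND => //; exact: NM.
    move=> x; rewrite -[ef_fun _ x]/(ef_fun e1 x + (1 - ef_fun e1 x) * ef_fun e2 x).
    by case=> [/h1|/h2] ->; rewrite ?subrr ?mul0r ?addr0 // mulr1 addrC subrK.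
  - by move=> R1 R2 sR [e Ne e1]; exists e => // x /sR; exact: e1.
  - have [a [Na ax]] : exists a, N a /\ ef_fun a x <> 0.
      apply: contrapT => na; apply: nx; exists x => a Na.
      by apply: contrapT => ax; apply: na; exists a.
    (* By regularity [s * a] is an idempotent of the kernel, equal to 1 wherever [a] is nonzero. *)
    have [s as_] := reg a.
    exists [set y | ef_fun a y = ef_fun a x]; first exact: ef_locally_constant.
    exists (s * a); first exact: NM.
    move=> y /= ay; have := congr1 (fun a => ef_fun a y) as_.
    rewrite -[ef_fun (a * a * s) y]/(ef_fun a y * ef_fun a y * ef_fun s y) ay => /eqP.
    rewrite -mulrA -[X in _ == X]mulr1 (inj_eq (mulfI _)); last exact/eqP.
    by move=> /eqP <-; rewrite -[LHS]/(ef_fun s y * ef_fun a y) ay mulrC.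
  have e1 : e = 1 by apply: ef_ext => x; rewrite eX.
  by move: Ne; rewrite /N e1 rmorph1; apply/eqP/oner_neq0.
have [|g [gE _]] := @partial_hom_extend k K K (sc_in K) (@sc_algebraic k K) _
    (prime_ideal0 K) (range (fun a => (h a : K, ef_fun a x))).
  split=> [c|_ _ [a _ <-] [b _ <-]|_ _ [a _ <-] [b _ <-]|_ [a _ <-] /= Na].
  - by exists (alg_in _ c); rewrite // alg_fun_in.
  - by exists (a - b); rewrite // rmorphB.
  - by exists (a * b); rewrite // rmorphM.
  exact: xN.
exists (sp_act (gp_inv (gal_of g : G)) x) => a; rewrite ef_act.
have -> : ef_fun a x = gal_fun (gal_of g) (h a) by apply/esym/gE; exists a.
by rewrite gal_invK.
Qed.

End SeparatePoints.

(** * The duality *)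

Lemma near_all_seq (X : topologicalType) (T : eqType) (s : seq T) (Q : T -> X -> Prop) (x : X) :
  (forall t, t \in s -> \forall y \near x, Q t y) ->
  \forall y \near x, forall t, t \in s -> Q t y.
Proof.
elim: s => [_|t s IH Qs]; first by apply: nearW.
have := Qs t (mem_head _ _); apply: filterS2; last first.
  by apply: IH => u us; apply: Qs; rewrite inE us orbT.
by move=> y /= Qsy Qt u; rewrite inE => /orP[/eqP->|/Qsy].
Qed.

Lemma alg_hom_continuous (k : fieldType) (A B : algebra k) (X : topologicalType)
    (f : X -> alg_hom A B) :
  (forall a, locally_constant (fun x => f x a)) -> continuous f.
Proof.
move=> lf x U [A' [[_ _ _ [s Es]] sU]].
have : \forall y \near x, forall a, a \in s -> f y a = f x a.
  by apply: near_all_seq => a _; exact: lf.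
apply: filterS => y e; apply: sU => a; rewrite Es => -[c ->].
rewrite !rmorph_sum; apply: eq_bigr => i _; rewrite !rmorphM !alg_fun_in.
by congr (_ * _); apply: e; exact: mem_nth.
Qed.

Section Duality.
Variables (k : diff_field) (K : sep_closure k).
Local Notation KA := (sc_algebra K).
Local Notation G := (galois_group K).

(** The complement of a neighbourhood of [v y] is covered by finitely many fibres of equivariant
    functions that avoid [v y]; hence these functions determine the topology of [X]. *)
Lemma ef_continuous (X : Gspace G) (Y : topologicalType) (v : Y -> X) :
  (forall a : ef_algebra X, locally_constant (fun y => ef_fun a (v y))) ->
  continuous v.
Proof.
move=> lv y W; rewrite nbhsE => -[O [oO Oy] sO].
have cO : compact (~` O).
  by apply: subclosed_compact (@sp_compact _ X) _ => //; rewrite closedC.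
have : \forall z \near y, ~ (~` O) (v z).
  apply: (compact_ind (P := fun R => \forall z \near y, ~ R (v z)) cO).
  - by apply: nearW => z [].
  - by move=> R1 R2; apply: filterS2 => z n1 n2 [].
  - by move=> R1 R2 sR; apply: filterS => z n /sR.
  move=> x nOx; have [a ax] : exists a : ef_algebra X, ef_fun a (v y) <> ef_fun a x.
    by apply: ef_separates => e; apply: nOx; rewrite -e.
  exists [set t | ef_fun a t = ef_fun a x]; first exact: ef_locally_constant.
  by apply: filterS (lv a y) => z /= ->.
by apply: filterS => z /contrapT /sO.
Qed.

Section Adjunction.
Variables (X : Gspace G) (B : algebra k) (iB : ind_etale B).

Lemma ef_adj_hom (v : alg_hom B KA -> X) : continuous v ->
  (forall (g : G) h, v (alg_comp (gal_fun g) h) = sp_act g (v h)) ->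
  exists u : alg_hom (ef_algebra X) B, forall (h : alg_hom B KA) a, h (u a) = ef_fun a (v h).
Proof.
move=> cv ev.
have /choice[u uE] (a : ef_algebra X) : exists b, forall h : alg_hom B KA, ef_fun a (v h) = h b.
  have l : locally_constant (fun h : alg_points K iB => ef_fun a (v h)).
    by move=> h; exact: (cv h _ (@ef_locally_constant _ _ _ a (v h))).
  have e (g : G) (h : alg_points K iB) :
      ef_fun a (v (sp_act g h)) = gal_fun g (ef_fun a (v h)).
    by rewrite /= ev ef_act.
  by have [b bE] := alg_value_surj (mk_ef l e); exists b.
have eqB (a b : B) : (forall h : alg_hom B KA, h a = h b) -> a = b by exact: alg_hom_eq.
have uB : zmod_morphism u.
  by move=> a b; apply: eqB => h; rewrite rmorphB -!uE.
have uM : monoid_morphism u.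
  split=> [|a b]; apply: eqB => h; first by rewrite rmorph1 -uE.
  by rewrite rmorphM -!uE.
have uin c : mk_rmorphism uB uM (alg_in _ c) = alg_in B c.
  by apply: eqB => h; rewrite alg_fun_in -[LHS]uE.
by exists (@AlgHom k _ B (mk_rmorphism uB uM) uin) => h a; rewrite -[LHS]uE.
Qed.

(** The composite of [h] with [u] is an evaluation by [ef_hom_eval]. Separation of points makes the
    chosen point unique, whence the equivariance of [v]. *)
Lemma ef_adj_map (u : alg_hom (ef_algebra X) B) :
  exists v : alg_hom B KA -> X, [/\ continuous v,
    forall (g : G) h, v (alg_comp (gal_fun g) h) = sp_act g (v h) &
    forall (h : alg_hom B KA) a, h (u a) = ef_fun a (v h)].
Proof.
have /choice[v vE] (h : alg_hom B KA) : exists x, forall a, h (u a) = ef_fun a x.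
  exact: (ef_hom_eval (alg_comp h u)).
exists v; split=> //.
  apply: ef_continuous => a h.
  apply: filterS (@alg_hom_value_locally_constant k K B (u a) iB h) => h' /=.
  by rewrite !vE.
move=> g h; apply: contrapT => /(@ef_separates k K)[a]; apply.
by rewrite -vE ef_act -vE.
Qed.

End Adjunction.

Section DiffFunctions.
Variable X : Gprofinite G.

Definition gspace_of : Gspace G :=
  @GSpace G X (let: And3 c _ _ := gs_profinite X in c)
    (profinite_zero_dimensional (gs_profinite X)) (@gs_act G X)
    (@gs_act1 G X) (@gs_actM G X) (@gs_act_continuous G X).

Local Notation E := (ef_algebra gspace_of).

(** Equivariance survives because the twist by [gp_sigma] that [gs_sigma] introduces is undone by
    [sc_sigma], through [gal_sigmaE]. *)
Program Definition ef_sigma (a : E) : E :=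
  @mk_ef k K gspace_of (fun x => sc_sigma K (ef_fun a (gs_sigma x))) _ _.
Next Obligation.
move=> a x; have : \forall y \near x, ef_fun a (gs_sigma y) = ef_fun a (gs_sigma x).
  exact: (@gs_sigma_continuous G X x _ (@ef_locally_constant _ _ _ a (gs_sigma x))).
by apply: filterS => y ->.
Qed.
Next Obligation.
move=> a g x /=; rewrite gs_sigma_act -gal_sigmaE.
by congr (sc_sigma K _); exact: (@ef_act _ _ gspace_of).
Qed.

Lemma ef_sigma_zmod : zmod_morphism ef_sigma.
Proof. by move=> a b; apply: ef_ext => x; exact: rmorphB. Qed.

Lemma ef_sigma_monoid : monoid_morphism ef_sigma.
Proof. by split=> [|a b]; apply: ef_ext => x; [exact: rmorph1|exact: rmorphM]. Qed.

Program Definition ef_diff_algebra : diff_algebra k :=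
  @DiffAlgebra k E (mk_rmorphism ef_sigma_zmod ef_sigma_monoid) _.
Next Obligation. by move=> c; apply: ef_ext => x; exact: sc_sigma_in. Qed.

Lemma ef_dle : diff_locally_etale ef_diff_algebra.
Proof. exact: ef_ind_etale. Qed.

Variables (B : diff_algebra k) (iB : ind_etale B).

Lemma ef_adj_da_hom (v : gs_hom (@points k K B iB) X) :
  exists u : da_hom ef_diff_algebra B,
    forall (h : alg_hom B KA) (a : E), h (u a) = ef_fun a (v h).
Proof.
have [|u uE] := @ef_adj_hom gspace_of B iB v (@gs_fun_continuous _ _ _ v).
  by move=> g h; exact: (gs_fun_act v).
have us a : u (da_sigma ef_diff_algebra a) = da_sigma B (u a).
  apply: (alg_hom_eq (K := K) iB) => h; rewrite uE -(sc_twistE iB h) uE /=.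
  by congr (sc_sigma K (ef_fun a _)); exact: (esym (gs_fun_sigma v h)).
by exists (DaHom us).
Qed.

Lemma ef_adj_gs_hom (u : da_hom ef_diff_algebra B) :
  exists v : gs_hom (@points k K B iB) X,
    forall (h : alg_hom B KA) (a : E), h (u a) = ef_fun a (v h).
Proof.
have [v [cv ev vE]] := @ef_adj_map gspace_of B iB u.
have sv (h : @points k K B iB) : v (gs_sigma h) = gs_sigma (v h).
  apply: contrapT => /(@ef_separates k K gspace_of)[a]; apply.
  rewrite -vE; apply: sc_sigma_inj; rewrite (sc_twistE iB h).
  apply: (etrans (congr1 h (esym (da_fun_sigma u a)))); exact: vE.
by exists (@GsHom _ (@points k K B iB) X v cv ev sv).
Qed.

End DiffFunctions.

Section Precomposition.
Variables (X Y : Gprofinite G) (f : gs_hom X Y).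

Program Definition ef_precomp_fun (a : ef_algebra (gspace_of Y)) : ef_algebra (gspace_of X) :=
  @mk_ef k K (gspace_of X) (fun x => ef_fun a (f x)) _ _.
Next Obligation.
by move=> a x; exact: (@gs_fun_continuous G X Y f x _ (@ef_locally_constant _ _ _ a (f x))).
Qed.
Next Obligation. by move=> a g x /=; rewrite gs_fun_act; exact: (@ef_act _ _ (gspace_of Y)). Qed.

Lemma ef_precomp_zmod : zmod_morphism ef_precomp_fun.
Proof. by move=> a b; apply: ef_ext. Qed.

Lemma ef_precomp_monoid : monoid_morphism ef_precomp_fun.
Proof. by split=> [|a b]; apply: ef_ext. Qed.

Program Definition ef_precomp : da_hom (ef_diff_algebra Y) (ef_diff_algebra X) :=
  @DaHom k (ef_diff_algebra Y) (ef_diff_algebra X) (@AlgHom k (ef_diff_algebra Y) (ef_diff_algebra X)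
    (mk_rmorphism ef_precomp_zmod ef_precomp_monoid) _) _.
Next Obligation. by move=> c; apply: ef_ext. Qed.
Next Obligation. by move=> a; apply: ef_ext => x /=; rewrite gs_fun_sigma. Qed.

End Precomposition.

Program Definition ef_functor : functor (Gprofinite_cat G) (op (dle_cat k)) :=
  @Functor (Gprofinite_cat G) (op (dle_cat k))
    (fun X => exist _ (ef_diff_algebra X) (@ef_dle X)) (fun X Y f => ef_precomp f) _ _.
Next Obligation. by move=> X; apply: da_hom_ext => a; apply: ef_ext. Qed.
Next Obligation. by move=> X Y Z g f; apply: da_hom_ext => a; apply: ef_ext. Qed.

Section Unit.
Variables (A : diff_algebra k) (iA : diff_locally_etale A).
Local Notation P := (@points k K A iA).

Program Definition ef_unit_fun (a : A) : ef_algebra (gspace_of P) :=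
  @mk_ef k K (gspace_of P) (fun h : alg_hom A KA => h a : K) _ _.
Next Obligation. by move=> a; exact: alg_hom_value_locally_constant. Qed.
Next Obligation. by []. Qed.

Lemma ef_unit_zmod : zmod_morphism ef_unit_fun.
Proof. by move=> a b; apply: ef_ext => h; exact: rmorphB. Qed.

Lemma ef_unit_monoid : monoid_morphism ef_unit_fun.
Proof. by split=> [|a b]; apply: ef_ext => h; [exact: rmorph1|exact: rmorphM]. Qed.

Program Definition ef_unit : da_hom A (ef_diff_algebra P) :=
  @DaHom k A (ef_diff_algebra P) (@AlgHom k A (ef_diff_algebra P)
    (mk_rmorphism ef_unit_zmod ef_unit_monoid) _) _.
Next Obligation. by move=> c; apply: ef_ext => h; exact: (alg_fun_in (h : alg_hom A KA) c). Qed.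
Next Obligation. by move=> a; apply: ef_ext => h; exact: (esym (sc_twistE iA h a)). Qed.

Lemma ef_unitV : {u : da_hom (ef_diff_algebra P) A | 
  forall (h : alg_hom A KA) a, h (u a) = ef_fun a h}.
Proof.
apply: cid; have [u uE] := ef_adj_da_hom (gs_id P : gs_hom P P).
by exists u => h a; exact: uE.
Qed.

Lemma ef_unit_inverse :
  (forall a, ef_unit (sval ef_unitV a) = a) /\ (forall a, sval ef_unitV (ef_unit a) = a).
Proof.
case: ef_unitV => u uE /=; split=> a; first by apply: ef_ext => h; exact: uE.
by apply: (alg_hom_eq (K := K) iA) => h; rewrite uE.
Qed.

End Unit.

Section Counit.
Variables (X : Gprofinite G) (iX : diff_locally_etale (ef_diff_algebra X)).
Local Notation P := (@points k K (ef_diff_algebra X) iX).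

Program Definition ef_counitV : gs_hom X P :=
  @GsHom G X P (fun x => ef_eval (x : gspace_of X)) _ _ _.
Next Obligation. by apply: alg_hom_continuous => a; exact: (@ef_locally_constant k K (gspace_of X) a). Qed.
Next Obligation. by move=> g x; apply: alg_hom_ext => a; exact: (@ef_act k K (gspace_of X) a). Qed.
Next Obligation.
by move=> x; apply: alg_hom_ext => a; apply: sc_sigma_inj; rewrite [RHS]sc_twistE.
Qed.

Lemma ef_counit : {v : gs_hom P X |
  forall (h : P) (a : ef_algebra (gspace_of X)), (h : alg_hom _ _) a = ef_fun a (v h)}.
Proof. by apply: cid; exact: (ef_adj_gs_hom _ (da_id (ef_diff_algebra X))). Qed.

Lemma ef_counit_inverse :
  (forall x, sval ef_counit (ef_counitV x) = x) /\
  (forall h, ef_counitV (sval ef_counit h) = h).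
Proof.
case: ef_counit => v vE /=; split=> [x|h]; last first.
  by apply: alg_hom_ext => a; rewrite [RHS]vE.
apply: contrapT => /(@ef_separates k K (gspace_of X))[a]; apply.
by rewrite -vE.
Qed.

End Counit.

Lemma ef_functor_inverse :
  naturally_isomorphic (functor_comp ef_functor (points_functor K))
    (functor_id (op (dle_cat k))) /\
  naturally_isomorphic (functor_comp (points_functor K) ef_functor)
    (functor_id (Gprofinite_cat G)).
Proof.
split.
  exists (fun A : dle_cat k => ef_unit (svalP A)), (fun A : dle_cat k => sval (ef_unitV (svalP A))).
  split=> [A|A B f].
    have [h1 h2] := ef_unit_inverse (svalP A).
    by split; apply: da_hom_ext => a; [exact: h1|exact: h2].
  apply: da_hom_ext => a; apply: ef_ext => h /=; reflexivity.
exists (fun X => sval (ef_counit (svalP (ef_functor X)))),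
  (fun X => ef_counitV (svalP (ef_functor X))); split=> [X|X Y f].
  have [h1 h2] := ef_counit_inverse (svalP (ef_functor X)).
  by split; apply: gs_hom_ext => x; [exact: h2|exact: h1].
apply: gs_hom_ext => h /=.
apply: contrapT => /(@ef_separates k K (gspace_of Y))[a]; apply.
case: (ef_counit _) (ef_counit _) => v vE [w wE] /=.
rewrite -wE; have := vE h (ef_precomp f a); exact.
Qed.

End Duality.

(** * Finite spaces and etale algebras *)

(** On full subcategories the components of the two natural isomorphisms can be reused as they are;
    each clause of the theorem is thereby reduced to two preservation statements. *)
Lemma restrict_equivalence (C D : category) (F : functor C D) (H : functor D C)
    (P : C -> Prop) (Q : D -> Prop) :
  naturally_isomorphic (functor_comp H F) (functor_id C) ->
  naturally_isomorphic (functor_comp F H) (functor_id D) ->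
  (forall x, P x -> Q (F x)) -> (forall y, Q y -> P (H y)) ->
  restricts_to_equivalence F P Q.
Proof.
move=> [a [a' [aK na]]] [b [b' [bK nb]]] PQ QP; exists PQ, (functor_restrict QP).
split.
  exists (fun x => a (sval x)), (fun x => a' (sval x)); split=> [x|x y f].
    exact: aK.
  exact: na.
exists (fun x => b (sval x)), (fun x => b' (sval x)); split=> [x|x y f].
  exact: bK.
exact: nb.
Qed.

(** At each stage [p i] is divided by its gcd with [q] before multiplying: a common factor of the
    quotient and [q] would divide that gcd too, and so occur twice in the separable [p i]. *)
Lemma separable_lcm (k : fieldType) (I : Type) (r : seq I) (p : I -> {poly k}) :
  (forall i, separable_poly (p i)) ->
  exists q, separable_poly q /\ all (fun i => p i %| q) r.
Proof.
move=> sp; elim: r => [|i r [q [sq IH]]].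
  by exists 1; have := @separable_prod_XsubC k [::]; rewrite big_nil => ->.
pose d := p i %/ gcdp (p i) q.
have Ei : p i = d * gcdp (p i) q by rewrite divpK // dvdp_gcdl.
exists (d * q); split; last first.
  rewrite /= {1}Ei dvdp_mul ?dvdp_gcdr //=.
  by apply: sub_all IH => l /= h; exact: dvdp_mull.
have := sp i; rewrite Ei separable_mul => /and3P[sd sg cop].
rewrite separable_mul sd sq /=.
apply/coprimepP => x xd xq; move/coprimepP: cop; apply=> //.
by rewrite dvdp_gcd xq andbT Ei dvdp_mulr.
Qed.

Lemma alg_hom_alg_eval (k : fieldType) (A B : algebra k) (h : alg_hom A B) p a :
  h (alg_eval p a) = alg_eval p (h a).
Proof.
rewrite /alg_eval rmorph_sum; apply: eq_bigr => i _.
by rewrite rmorphM rmorphXn alg_fun_in.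
Qed.

Section Etale.
Variables (k : fieldType) (A : algebra k).
Hypothesis eA : etale A.

Lemma etale_joint_inj n (L : 'I_n -> fieldType) (j : forall i, {rmorphism k -> L i})
    (pr : forall i, alg_hom A (field_algebra (j i))) :
  (forall x : (forall i, L i), exists! a : A, forall i, pr i a = x i) ->
  forall a b, (forall i, pr i a = pr i b) -> a = b.
Proof.
move=> bij a b e; have [c [_ c_uniq]] := bij (fun i => pr i b).
by rewrite -(c_uniq a e) -(c_uniq b).
Qed.

Lemma etale_ind_etale : ind_etale A.
Proof.
case: eA => n [L [j [pr [LP bij]]]] a.
have /choice[p pP] i : exists p : {poly k}, separable_poly p /\
    alg_eval (A := field_algebra (j i)) p (pr i a) = 0.
  by have [_ iL] := LP i; exact: iL.
have [q [sq /allP pq]] := separable_lcm (enum 'I_n) (fun i => (pP i).1).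
exists q; split=> //; apply: (etale_joint_inj bij) => i; rewrite rmorph0.
rewrite alg_hom_alg_eval; have [_] := pP i; rewrite !alg_evalE.
have /dvdpP[u ->] : p i %| q by apply: pq; rewrite mem_enum.
by rewrite rmorphM hornerM => ->; rewrite mulr0.
Qed.

Lemma etale_finite_dim : finite_dim A.
Proof.
case: eA => n [L [j [pr [LP bij]]]].
have pr_inj := etale_joint_inj bij.
have exs i : {s : seq (L i) | lin_span (A := field_algebra (j i)) s = setT}.
  by apply: cid; have [[s e] _] := LP i; exists s.
pose s i := sval (exs i).
have sP i : lin_span (A := field_algebra (j i)) (s i) = setT := svalP (exs i).
(* [dfwith] is the family with one prescribed component and 0 elsewhere, so that [u i] below embeds
   the factor [L i] into [A] by zero extension. *)
have /choice[t tP] (iy : {i : 'I_n & L i}) : exists a : A,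
    forall l, pr l a = dfwith (fun l : 'I_n => 0 : L l) (tag iy) (tagged iy) l.
  by have [a [ha _]] := bij (dfwith (fun l : 'I_n => 0 : L l) (tag iy) (tagged iy)); exists a.
pose u (i : 'I_n) (y : L i) := t (Tagged (fun i => L i : Type) y).
have u_in i y : pr i (u i y) = y by rewrite tP dfwithin.
have u_out i y l : l != i -> pr l (u i y) = 0 by move=> li; rewrite tP dfwithout // eq_sym.
have uE i (y : L i) a : pr i a = y -> (forall l, l != i -> pr l a = 0) -> a = u i y.
  move=> ay a0; apply: pr_inj => l; have [->|li] := eqVneq l i; first by rewrite u_in.
  by rewrite a0 // u_out.
exists (flatten [seq map (u i) (s i) | i <- enum 'I_n]).
apply/seteqP; split=> // a _; set S := flatten _.
have [S0 SD SZ] := span_submodule S.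
have uS i y : lin_span S (u i y).
  have : lin_span (A := field_algebra (j i)) (s i) y by rewrite sP.
  apply: (@span_sub k (field_algebra (j i)) (s i) (fun y => lin_span S (u i y))) => [|x xs].
    split=> [|x x' hx hx'|c x hx].
    - by rewrite -(uE i 0 0) // ?rmorph0 // => l _; rewrite rmorph0.
    - rewrite -(uE i (x + x') (u i x + u i x')); first exact: SD.
        by rewrite rmorphD !u_in.
      by move=> l li; rewrite rmorphD !u_out // addr0.
    - rewrite -(uE i _ (alg_in A c * u i x)); first exact: SZ.
        by rewrite rmorphM u_in alg_fun_in.
      by move=> l li; rewrite rmorphM !u_out // mulr0.
  apply: span_mem; apply/flattenP; exists (map (u i) (s i)); last exact: map_f.
  by apply: map_f; rewrite mem_enum.
have -> : a = \sum_i u i (pr i a).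
  apply: pr_inj => l; rewrite rmorph_sum (bigD1 l) //= u_in big1 ?addr0 // => i il.
  by rewrite u_out // eq_sym.
by elim/big_ind: _.
Qed.

End Etale.

Section FiniteHom.
Variables (k : diff_field) (K : sep_closure k).
Local Notation KA := (sc_algebra K).

(** Taking the whole of [A] as finite-dimensional subalgebra shows that the space of homomorphisms
    is discrete; it is also compact, hence finite. *)
Lemma finite_dim_hom_finite (A : algebra k) : ind_etale A -> finite_dim A ->
  finite_set [set: alg_hom A KA].
Proof.
move=> iA [s Es].
have := @locally_constant_finite _ _ id (@alg_hom_compact k K A iA).
rewrite image_id; apply => h.
exists setT; split=> //; first by split=> //; exists s.
by move=> h' e; apply: alg_hom_ext => a; exact: e.
Qed.

End FiniteHom.

Section FiniteSpace.
Variables (G : diff_profinite_group) (T : Gspace G).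
Hypothesis finT : finite_set [set: T].

Lemma finite_clopen (D : set T) : clopen D.
Proof.
have cl (B : set T) : closed B.
  apply: (accessible_finite_set_closed.1 _).
    exact/hausdorff_accessible/zero_dimensional_hausdorff/sp_zero_dim.
  exact: sub_finite_set finT.
by split=> //; rewrite -closedC.
Qed.

Lemma finite_locally_constant U (f : T -> U) : locally_constant f.
Proof.
move=> t; have [o1 _] := finite_clopen [set t].
by apply: filterS (open_nbhs_nbhs (conj o1 erefl)) => t' ->.
Qed.

End FiniteSpace.

Section FiniteGspace.
Variables (k : diff_field) (K : sep_closure k).
Local Notation KA := (sc_algebra K).
Local Notation G := (galois_group K).
Variable T : Gspace G.
Hypothesis finT : finite_set [set: T].
Local Notation E := (ef_algebra T).

(** The indicator of each point is a [K]-combination of finitely many equivariant functions. Those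
    that occur span over [k] a submodule whose [K]-span contains every function, and descent shows
    that this submodule is everything. *)
Lemma ef_finite_dim : finite_dim E.
Proof.
have /choice[s sP] t : exists s : seq E, kcomb (lin_span s) (indic [set t]).
  have : kcomb setT (indic [set t]) by apply: kcomb_indic (finite_clopen finT _) => // x y /ef_separates[a]; exists a.
  move=> [n [c [v [_ e]]]]; exists [seq v i | i <- enum 'I_n], n, c, v; split=> // i.
  by apply: span_mem; apply: map_f; rewrite mem_enum.
have [S ES] : exists S : seq T, forall t, t \in S.
  by have /finite_seqP[S e] := finT; exists S => t; have : [set: T] t by []; rewrite e.
exists (flatten [seq s t | t <- S]); apply/seteqP; split=> // a _.
set V := lin_span _.
have sV : submodule V by exact: span_submodule.
have : kcomb V (fun x => \sum_(t <- undup S) ef_fun a t * indic [set t] x).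
  apply: kcomb_sum => t; apply: kcombZ.
  have [n [c [v [vs e]]]] := sP t; exists n, c, v; split=> // i.
  apply: (span_sub sV _ (vs i)) => x xs; apply: span_mem.
  by apply/flattenP; exists (s t) => //; exact: map_f.
case=> n san; apply: (kspan_descent sV (n := n)).
case: san => c [v [Vv e]]; exists c, v; split=> // x; rewrite -e.
rewrite (bigD1_seq x) ?undup_uniq ?mem_undup //= /indic asboolT // mulr1 big1 ?addr0 //.
move=> t /eqP tx; rewrite asboolF ?mulr0 // => /= e'; exact: tx.
Qed.

End FiniteGspace.

Section ValueField.
Variables (k : diff_field) (K : sep_closure k).
Local Notation KA := (sc_algebra K).
Local Notation G := (galois_group K).
Variables (T : Gspace G) (t : T).

(** This is the residue field at [t], realised inside [K] as a set of values so that evaluation is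
    onto by construction; for finite [T] it is the fixed field of the stabiliser of [t]. *)
Definition value_pred : {pred K} :=
  [pred c | `[< exists a : ef_algebra T, ef_fun a t = c >]].

Lemma value_predP c : c \in value_pred <-> exists a : ef_algebra T, ef_fun a t = c.
Proof. by rewrite unfold_in /=; split=> /asboolP. Qed.

Lemma value_divring_closed : divring_closed value_pred.
Proof.
split=> [|c d /value_predP[a <-] /value_predP[b <-]|c d /value_predP[a <-] /value_predP[b <-]];
  apply/value_predP.
- by exists 1.
- by exists (a - b).
- have [b0|b0] := eqVneq (ef_fun b t) 0.
    by exists 0; rewrite b0 invr0 mulr0.
  have [s bs] := separable_elt_regular (@ef_ind_etale k K T b).
  exists (a * s); have := congr1 (fun a => ef_fun a t) bs.
  rewrite -[LHS]/(ef_fun b t * ef_fun b t * ef_fun s t) => e.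
  rewrite -[LHS]/(ef_fun a t * ef_fun s t); congr (_ * _).
  by apply: (mulfI b0); apply: (mulfI b0); rewrite mulrA e mulfV // mulr1.
Qed.

Record value_field := ValueField { vf_val : K; vf_valP : vf_val \in value_pred }.

HB.instance Definition _ := [isSub for vf_val].
HB.instance Definition _ := [Choice of value_field by <:].
HB.instance Definition _ := GRing.SubChoice_isSubIntegralDomain.Build
  K value_pred value_field value_divring_closed.
HB.instance Definition _ := [SubIntegralDomain_isSubField of value_field by <:].

Definition vf_eval_fun (a : ef_algebra T) : value_field :=
  ValueField ((value_predP _).2 (ex_intro _ a erefl)).

Lemma vf_eval_zmod : zmod_morphism vf_eval_fun.
Proof. by move=> a b; apply: val_inj. Qed.

Lemma vf_eval_monoid : monoid_morphism vf_eval_fun.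
Proof. by split=> [|a b]; apply: val_inj. Qed.

Definition vf_eval_rmorphism : {rmorphism ef_algebra T -> value_field} :=
  mk_rmorphism vf_eval_zmod vf_eval_monoid.

Definition vf_in : {rmorphism k -> value_field} :=
  vf_eval_rmorphism \o alg_in (ef_algebra T).

Definition vf_eval : alg_hom (ef_algebra T) (field_algebra vf_in) :=
  @AlgHom k (ef_algebra T) (field_algebra vf_in) vf_eval_rmorphism (fun=> erefl).

Lemma vf_eval_surj c : exists a, vf_eval a = c.
Proof.
have /value_predP[a ac] := vf_valP c.
by exists a; apply: val_inj.
Qed.

End ValueField.

Lemma finite_dim_surj (k : fieldType) (A B : algebra k) (f : alg_hom A B) :
  (forall b, exists a, f a = b) -> finite_dim A -> finite_dim B.
Proof.
move=> fs [s Es]; exists (map f s); apply/seteqP; split=> // b _.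
have [a <-] := fs b; have : lin_span s a by rewrite Es.
have [W0 WD WZ] := span_submodule (map f s).
apply: (@span_sub k A s (fun a => lin_span (map f s) (f a))) => [|x xs].
  split=> [|x y|c x]; rewrite ?rmorph0 ?rmorphD ?rmorphM ?alg_fun_in //.
    exact: WD.
  exact: WZ.
by apply: span_mem; exact: map_f.
Qed.

Section FiniteEtale.
Variables (k : diff_field) (K : sep_closure k).
Local Notation G := (galois_group K).
Variable T : Gspace G.
Hypothesis finT : finite_set [set: T].

(** The ring is the product, over the orbits, of the value fields at chosen representatives: an
    equivariant function is determined by its values there, and these can be prescribed
    independently. *)
Lemma ef_etale : etale (ef_algebra T).
Proof.
pose orb (x y : T) := `[< exists g : G, y = sp_act g x >].
have orb_refl x : orb x x by apply/asboolP; exists (gp_one G); rewrite sp_act1.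
have orbV x y : orb x y -> orb y x.
  by move=> /asboolP[g ->]; apply/asboolP; exists (gp_inv g); rewrite sp_actK.
have orbT x y z : orb x y -> orb y z -> orb x z.
  by move=> /asboolP[g ->] /asboolP[h ->]; apply/asboolP; exists (gp_mul h g); rewrite sp_actM.
pose rep x := choose (orb x) x.
have repP x : orb x (rep x) by apply: chooseP.
have repE x y : orb x y -> rep x = rep y.
  move=> xy; rewrite /rep (@eq_choose _ (orb x) (orb y)); last first.
    by move=> z; apply/idP/idP; apply: orbT => //; exact: orbV.
  by apply: choose_id => //; exact: orbV.
have rep_rep x : rep (rep x) = rep x by apply/esym/repE.
have /finite_seqP[S0 ES] : finite_set (range rep).
  by apply: finite_image.
pose S := undup S0.
have memS x : (x \in S) <-> range rep x.
  by rewrite ES mem_undup.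
pose t (i : 'I_(size S)) := tnth (in_tuple S) i.
have rep_t i : rep (t i) = t i.
  have : t i \in S by exact: mem_tnth.
  by move=> /memS[x _ <-]; rewrite rep_rep.
have t_inj : injective t.
  by apply/tuple_uniqP; exact: undup_uniq.
have t_surj x : exists i, rep x = t i.
  have : rep x \in S by apply/memS; exists x.
  by move=> /(@tnthP _ _ (in_tuple S))[i e]; exists i.
exists (size S), (fun i => value_field (t i) : fieldType), (fun i => vf_in (t i)), (fun i => vf_eval (t i)).
split=> [i|x].
  split; first exact: finite_dim_surj (@vf_eval_surj _ _ _ _) (ef_finite_dim finT).
  exact: alg_hom_ind_etale (@vf_eval_surj _ _ _ _) (@ef_ind_etale k K T).
have exa i : {a | vf_eval (t i) a = x i} by apply: cid; exact: vf_eval_surj.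
(* The indicator of the orbit of [t i] is equivariant because the Galois group fixes 0 and 1; these
   idempotents glue the prescribed values. *)
have exe i : {e : ef_algebra T | forall y, ef_fun e y = (rep y == t i)%:R}.
  apply: cid.
  have e (g : G) y : (rep (sp_act g y) == t i)%:R = gal_fun g (rep y == t i)%:R :> K.
    rewrite (rmorph_nat (gal_fun g)) -(repE y (sp_act g y)) //.
    by apply/asboolP; exists g.
  by exists (mk_ef (finite_locally_constant finT _) e).
pose a := \sum_i sval (exe i) * sval (exa i).
have aE y : ef_fun a y = \sum_i (rep y == t i)%:R * ef_fun (sval (exa i)) y.
  rewrite -[LHS]/(ef_eval y a) rmorph_sum; apply: eq_bigr => i _.
  by rewrite rmorphM; congr (_ * _); exact: (svalP (exe i)).
have at_ i : ef_fun a (t i) = val (x i).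
  rewrite aE (bigD1 i) //= rep_t eqxx mul1r big1 ?addr0 => [|l li].
    by case: (exa i) => ai /= <-.
  by case: eqP => [/t_inj e|_]; [rewrite e eqxx in li|rewrite mul0r].
exists a; split=> [i|b be]; first by apply: val_inj; exact: at_.
apply: ef_ext => y; have [i yi] := t_surj y.
have /asboolP[g ->] := orbV _ _ (repP y).
by rewrite !ef_act yi at_ -(be i).
Qed.

End FiniteEtale.

(** * Finitely sigma-generated objects *)

Lemma locally_constant_comp (X Y : topologicalType) (T : Type) (f : X -> Y) (g : Y -> T) :
  continuous f -> locally_constant g -> locally_constant (g \o f).
Proof. by move=> cf lg x; exact: (cf x _ (lg (f x))). Qed.

Lemma locally_constant_continuous (X : topologicalType) (T : discreteTopologicalType) (f : X -> T) :
  continuous f <-> locally_constant f.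
Proof.
split=> [cf x|lf x U fxU].
  have : nbhs (f x) [set f x] by apply: open_nbhs_nbhs; split=> //; exact: discrete_open.
  by move=> /cf.
by apply: filterS (lf x) => y e; rewrite /= e; exact: nbhs_singleton.
Qed.

Lemma locally_constant_post (X : topologicalType) (T U : Type) (f : X -> T) (g : T -> U) :
  locally_constant f -> locally_constant (g \o f).
Proof. by move=> lf x; apply: filterS (lf x) => y /= ->. Qed.

Section FiniteGsets.
Variable G : diff_profinite_group.

Lemma fg_act_locally_constant (X0 : finite_Gset G) (x : X0) :
  locally_constant (fun g : G => fg_act g x).
Proof.
apply/(@locally_constant_continuous _ (discrete_topology X0)) => g.
have := @continuous_comp _ _ _ (fun g : G => (g, x : discrete_topology X0))
  (fun u : G * discrete_topology X0 => fg_act u.1 u.2 : discrete_topology X0) g.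
apply; last exact: fg_act_continuous.
have h1 : {for g, continuous (fun g : G => g)} by exact: cvg_id.
have h2 : {for g, continuous (fun _ : G => x : discrete_topology X0)} by exact: cvg_cst.
exact: (cvg_pair h1 h2).
Qed.

Lemma finite_act_continuous (X0 : finType) (act : G -> X0 -> X0) :
  (forall x, locally_constant (fun g => act g x)) ->
  continuous (fun u : G * discrete_topology X0 => act u.1 u.2 : discrete_topology X0).
Proof.
move=> lact; apply/(@locally_constant_continuous _ (discrete_topology X0)).
move=> [g x]; exists ([set h | act h x = act g x], [set x]).
  split=> /=; first exact: lact.
  by apply: open_nbhs_nbhs; split=> //; exact: discrete_open.
by move=> [h y] /= [<- ->].
Qed.

Program Definition fg_gspace (X0 : finite_Gset G) : Gspace G :=
  @GSpace G (discrete_topology X0) _ discrete_zero_dimension (@fg_act G X0)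
    (@fg_act1 G X0) (@fg_actM G X0) (@fg_act_continuous G X0).
Next Obligation. by move=> X0; apply: finite_compact; exact: (@finite_finset X0). Qed.

Lemma fg_gspace_finite (X0 : finite_Gset G) : finite_set [set: fg_gspace X0].
Proof. exact: (@finite_finset X0). Qed.

Lemma finite_Gset_of (T : Gspace G) : finite_set [set: T] ->
  exists (X0 : finite_Gset G) (e : X0 -> T) (e' : T -> X0),
    [/\ cancel e e', cancel e' e & forall g x, e (fg_act g x) = sp_act g (e x)].
Proof.
move=> finT; have [S ES] : exists S : seq T, forall t, t \in S.
  by have /finite_seqP[S e] := finT; exists S => t; have : [set: T] t by []; rewrite e.
pose e' t : seq_sub S := SeqSub (ES t).
have e'K : cancel e' (@ssval _ S) by [].
have eK : cancel (@ssval _ S) e' by move=> x; apply: val_inj.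
pose act (g : G) (x : seq_sub S) := e' (sp_act g (ssval x)).
have act1 x : act (gp_one G) x = x by rewrite /act sp_act1 eK.
have actM g h x : act (gp_mul g h) x = act g (act h x) by rewrite /act sp_actM.
have lact x : locally_constant (fun g => act g x).
  have cg : continuous (fun g : G => sp_act g (ssval x)).
    move=> g; have := @continuous_comp _ _ _ (fun g : G => (g, ssval x))
      (fun u : G * T => sp_act u.1 u.2) g; apply; last exact: sp_act_continuous.
    have h1 : {for g, continuous (fun g : G => g)} by exact: cvg_id.
    have h2 : {for g, continuous (fun _ : G => ssval x)} by exact: cvg_cst.
    exact: (cvg_pair h1 h2).
  exact: (locally_constant_comp cg (finite_locally_constant finT e')).
exists (@FiniteGset G (seq_sub S) act act1 actM (finite_act_continuous lact)).
by exists (@ssval _ S), e'.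
Qed.

Lemma sfree_coord_locally_constant (X0 : finite_Gset G) i :
  locally_constant (fun z : sfree X0 => z i).
Proof.
apply/(@locally_constant_continuous _ (discrete_topology X0)).
exact: sfree_proj_continuous.
Qed.

Section Twist.
Variable X0 : finite_Gset G.

(** Target for maps that are equivariant only up to [gp_sigma], such as the dual of a semilinear
    homomorphism. *)
Definition twist_act (g : G) (x : X0) : X0 := fg_act (gp_sigma g) x.

Lemma twist_act_continuous : continuous (fun u : G * discrete_topology X0 =>
  twist_act u.1 u.2 : discrete_topology X0).
Proof.
apply: finite_act_continuous => x.
exact: (locally_constant_comp (@gp_sigma_continuous G) (fg_act_locally_constant x)).
Qed.

Program Definition twist_Gset : finite_Gset G :=
  @FiniteGset G X0 twist_act _ _ twist_act_continuous.
Next Obligation. by move=> x; rewrite /twist_act -[gp_sigma _]/(iter 1 _ _) iter_gp_sigma1 fg_act1. Qed.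
Next Obligation. by move=> g h x; rewrite /twist_act gp_sigma_mul fg_actM. Qed.

End Twist.

Section SigmaFreeMaps.
Variables (X0 : finite_Gset G) (Y : Gprofinite G).

Lemma gs_iter_act i (g : G) (y : Y) :
  iter i (@gs_sigma G Y) (gs_act g y) = gs_act (iter i (@gp_sigma G) g) (iter i (@gs_sigma G Y) y).
Proof. by elim: i => //= i ->; rewrite gs_sigma_act. Qed.

Lemma gs_iter_continuous i : continuous (iter i (@gs_sigma G Y)).
Proof.
elim: i => [|i IH] y; first exact: cvg_id.
by apply: (continuous_comp (IH y)); apply: gs_sigma_continuous.
Qed.

Lemma sfree_homE (f : gs_hom Y (sfree X0)) y i :
  f y i = f (iter i (@gs_sigma G Y) y) 0%N.
Proof.
elim: i y => [|i IH] y //=; rewrite -iterS iterSr -IH.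
by rewrite gs_fun_sigma.
Qed.

Lemma sfree_hom_ext (f g : gs_hom Y (sfree X0)) :
  (forall y, f y 0%N = g y 0%N) -> f = g.
Proof.
by move=> e; apply: gs_hom_ext => y; apply: funext => i; rewrite sfree_homE e -sfree_homE.
Qed.

Lemma sfree_hom_head (f : gs_hom Y (sfree X0)) :
  locally_constant (fun y => f y 0%N) /\
  forall g y, f (gs_act g y) 0%N = fg_act g (f y 0%N).
Proof.
split=> [|g y]; last by rewrite gs_fun_act.
apply: (locally_constant_comp (g := fun z : sfree X0 => z 0%N) (@gs_fun_continuous _ _ _ f)).
apply/(@locally_constant_continuous _ (discrete_topology X0)).
exact: sfree_proj_continuous.
Qed.

(** Together with [sfree_hom_ext] this is the cofreeness of [sfree X0] on [X0]. *)
Lemma sfree_lift (w : Y -> X0) : locally_constant w ->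
  (forall g y, w (gs_act g y) = fg_act g (w y)) ->
  exists u : gs_hom Y (sfree X0), forall y i, u y i = w (iter i (@gs_sigma G Y) y).
Proof.
move=> lw ew.
pose u (y : Y) : sfree X0 := fun i => w (iter i (@gs_sigma G Y) y).
have cu : continuous u.
  apply: (@sfree_continuous G X0) => i.
  apply/locally_constant_continuous; apply: locally_constant_comp lw.
  exact: gs_iter_continuous.
have eu g y : u (gs_act g y) = gs_act g (u y).
  by apply: funext => i; rewrite /u gs_iter_act ew.
have su y : u (gs_sigma y) = gs_sigma (u y).
  by apply: funext => i; rewrite /u -iterSr.
by exists (GsHom cu eu su).
Qed.

End SigmaFreeMaps.

Lemma injective_monomorphism (X Y : Gprofinite G) (m : gs_hom X Y) : injective m ->
  monomorphism (m : mor (X : Gprofinite_cat G) (Y : Gprofinite_cat G)).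
Proof.
move=> mi Z f g e; apply: gs_hom_ext => z; apply: mi.
exact: (congr1 (fun h : gs_hom Z Y => h z) e).
Qed.

End FiniteGsets.

(* The universal property forces R to be its own separable part. *)
Lemma presented_locally_etale (k : diff_field) (K : sep_closure k) (A : diff_algebra k) :
  fin_sigma_presented_etale A -> diff_locally_etale A.
Proof.
move=> [E [R [r [_ eC [rpt Runiv] [f [g [gf fg]]]]]]].
suff iR : diff_locally_etale R.
  move=> a; have <- : g (f a) = a by have := congr1 (fun h : da_hom A A => h a) gf.
  by apply: (@separable_elt_hom _ _ _ g idfun) (iR _) => c; exact: alg_fun_in.
have iC := etale_ind_etale eC.
have [r' r'E] := sep_lift K r iC.
have r'pt : cc_point r'.
  move=> a; apply: sep_incl_inj; rewrite r'E -rpt -r'E.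
  exact: (da_fun_sigma (sep_incl K R) _).
have [u [ur _]] := Runiv _ _ r'pt.
have [w [_ w_uniq]] := Runiv _ _ rpt.
have w1 : w = da_id R by apply: w_uniq; apply: alg_hom_ext.
have wu : w = da_comp (sep_incl K R) u.
  apply: w_uniq; apply: alg_hom_ext => c /=.
  by have := r'E c; rewrite -ur.
move=> b; have -> : b = sep_incl K R (u b).
  by have := congr1 (fun h : da_hom R R => h b) (etrans (esym w1) wu).
apply: (@separable_elt_hom _ _ _ (sep_incl K R) idfun); last exact: sep_ind_etale.
by move=> c; exact: alg_fun_in.
Qed.

(** * Sequences in the separable closure as a test algebra *)

Section Cofree.
Variables (k : diff_field) (K : sep_closure k).
Local Notation KA := (sc_algebra K).

Definition cofree_in (c : k) (i : nat) : K := sc_in K (iter i (df_sigma k) c).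

Lemma cofree_in_zmod : zmod_morphism cofree_in.
Proof.
move=> a b; apply: funext => i; rewrite /cofree_in !fctE -rmorphB; congr (sc_in K _).
by elim: i => //= i ->; rewrite rmorphB.
Qed.

Lemma cofree_in_monoid : monoid_morphism cofree_in.
Proof.
split=> [|a b]; apply: funext => i; rewrite /cofree_in.
  by rewrite -[RHS](rmorph1 (sc_in K)); congr (sc_in K _); elim: i => //= i ->; rewrite rmorph1.
rewrite !fctE -rmorphM; congr (sc_in K _).
by elim: i => //= i ->; rewrite rmorphM.
Qed.

Definition cofree_shift (x : nat -> K) (i : nat) : K := x i.+1.

Lemma cofree_shift_zmod : zmod_morphism cofree_shift.
Proof. by []. Qed.

Lemma cofree_shift_monoid : monoid_morphism cofree_shift.
Proof. by []. Qed.

(* Difference homomorphisms to this algebra correspond, by taking the 0th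
   component, to algebra homomorphisms to K. *)
Program Definition cofree : diff_algebra k :=
  @DiffAlgebra k (@Algebra k (nat -> K) (mk_rmorphism cofree_in_zmod cofree_in_monoid))
    (mk_rmorphism cofree_shift_zmod cofree_shift_monoid) _.
Next Obligation.
by move=> c; apply: funext => i; rewrite /= /cofree_shift /cofree_in iterSr.
Qed.

Lemma cofree_lift (A : diff_algebra k) (h : alg_hom A KA) :
  exists u : da_hom A cofree, forall a i, u a i = h (iter i (da_sigma A) a).
Proof.
pose u (a : A) : nat -> K := fun i => h (iter i (da_sigma A) a).
have uB : zmod_morphism u.
  move=> a b; apply: funext => i; rewrite /u !fctE -rmorphB; congr (h _).
  by elim: i => //= i ->; rewrite rmorphB.
have uM : monoid_morphism u.
  split=> [|a b]; apply: funext => i; rewrite /u.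
    rewrite -[RHS](rmorph1 h); congr (h _).
    by elim: i => //= i ->; rewrite rmorph1.
  rewrite !fctE -rmorphM; congr (h _).
  by elim: i => //= i ->; rewrite rmorphM.
have uin c : mk_rmorphism uB uM (alg_in A c) = alg_in cofree c.
  apply: funext => i; rewrite /= /u /cofree_in.
  have -> : iter i (da_sigma A) (alg_in A c) = alg_in A (iter i (df_sigma k) c).
    by elim: i => //= i ->; rewrite da_sigma_in.
  exact: (alg_fun_in h).
pose u' : alg_hom A cofree := @AlgHom k A cofree (mk_rmorphism uB uM) uin.
have us a : u' (da_sigma A a) = da_sigma cofree (u' a).
  by apply: funext => i; rewrite /= /cofree_shift /u iterSr.
by exists (DaHom us).
Qed.

End Cofree.

Section Generated.
Variables (k : diff_field) (K : sep_closure k).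
Local Notation KA := (sc_algebra K).
Local Notation G := (galois_group K).

Lemma iter_sc_twist (A : diff_algebra k) (iA : ind_etale A) (h : alg_hom A KA) i a :
  iter i (sc_sigma K) ((iter i (sc_twist iA) h : alg_hom A KA) a) =
  h (iter i (da_sigma A) a).
Proof.
elim: i h a => // i IH h a; rewrite iterS iterSr -[X in sc_sigma K X]/(iter i _ _).
by rewrite IH sc_twistE.
Qed.

Lemma etale_finite_Gset (A : algebra k) : etale A ->
  exists (X0 : finite_Gset G) (e : X0 -> alg_hom A KA) (e' : alg_hom A KA -> X0),
    [/\ cancel e e', cancel e' e, locally_constant e' &
     forall (g : G) h, e' (alg_comp (gal_fun g) h) = fg_act g (e' h)].
Proof.
move=> eA; have iA := etale_ind_etale eA.
have finT : finite_set [set: alg_points K iA].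
  exact: finite_dim_hom_finite (etale_finite_dim eA).
have [X0 [e [e' [eK e'K eact]]]] := finite_Gset_of finT.
exists X0, e, e'; split=> //; first exact: (finite_locally_constant finT).
by move=> g h; apply: (can_inj eK); rewrite eact !e'K.
Qed.

(** A point [h] goes to the restrictions to [A0] of its iterated twists. If two points agree there,
    [iter_sc_twist] shows that the difference homomorphisms from [F] to [cofree K] they induce agree
    on [A0], hence everywhere by freeness; [q] being onto, the points are equal. *)
Lemma points_fin_sigma_generated (A : diff_algebra k) (iA : diff_locally_etale A) :
  fin_sigma_generated_etale A -> fin_sigma_generated (@points k K A iA).
Proof.
move=> [_ [A0 [F [eta [q [eA0 freeF q_surj]]]]]].
have [X0 [e [e' [eK e'K le' e'act]]]] := etale_finite_Gset eA0.
pose f := alg_comp q eta.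
have [|g h|m mE] := @sfree_lift G X0 (@points k K A iA) (fun h : alg_hom A KA => e' (alg_comp h f)).
- have := locally_constant_comp (@precomp_continuous k A0 A KA f) le'; exact.
- rewrite -e'act; congr e'; exact: alg_hom_ext.
exists X0, m; apply: injective_monomorphism => h1 h2 m12.
have h12 i a : iter i (sc_twist iA) h1 (f a) = iter i (sc_twist iA) h2 (f a).
  have := congr1 (fun z : sfree X0 => e (z i)) m12.
  by rewrite !mE !e'K => /(congr1 (fun h : alg_hom A0 KA => h a)).
have [u1 u1E] := cofree_lift h1; have [u2 u2E] := cofree_lift h2.
have [w [_ w_uniq]] := freeF (cofree K) (alg_comp (da_comp u1 q) eta).
have e12 : da_comp u1 q = da_comp u2 q.
  rewrite -(w_uniq (da_comp u1 q)) // -(w_uniq (da_comp u2 q)) //.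
  apply: alg_hom_ext => a; apply: funext => i /=.
  by rewrite u1E u2E -!(iter_sc_twist iA) -[q (eta a)]/(f a) h12.
apply: alg_hom_ext => a; have [b <-] := q_surj a.
by have := congr1 (fun h : da_hom F (cofree K) => h b 0%N) e12; rewrite /= u1E u2E.
Qed.

End Generated.

(** * Monomorphisms of profinite G-sets are injective *)

Section KernelPair.
Variables (G : diff_profinite_group) (X Y : Gprofinite G) (m : gs_hom X Y).

Definition kp_space : topologicalType := [set u : X * X | m u.1 = m u.2] : Type.

Definition kp_val (z : kp_space) : X * X := set_val z.

Lemma kp_valP z : m (kp_val z).1 = m (kp_val z).2.
Proof. by have := set_valP z. Qed.

Definition kp_mk (u : X * X) (mu : m u.1 = m u.2) : kp_space := exist _ u (mem_set mu).

Lemma kp_val_continuous : continuous kp_val.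
Proof. exact: initial_continuous. Qed.

Lemma kp_nbhsP (z : kp_space) U : nbhs z U ->
  exists2 O, open_nbhs (kp_val z) O & kp_val @^-1` O `<=` U.
Proof. by move=> [_ [[O oO <-] Oz sO]]; exists O. Qed.

Lemma kp_continuous (T : topologicalType) (f : T -> kp_space) :
  continuous (kp_val \o f) -> continuous f.
Proof.
move=> fc t A /kp_nbhsP[O oO sO].
by apply: filterS sO _; apply: (fc t O); exact: open_nbhs_nbhs.
Qed.

Lemma kp_compact : compact [set: kp_space].
Proof.
have [cX _ _] := gs_profinite X.
have cXX : compact [set: X * X] by rewrite -setXTT; exact: compact_setX.
have clK : closed [set u : X * X | m u.1 = m u.2].
  rewrite -openC openE => u /= /eqP nu.
  have [U [cU U1 nU2]] := profinite_zero_dimensional (gs_profinite Y) nu.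
  have c1 : {for u, continuous (fun u : X * X => m u.1)}.
    by apply: (@continuous_comp _ _ _ fst); [exact: cvg_fst|exact: gs_fun_continuous].
  have c2 : {for u, continuous (fun u : X * X => m u.2)}.
    by apply: (@continuous_comp _ _ _ snd); [exact: cvg_snd|exact: gs_fun_continuous].
  have n1 : nbhs u [set v | U (m v.1)] := c1 _ (open_nbhs_nbhs (conj cU.1 U1)).
  have n2 : nbhs u [set v | ~ U (m v.2)] := c2 _ (open_nbhs_nbhs (conj (closed_openC cU.2) nU2)).
  by apply: filterS (filterI n1 n2) => v [/= h1 h2] e; apply: h2; rewrite -e.
have cK := subclosed_compact clK cXX (@subsetT _ _).
move=> F FF _.
have KF : F (kp_val @^-1` [set u : X * X | m u.1 = m u.2]).
  by apply: filterS filterT => z _; exact: kp_valP.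
have [u [Ku clu]] := cK _ (fmap_proper_filter kp_val FF) KF.
exists (kp_mk Ku); split=> // B C FB /kp_nbhsP[O oO sO].
have BF : F (kp_val @^-1` (kp_val @` B)) by apply: filterS FB => z Bz; exists z.
have [v [[z Bz <-] Oz]] := clu _ O BF (open_nbhs_nbhs oO).
by exists z; split=> //; exact: sO.
Qed.

Lemma kp_zero_dim : zero_dimensional kp_space.
Proof.
move=> z w zw; have zX := profinite_zero_dimensional (gs_profinite X).
have pre (p : X * X -> X) : continuous p -> p (kp_val z) != p (kp_val w) ->
    exists U, [/\ clopen U, U z & ~ U w].
  move=> cp /zX[U [cU Uz nUw]]; exists ((p \o kp_val) @^-1` U); split=> //.
  apply: preimage_clopen => // t; apply: continuous_comp; first exact: kp_val_continuous.
  exact: cp.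
have [e1|n1] := eqVneq (kp_val z).1 (kp_val w).1; last first.
  by apply: (pre fst) => // u; exact: cvg_fst.
have [e2|n2] := eqVneq (kp_val z).2 (kp_val w).2; last first.
  by apply: (pre snd) => // u; exact: cvg_snd.
case/eqP: zw; apply: val_inj; rewrite -[LHS]/(kp_val z) -[RHS]/(kp_val w).
by rewrite [LHS]surjective_pairing e1 e2 -surjective_pairing.
Qed.

Let fst_continuous : continuous (fst : X * X -> X).
Proof. by move=> u; exact: cvg_fst. Qed.

Let snd_continuous : continuous (snd : X * X -> X).
Proof. by move=> u; exact: cvg_snd. Qed.

Definition kp_act (g : G) (z : kp_space) : kp_space :=
  @kp_mk (gs_act g (kp_val z).1, gs_act g (kp_val z).2)
    (etrans (gs_fun_act m g _) (etrans (congr1 (gs_act g) (kp_valP z)) (esym (gs_fun_act m g _)))).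

Definition kp_sigma (z : kp_space) : kp_space :=
  @kp_mk (gs_sigma (kp_val z).1, gs_sigma (kp_val z).2)
    (etrans (gs_fun_sigma m _) (etrans (congr1 (@gs_sigma G Y) (kp_valP z)) (esym (gs_fun_sigma m _)))).

Lemma kp_ext z w : (kp_val z).1 = (kp_val w).1 -> (kp_val z).2 = (kp_val w).2 -> z = w.
Proof.
move=> e1 e2; apply: val_inj; rewrite -[LHS]/(kp_val z) -[RHS]/(kp_val w).
by rewrite [LHS]surjective_pairing e1 e2 -surjective_pairing.
Qed.

Program Definition kernel_pair : Gprofinite G :=
  @GProfinite G kp_space (zero_dimensional_profinite kp_compact kp_zero_dim)
    kp_act _ _ _ kp_sigma _ _.
Next Obligation. by move=> z; apply: kp_ext; exact: gs_act1. Qed.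
Next Obligation. by move=> g h z; apply: kp_ext; exact: gs_actM. Qed.
Next Obligation.
apply: kp_continuous => -[g z].
have c (p : X * X -> X) : continuous p ->
    {for (g, z), continuous (fun u : G * kp_space => gs_act u.1 (p (kp_val u.2)))}.
  move=> cp; apply: (@continuous_comp _ _ _
    (fun u : G * kp_space => (u.1, p (kp_val u.2))) (fun u : G * X => gs_act u.1 u.2)).
    have h1 : {for (g, z), continuous (fun u : G * kp_space => u.1)} by exact: cvg_fst.
    have h2 : {for (g, z), continuous (fun u : G * kp_space => p (kp_val u.2))}.
      apply: (@continuous_comp _ _ _ snd (p \o kp_val)); first exact: cvg_snd.
      by apply: continuous_comp; [exact: kp_val_continuous|exact: cp].
    exact: (cvg_pair h1 h2).
  exact: gs_act_continuous.
have h1 := c fst fst_continuous; have h2 := c snd snd_continuous.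
exact: (cvg_pair h1 h2).
Qed.
Next Obligation.
apply: kp_continuous => z.
have c (p : X * X -> X) : continuous p ->
    {for z, continuous (fun z : kp_space => gs_sigma (p (kp_val z)))}.
  move=> cp; apply: (@continuous_comp _ _ _ (p \o kp_val)).
    by apply: continuous_comp; [exact: kp_val_continuous|exact: cp].
  exact: gs_sigma_continuous.
have h1 := c fst fst_continuous; have h2 := c snd snd_continuous.
exact: (cvg_pair h1 h2).
Qed.
Next Obligation. by move=> g z; apply: kp_ext; exact: gs_sigma_act. Qed.

Lemma monomorphism_injective :
  monomorphism (m : mor (X : Gprofinite_cat G) (Y : Gprofinite_cat G)) -> injective m.
Proof.
move=> mono x y mxy.
have cp (p : X * X -> X) : continuous p -> continuous (p \o kp_val).
  by move=> c z; apply: continuous_comp; [exact: kp_val_continuous|exact: c].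
pose p1 : gs_hom kernel_pair X := @GsHom G kernel_pair X (fst \o kp_val)
  (cp fst fst_continuous) (fun g z => erefl) (fun z => erefl).
pose p2 : gs_hom kernel_pair X := @GsHom G kernel_pair X (snd \o kp_val)
  (cp snd snd_continuous) (fun g z => erefl) (fun z => erefl).
have e : p1 = p2.
  by apply: (mono kernel_pair); apply: gs_hom_ext => z; exact: kp_valP.
exact: (congr1 (fun p : gs_hom kernel_pair X => p (@kp_mk (x, y) mxy)) e).
Qed.

End KernelPair.

(** * Universal properties of rings of equivariant functions *)

Section Universal.
Variables (k : diff_field) (K : sep_closure k).
Local Notation KA := (sc_algebra K).
Local Notation G := (galois_group K).

Lemma ef_pullback (X Y : Gspace G) (f : X -> Y) : continuous f ->
  (forall g x, f (sp_act g x) = sp_act g (f x)) ->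
  exists u : alg_hom (ef_algebra Y) (ef_algebra X),
    forall a x, ef_fun (u a) x = ef_fun a (f x).
Proof.
move=> cf ef.
have lu (a : ef_algebra Y) : locally_constant (fun x => ef_fun a (f x)).
  exact: locally_constant_comp cf (@ef_locally_constant _ _ _ a).
have eu (a : ef_algebra Y) (g : G) x : ef_fun a (f (sp_act g x)) = gal_fun g (ef_fun a (f x)).
  by rewrite ef ef_act.
pose u a : ef_algebra X := mk_ef (lu a) (eu a).
have uB : zmod_morphism u by move=> a b; apply: ef_ext.
have uM : monoid_morphism u by split=> [|a b]; apply: ef_ext.
have uin c : mk_rmorphism uB uM (alg_in _ c) = alg_in (ef_algebra X) c by apply: ef_ext.
by exists (@AlgHom k _ _ (mk_rmorphism uB uM) uin).
Qed.

Variable B : diff_algebra k.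
Local Notation D := (sep_diff_algebra K B).
Local Notation Y := (@points k K D (@sep_ind_etale k K B)).

Lemma ef_dual (T : Gspace G) (f : alg_hom (ef_algebra T) B) :
  exists (f' : alg_hom (ef_algebra T) D) (v : Y -> T),
    [/\ forall a, sep_incl K B (f' a) = f a, continuous v,
        forall g h, v (gs_act g h) = sp_act g (v h) &
        forall (h : alg_hom D KA) a, h (f' a) = ef_fun a (v h)].
Proof.
have [f' f'E] := sep_lift K f (@ef_ind_etale k K T).
have [v [cv ev vE]] := ef_adj_map (@sep_ind_etale k K B) f'.
by exists f', v.
Qed.

(* Everything factors through the separable part of B, where homomorphisms out
   of a ring of equivariant functions are dual to maps of spaces. *)
Lemma ef_universal (T : Gspace G) (X : Gprofinite G) (z : X -> T)
    (eta : alg_hom (ef_algebra T) (ef_diff_algebra X))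
    (f : alg_hom (ef_algebra T) B) (f' : alg_hom (ef_algebra T) D) (v : Y -> T) :
  (forall a x, ef_fun (eta a) x = ef_fun a (z x)) ->
  (forall a, sep_incl K B (f' a) = f a) ->
  (forall (h : alg_hom D KA) a, h (f' a) = ef_fun a (v h)) ->
  (exists! V : gs_hom Y X, forall h, z (V h) = v h) ->
  exists! u : da_hom (ef_diff_algebra X) B, alg_comp u eta = f.
Proof.
move=> etaE f'E vE [V [zV V_uniq]].
have eqD (a b : D) : (forall h : alg_hom D KA, h a = h b) -> a = b.
  exact: (alg_hom_eq (@sep_ind_etale k K B)).
have [u' u'E] := ef_adj_da_hom V.
exists (da_comp (sep_incl K B) u'); split.
  apply: alg_hom_ext => a; rewrite -f'E; congr (sep_incl K B _).
  by apply: eqD => h; rewrite vE -zV -etaE; exact: u'E.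
move=> u2 u2eta.
have [u2' u2'E] := sep_lift_da K u2 (@ef_dle k K X).
have [V2 V2E] := ef_adj_gs_hom (@sep_ind_etale k K B) u2'.
have V12 : V = V2.
  apply: V_uniq => h; apply: contrapT => /ef_separates[a]; apply.
  rewrite -vE -etaE -V2E; congr (h _); apply: (@sep_incl_inj k K B).
  by rewrite u2'E f'E -u2eta.
apply: da_hom_ext => a; rewrite -u2'E; congr (sep_incl K B _).
by apply: eqD => h; rewrite V2E -V12; exact: u'E.
Qed.

End Universal.

Section FreeAlgebras.
Variables (k : diff_field) (K : sep_closure k).
Local Notation KA := (sc_algebra K).
Local Notation G := (galois_group K).

Lemma sfree_head_continuous (X0 : finite_Gset G) :
  continuous (fun z : gspace_of (sfree X0) => z 0%N : fg_gspace X0).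
Proof. exact: sfree_proj_continuous. Qed.

(** By [ef_universal], freeness of the ring of functions on [sfree X0] is the cofreeness of the
    space [sfree X0]. *)
Lemma sfree_free (X0 : finite_Gset G) :
  exists eta : alg_hom (ef_algebra (fg_gspace X0)) (ef_diff_algebra (sfree X0)),
    is_free_diff_algebra eta.
Proof.
have [//|eta etaE] := @ef_pullback k K (gspace_of (sfree X0)) (fg_gspace X0)
  (fun z => z 0%N) (@sfree_head_continuous X0).
exists eta => B f; have [f' [v [f'E cv ev vE]]] := ef_dual f.
apply: (ef_universal etaE f'E vE).
have [||V VE] := @sfree_lift G X0 _ v.
- by apply/(@locally_constant_continuous _ (discrete_topology X0)).
- exact: ev.
exists V; split=> [h|V2 V2E]; first exact: VE.
by apply: sfree_hom_ext => h; rewrite VE V2E.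
Qed.

Lemma ef_precomp_surj (X Y : Gprofinite G) (m : gs_hom X Y) : injective m ->
  forall a : ef_diff_algebra X, exists b, ef_precomp m b = a.
Proof.
move=> mi a; pose V := [set a : ef_algebra (gspace_of X) | exists b, ef_precomp m b = a].
suff : V a by [].
apply: ef_dense.
- by move=> c; exists (alg_in _ c); exact: alg_fun_in.
- by move=> _ _ [b <-] [b' <-]; exists (b - b'); rewrite rmorphB.
- by move=> _ _ [b <-] [b' <-]; exists (b * b'); rewrite rmorphM.
move=> x y xy; have [b mxy] : exists b : ef_algebra (gspace_of Y), ef_fun b (m x) <> ef_fun b (m y).
  by apply: ef_separates => /mi.
by exists (ef_precomp m b) => //; exists b.
Qed.

Lemma ef_fin_sigma_generated (X : Gprofinite G) :
  fin_sigma_generated X -> fin_sigma_generated_etale (ef_diff_algebra X).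
Proof.
move=> [X0 [m mono]]; split; first exact: ef_dle.
have [eta free] := sfree_free X0.
exists (ef_algebra (fg_gspace X0)), (ef_diff_algebra (sfree X0)), eta, (ef_precomp m).
split=> //; first exact: ef_etale (@fg_gspace_finite _ X0).
exact: ef_precomp_surj (monomorphism_injective mono).
Qed.

End FreeAlgebras.

(** * Finitely sigma-presented objects *)

Section PresentedPoints.
Variables (k : diff_field) (K : sep_closure k).
Local Notation KA := (sc_algebra K).
Local Notation G := (galois_group K).

(** If [p] kills [a], then [t a] is a root of the conjugate of [p] under [sc_sigma]. Since [p]
    splits in [K], all roots of this conjugate are images under [sc_sigma], and injectivity
    transfers the ring laws. *)
Lemma semilinear_twist (A : algebra k) (t : {rmorphism A -> K}) : ind_etale A ->
  (forall c, t (alg_in A c) = sc_in K (df_sigma k c)) ->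
  exists x : alg_hom A KA, forall a, sc_sigma K (x a) = t a.
Proof.
move=> iA tin.
have ex a : {b : K | sc_sigma K b = t a}.
  apply: cid; have [p [sp pa]] := iA a.
  have := sp; rewrite -(separable_map (sc_in K)) => /sc_split[rs E].
  have : root (map_poly (sc_sigma K) (map_poly (sc_in K) p)) (t a).
    apply/eqP; rewrite -[RHS](rmorph0 t) -pa /alg_eval rmorph_sum.
    rewrite (@horner_coef_wide _ (size p)) ?size_map_poly //.
    apply: eq_bigr => i _; rewrite rmorphM rmorphXn tin.
    by rewrite !coef_map /= sc_sigma_in.
  rewrite E map_polyZ rmorph_prod rootZ; last first.
    by rewrite fmorph_eq0 lead_coef_eq0 map_poly_eq0 separable_poly_neq0.
  under eq_bigr do rewrite /= map_polyXsubC.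
  rewrite -(big_map (sc_sigma K) xpredT (fun r => 'X - r%:P)) root_prod_XsubC.
  by case/mapP=> b _ ->; exists b.
pose v a := sval (ex a); have vE a : sc_sigma K (v a) = t a := svalP (ex a).
have vB : zmod_morphism v.
  by move=> a b; apply: (sc_sigma_inj (K := K)); rewrite rmorphB !vE rmorphB.
have vM : monoid_morphism v.
  split=> [|a b]; apply: (sc_sigma_inj (K := K)); first by rewrite rmorph1 vE rmorph1.
  by rewrite rmorphM !vE rmorphM.
have vin c : mk_rmorphism vB vM (alg_in A c) = alg_in KA c.
  by apply: sc_sigma_inj; rewrite [LHS]vE tin /= sc_sigma_in.
by exists (@AlgHom k A KA (mk_rmorphism vB vM) vin).
Qed.

Lemma represents_cc_iso (E : cocorrespondence k) (A R : diff_algebra k)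
    (r : alg_hom (cc_C E) R) (f : da_hom A R) (g : da_hom R A) :
  cancel f g -> cancel g f -> represents_cc r -> represents_cc (alg_comp g r).
Proof.
move=> fK gK [rpt Runiv]; split=> [a|B c cpt].
  by rewrite /= -da_fun_sigma rpt.
have [u [ur u_uniq]] := Runiv B c cpt.
exists (da_comp u f); split.
  by apply: alg_hom_ext => a; rewrite /= gK -ur.
move=> w wr; have -> : u = da_comp w g.
  by apply: u_uniq; apply: alg_hom_ext => a; rewrite -wr.
by apply: da_hom_ext => a; rewrite /= fK.
Qed.

Lemma alg_point_ext (A : algebra k) (x y : alg_hom A KA) :
  (forall a, sc_sigma K (x a) = sc_sigma K (y a)) -> x = y.
Proof. by move=> e; apply: alg_hom_ext => a; apply: sc_sigma_inj. Qed.

(** With [Z0] and [X0] the points of [cc_C E] and [cc_A E], a point of [A] amounts to a sequence in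
    [Z0] with [s z_i] equal to the restriction of [z_(i+1)] along [cc_p], where [s] is dual to
    [cc_s]. Such sequences form an equaliser of maps to the free object on the twist of [X0]; the
    twist is forced by [s_act]. *)
Lemma points_fin_sigma_presented (A : diff_algebra k) (iA : diff_locally_etale A) :
  fin_sigma_presented_etale A -> fin_sigma_presented (@points k K A iA).
Proof.
move=> [E [R [r0 [eA eC repR [f0 [g0 [gf fg]]]]]]].
have [f0K g0K] : cancel f0 g0 /\ cancel g0 f0.
  split=> a; first exact: (congr1 (fun h : da_hom A A => h a) gf).
  exact: (congr1 (fun h : da_hom R R => h a) fg).
have := represents_cc_iso f0K g0K repR; move: (alg_comp g0 r0) => r [rpt Auniv].
move=> {R r0 repR f0 g0 gf fg f0K g0K}.
have iA0 := etale_ind_etale eA; have iC := etale_ind_etale eC.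
have [X0 [e [e' [eK e'K le' e'act]]]] := etale_finite_Gset K eA.
have [Z0 [ez [ez' [ezK ez'K lez' ez'act]]]] := etale_finite_Gset K eC.
have ez_act g z : ez (fg_act g z) = alg_comp (gal_fun g) (ez z).
  by apply: (can_inj ez'K); rewrite ez'act !ezK.
have /choice[s sE] (z : alg_hom (cc_C E) KA) : exists x : alg_hom (cc_A E) KA,
    forall a, sc_sigma K (x a) = z (cc_s E a).
  have [|x xE] := @semilinear_twist _ (z \o cc_s E : {rmorphism _ -> _}) iA0; last by exists x.
  move=> c /=; rewrite -[alg_in _ c]mulr1 cc_s_semilinear rmorph1 mulr1.
  exact: (alg_fun_in z).
have s_act (g : G) z : s (alg_comp (gal_fun g) z) = alg_comp (gal_fun (gp_sigma g)) (s z).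
  by apply: alg_point_ext => a; rewrite sE /= -sE -gal_sigmaE.
have [|g h|i iE] := @sfree_lift G Z0 (@points k K A iA) (fun h : alg_hom A KA => ez' (alg_comp h r)).
- by have := locally_constant_comp (@precomp_continuous k _ A KA r) lez'; exact.
- by rewrite -ez'act; congr ez'; exact: alg_hom_ext.
have [|g z|f fE] := @sfree_lift G (twist_Gset X0) (sfree Z0) (fun z => e' (s (ez (z 0%N)))).
- exact: (locally_constant_post (e' \o s \o ez) (@sfree_coord_locally_constant _ Z0 0%N)).
- by rewrite -[gs_act g z 0%N]/(fg_act g (z 0%N)) ez_act s_act e'act.
(* The group acts on coordinate 1 through [gp_sigma], as the twisted target requires. *)
have [|g z|f' f'E] := @sfree_lift G (twist_Gset X0) (sfree Z0)
    (fun z => e' (alg_comp (ez (z 1%N)) (cc_p E))).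
- exact: (locally_constant_post (fun z => e' (alg_comp (ez z) (cc_p E)))
    (@sfree_coord_locally_constant _ Z0 1%N)).
- rewrite -[gs_act g z 1%N]/(fg_act (gp_sigma g) (z 1%N)) ez_act.
  by rewrite -[RHS]/(fg_act (gp_sigma g) _) -e'act; congr e'; exact: alg_hom_ext.
exists Z0, (twist_Gset X0), f, f', i; split.
  apply: sfree_hom_ext => h /=; rewrite fE f'E /= !iE /= !ez'K; congr e'.
  apply: alg_point_ext => a; rewrite sE /= -rpt.
  by rewrite (sc_twistE iA).
move=> Z j fj; pose B := ef_diff_algebra Z.
have jE x : s (ez (j x 0%N)) = alg_comp (ez (j x 1%N)) (cc_p E).
  have := congr1 (fun h : gs_hom Z (sfree (twist_Gset X0)) => h x 0%N) fj.
  by rewrite /= fE f'E => /(can_inj e'K).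
have jS x n : j (gs_sigma x) n = j x n.+1 by rewrite gs_fun_sigma.
have [lj ej] := sfree_hom_head j.
have lc b : locally_constant (fun x : gspace_of Z => ez (j x 0%N) b : K).
  exact: (locally_constant_post (fun z => ez z b : K) lj).
have ec b (g : G) (x : gspace_of Z) : ez (j (gs_act g x) 0%N) b = gal_fun g (ez (j x 0%N) b) :> K.
  by rewrite ej ez_act.
(* The head of [j] is dual to a homomorphism from [cc_C E] to the functions on [Z], and [jE] says
   that it is a point of the cocorrespondence. *)
pose c b : B := mk_ef (lc b) (ec b).
have cB : zmod_morphism c by move=> a b; apply: ef_ext => x; exact: rmorphB.
have cM : monoid_morphism c.
  by split=> [|a b]; apply: ef_ext => x; [exact: rmorph1|exact: rmorphM].
have cin d : mk_rmorphism cB cM (alg_in _ d) = alg_in B d.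
  by apply: ef_ext => x; exact: (alg_fun_in (ez _)).
pose c' : alg_hom (cc_C E) B := AlgHom cin.
have [|U [Ur U_uniq]] := Auniv B c'.
  move=> a; apply: ef_ext => x; rewrite -[LHS]/(sc_sigma K (ez (j (gs_sigma x) 0%N) (cc_p E a))).
  by rewrite jS -[RHS]/(ez (j x 0%N) (cc_s E a) : K) -sE jE.
pose u (x : Z) : alg_hom A KA := alg_comp (ef_eval (x : gspace_of Z)) U.
have UrE b x : u x (r b) = ez (j x 0%N) b.
  by rewrite -[LHS]/(ef_eval _ (alg_comp U r b)) Ur.
have cu : continuous (u : Z -> @points k K A iA).
  by apply: alg_hom_continuous => a; exact: (@ef_locally_constant _ _ (gspace_of Z) (U a)).
have eu g x : u (gs_act g x) = gs_act (g0 := @points k K A iA) g (u x).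
  by apply: alg_hom_ext => a; exact: (@ef_act _ _ (gspace_of Z) (U a)).
have su x : u (gs_sigma x) = gs_sigma (u x : @points k K A iA).
  apply: alg_point_ext => a; rewrite (sc_twistE iA).
  exact: (congr1 (fun b : ef_algebra (gspace_of Z) => ef_fun b x) (esym (da_fun_sigma U a))).
exists (@GsHom G Z (@points k K A iA) u cu eu su); split.
  apply: sfree_hom_ext => x; rewrite /= iE /=; apply: (can_inj ezK); rewrite ez'K.
  by apply: alg_hom_ext => b; exact: UrE.
move=> u2 iu2; apply: gs_hom_ext => x; apply: alg_hom_ext => a.
have UE : U = da_comp (ef_precomp u2) (ef_unit K iA).
  apply: U_uniq; apply: alg_hom_ext => b; apply: ef_ext => y.
  rewrite -[LHS]/((u2 y : alg_hom A KA) (r b) : K) -[RHS]/(ez (j y 0%N) b : K).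
  have := congr1 (fun h : gs_hom Z (sfree Z0) => ez (h y 0%N)) iu2.
  by rewrite /= iE /= ez'K => <-.
exact: (congr1 (fun w : da_hom A B => ef_fun (w a : ef_algebra (gspace_of Z)) x) UE).
Qed.

End PresentedPoints.

(** * Dependence on finitely many coordinates, and windows *)

Section Cylinders.
Variables (G : diff_profinite_group) (X0 : finite_Gset G).

Lemma sfree_open_coord i (x : X0) : open [set z : sfree X0 | z i = x].
Proof.
by have [] := locally_constant_clopen [set x] (@sfree_coord_locally_constant G X0 i).
Qed.

(** The open sets that depend on finitely many coordinates form a separating Boolean algebra, hence
    include every clopen set, in particular every fibre of [F]. *)
Lemma sfree_finite_support (T : Type) (F : sfree X0 -> T) : locally_constant F ->
  exists n, forall z w : sfree X0, (forall i, (i < n)%N -> z i = w i) -> F z = F w.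
Proof.
move=> lF; have [cX _ _] := gs_profinite (sfree X0).
pose C := [set A : set (sfree X0) | open A /\
  exists n, forall z w : sfree X0, (forall i, (i < n)%N -> z i = w i) -> A z -> A w].
have oC (A : set (sfree X0)) n :
    (forall z w : sfree X0, (forall i, (i < n)%N -> z i = w i) -> A z -> A w) -> open A.
  move=> An; rewrite openE => z Az.
  have := near_all_seq (s := iota 0 n)
    (fun i _ => sfree_coord_locally_constant i z).
  by apply: filterS => w e; apply: (An z) => // i lt_i; rewrite e ?mem_iota.
have CP D : clopen D -> C D.
  apply: clopen_generated => //.
  - by move=> A [].
  - by split; [exact: openT|exists 0%N].
  - move=> A [oA [n An]]; have nA z w : (forall i, (i < n)%N -> z i = w i) -> (~` A) z -> (~` A) w.
      by move=> e nAz Aw; apply: nAz; apply: (An w) => // i /e.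
    by split; [exact: oC nA|exists n].
  - move=> A A' [oA [n An]] [oA' [n' An']]; split; first exact: openI.
    exists (maxn n n') => z w e [Az A'z].
    split; [apply: An Az|apply: An' A'z] => i lt_i; apply: e.
      exact: leq_trans lt_i (leq_maxl _ _).
    exact: leq_trans lt_i (leq_maxr _ _).
  - move=> z w zw; have [i zwi] : exists i, z i <> w i.
      apply: contrapT => nzw; apply: zw; apply: funext => i.
      by apply: contrapT => zwi; apply: nzw; exists i.
    exists [set y | y i = z i]; split=> //; last by move=> /esym.
    split; first exact: sfree_open_coord.
    by exists i.+1 => y y' e /= <-; rewrite e.
have /choice[n nP] (t : T) : exists n, forall z w : sfree X0,
    (forall i, (i < n)%N -> z i = w i) -> F z = t -> F w = t.
  have [_ [n h]] := CP _ (locally_constant_clopen [set t] lF).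
  by exists n => z w e; exact: h.
(* The bound [n] belongs to a value of [F]; composed with [F] it takes finitely many values by
   compactness, so their maximum serves for all fibres. *)
have /finite_seqP[S ES] := locally_constant_finite cX (locally_constant_post n lF).
exists (\max_(m <- S) m) => z w e; apply/esym; apply: (nP (F z) z) => // i lt_i.
apply: e; apply: leq_trans lt_i _; apply: (@leq_bigmax_seq _ S xpredT id) => //.
suff : [set` S] (n (F z)) by [].
by rewrite -ES; exists z.
Qed.

Definition cyl_act m (g : G) (z : {ffun 'I_m -> X0}) : {ffun 'I_m -> X0} :=
  [ffun i : 'I_m => fg_act (iter i (@gp_sigma G) g) (z i)].

Lemma cyl_act1 m (z : {ffun 'I_m -> X0}) : cyl_act (gp_one G) z = z.
Proof. by apply/ffunP => i; rewrite ffunE iter_gp_sigma1 fg_act1. Qed.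

Lemma iter_gp_sigmaM i (g h : G) : iter i (@gp_sigma G) (gp_mul g h) =
  gp_mul (iter i (@gp_sigma G) g) (iter i (@gp_sigma G) h).
Proof. by elim: i => //= i ->; rewrite gp_sigma_mul. Qed.

Lemma cyl_actM m g h (z : {ffun 'I_m -> X0}) :
  cyl_act (gp_mul g h) z = cyl_act g (cyl_act h z).
Proof. by apply/ffunP => i; rewrite !ffunE iter_gp_sigmaM fg_actM. Qed.

Lemma cyl_act_locally_constant m (z : {ffun 'I_m -> X0}) :
  locally_constant (fun g => cyl_act g z).
Proof.
move=> g; have : \forall h \near g, forall i : 'I_m,
    fg_act (iter i (@gp_sigma G) h) (z i) = fg_act (iter i (@gp_sigma G) g) (z i).
  apply: filter_forall => i.
  exact: (locally_constant_comp (@iter_gp_sigma_continuous G i) (fg_act_locally_constant (z i))).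
by apply: filterS => h e; apply/ffunP => i; rewrite !ffunE e.
Qed.

Definition cyl m : finite_Gset G :=
  FiniteGset (@cyl_act1 m) (@cyl_actM m) (finite_act_continuous (@cyl_act_locally_constant m)).

Section StableSubset.
Variables (W : finite_Gset G) (b : pred W).
Hypothesis b_act : forall (g : G) w, b w -> b (fg_act g w).

Definition sub_act (g : G) (w : {w | b w}) : {w | b w} :=
  exist _ (fg_act g (val w)) (b_act g (valP w)).

Lemma sub_act1 w : sub_act (gp_one G) w = w.
Proof. by apply: val_inj; exact: fg_act1. Qed.

Lemma sub_actM g h w : sub_act (gp_mul g h) w = sub_act g (sub_act h w).
Proof. by apply: val_inj; exact: fg_actM. Qed.

Lemma sub_act_locally_constant w : locally_constant (fun g => sub_act g w).
Proof.
move=> g; apply: filterS (fg_act_locally_constant (val w) g) => h e.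
exact: val_inj.
Qed.

Definition sub_Gset : finite_Gset G :=
  FiniteGset sub_act1 sub_actM (finite_act_continuous sub_act_locally_constant).

End StableSubset.

(** Beyond position [n], [inord] returns index 0, so the window is continued by its head. This is
    harmless for functions that read only the first [n.+1] coordinates. *)
Definition cyl_ext n (z : {ffun 'I_n.+1 -> X0}) : sfree X0 := fun i => z (inord i).

Definition cyl_trunc n (z : nat -> X0) : {ffun 'I_n.+1 -> X0} := [ffun i : 'I_n.+1 => z i].

Lemma cyl_trunc_ext n (z : sfree X0) i : (i < n.+1)%N -> cyl_ext (cyl_trunc n z) i = z i.
Proof. by move=> lt_i; rewrite /cyl_ext ffunE inordK. Qed.

End Cylinders.

Section PresentedAlgebras.
Variables (k : diff_field) (K : sep_closure k).
Local Notation KA := (sc_algebra K).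
Local Notation G := (galois_group K).

(* The equaliser of f and f' consists of the sequences all of whose windows of
   length n.+1 lie in Z0, so it is presented by the two maps from Z0 to the
   windows of length n. *)
Lemma ef_fin_sigma_presented (X : Gprofinite G) :
  fin_sigma_presented X -> fin_sigma_presented_etale (ef_diff_algebra X).
Proof.
move=> [X0 [Y0 [f [f' [i [fi Xuniv]]]]]].
have [lf ef] := sfree_hom_head f; have [lf' ef'] := sfree_hom_head f'.
have [n [fn f'n]] : exists n,
    (forall z w : sfree X0, (forall i, (i < n.+1)%N -> z i = w i) -> f z 0%N = f w 0%N) /\
    (forall z w : sfree X0, (forall i, (i < n.+1)%N -> z i = w i) -> f' z 0%N = f' w 0%N).
  have [n1 h1] := sfree_finite_support lf; have [n2 h2] := sfree_finite_support lf'.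
  (* Windows have length [n.+1], so they always have a head; consecutive ones overlap in length
     [n]. *)
  exists (maxn n1 n2); split=> z w e; [apply: h1|apply: h2] => l lt_l; apply: e.
    by rewrite ltnS ltnW // (leq_trans lt_l) // leq_maxl.
  by rewrite ltnS ltnW // (leq_trans lt_l) // leq_maxr.
pose W := cyl X0 n.+1; pose V := cyl X0 n.
pose b (z : W) : bool := f (cyl_ext z) 0%N == f' (cyl_ext z) 0%N.
have ext_act (g : G) (z : W) l : (l < n.+1)%N ->
    cyl_ext (fg_act g z) l = (gs_act g (cyl_ext z : sfree X0) : sfree X0) l.
  by move=> lt_l; rewrite /cyl_ext ffunE inordK.
have b_act (g : G) z : b z -> b (fg_act g z).
  rewrite /b => /eqP bz; rewrite (fn _ _ (ext_act g z)) (f'n _ _ (ext_act g z)).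
  by rewrite ef ef' bz.
pose Z0 := sub_Gset b_act.
pose p (z : Z0) : V := [ffun l : 'I_n => val z (widen_ord (leqnSn n) l)].
pose s (z : Z0) : V := [ffun l : 'I_n => val z (lift ord0 l)].
have p_act g z : p (fg_act g z) = fg_act g (p z).
  by apply/ffunP => l; rewrite !ffunE.
have s_act g z : s (fg_act g z) = fg_act (gp_sigma g) (s z).
  by apply/ffunP => l; rewrite !ffunE /= -iterSr.
have lZ T (h : Z0 -> T) : locally_constant (h : fg_gspace Z0 -> T).
  exact: (finite_locally_constant (@fg_gspace_finite _ Z0)).
have [||pA pAE] := @ef_pullback k K (fg_gspace Z0) (fg_gspace V) p.
- by apply/(@locally_constant_continuous _ (discrete_topology V)); exact: lZ.
- exact: p_act.
(* Composing with [sc_sigma] compensates for [s] being equivariant only through [gp_sigma], and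
   makes the resulting homomorphism semilinear. *)
have sA_eq (a : ef_algebra (fg_gspace V)) (g : G) (z : fg_gspace Z0) :
    sc_sigma K (ef_fun a (s (sp_act g z))) = gal_fun g (sc_sigma K (ef_fun a (s z))).
  by rewrite s_act -gal_sigmaE; congr (sc_sigma K _); exact: (@ef_act k K (fg_gspace V)).
pose sA a : ef_algebra (fg_gspace Z0) := mk_ef (lZ _ _) (sA_eq a).
have sB : zmod_morphism sA by move=> a c; apply: ef_ext => z; exact: rmorphB.
have sM : monoid_morphism sA.
  by split=> [|a c]; apply: ef_ext => z; [exact: rmorph1|exact: rmorphM].
have s_semi (c : k) a : mk_rmorphism sB sM (alg_in _ c * a) =
    alg_in (ef_algebra (fg_gspace Z0)) (df_sigma k c) * mk_rmorphism sB sM a.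
  by apply: ef_ext => z; rewrite -[LHS]/(sc_sigma K (sc_in K c * ef_fun a (s z))) rmorphM sc_sigma_in.
pose E := @Cocorrespondence k (ef_algebra (fg_gspace V)) (ef_algebra (fg_gspace Z0))
  pA (mk_rmorphism sB sM) s_semi.
have bi x : b (cyl_trunc n (i x)).
  rewrite /b; rewrite (fn _ (i x)); last by move=> l; exact: cyl_trunc_ext.
  rewrite (f'n _ (i x)); last by move=> l; exact: cyl_trunc_ext.
  by apply/eqP; exact: (congr1 (fun h : gs_hom X (sfree Y0) => h x 0%N) fi).
pose zeta (x : gspace_of X) : fg_gspace Z0 := exist _ (cyl_trunc n (i x)) (bi x).
have [||eta etaE] := @ef_pullback k K (gspace_of X) (fg_gspace Z0) zeta.
- apply/(@locally_constant_continuous _ (discrete_topology Z0)) => x.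
  have : \forall y \near x, forall l : 'I_n.+1, i y l = i x l.
    apply: filter_forall => l.
    exact: (locally_constant_comp (@gs_fun_continuous _ _ _ i) (@sfree_coord_locally_constant _ X0 l)).
  by apply: filterS => y e; apply: val_inj; apply/ffunP => l; rewrite !ffunE e.
- by move=> g x; apply: val_inj; apply/ffunP => l; rewrite !ffunE gs_fun_act.
exists E, (ef_diff_algebra X), eta; split.
- exact: ef_etale (@fg_gspace_finite _ V).
- exact: ef_etale (@fg_gspace_finite _ Z0).
- split.
    move=> a; apply: ef_ext => x.
    rewrite -[LHS]/(sc_sigma K (ef_fun (eta (pA a)) (gs_sigma x : gspace_of X))) !etaE pAE.
    rewrite -[RHS]/(sc_sigma K (ef_fun a (s (zeta x)))).
    congr (sc_sigma K (ef_fun a _)); apply/ffunP => l; rewrite !ffunE gs_fun_sigma.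
    by [].
  move=> B c cpt; have [c' [v [c'E cv ev vE]]] := ef_dual c.
  apply: (ef_universal etaE c'E vE).
  (* The cocorrespondence condition, read on points: the window at [gs_sigma h] continues the window
     at [h] by one step. *)
  have vS h : p (v (gs_sigma h)) = s (v h).
    apply: contrapT => /(@ef_separates k K (fg_gspace V))[a]; apply.
    rewrite -pAE -vE; apply: sc_sigma_inj; rewrite sc_twistE.
    rewrite -[RHS]/(ef_fun (sA a) (v h)) -vE; congr (h _).
    apply: (@sep_incl_inj k K B).
    by rewrite da_fun_sigma !c'E; exact: cpt.
  have v_lc : locally_constant v.
    by apply/(@locally_constant_continuous _ (discrete_topology Z0)).
  have [|g h|U UE] := @sfree_lift G X0 _ (fun h => val (v h) ord0).
  - exact: (locally_constant_post (fun z : Z0 => val z ord0) v_lc).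
  - by rewrite ev ffunE.
  (* Overlapping windows are determined by their heads: coordinate [l] of the window at [h] is the
     head of the window at the [l]-th iterate of [h]. *)
  have vU l (lt_l : (l < n.+1)%N) h : val (v h) (Ordinal lt_l) = U h l.
    elim: l lt_l h => [|l IH] lt_l h.
      by rewrite UE /=; congr (val (v h) _); exact: val_inj.
    have lt_l' : (l < n)%N by [].
    have := congr1 (fun w : V => w (Ordinal lt_l')) (vS h); rewrite !ffunE => e.
    rewrite -[U h l.+1]/(gs_sigma (U h) l) -gs_fun_sigma -(IH (ltnW lt_l)).
    rewrite (_ : Ordinal lt_l = lift ord0 (Ordinal lt_l')); last exact: val_inj.
    by rewrite -e; congr (val (v (gs_sigma h)) _); exact: val_inj.
  have extU h l : (l < n.+1)%N -> U h l = cyl_ext (val (v h)) l.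
    move=> lt_l; rewrite -(vU _ lt_l) /cyl_ext; congr (val (v h) _).
    by apply: val_inj; rewrite /= inordK.
  have [|V1 [iV V1_uniq]] := Xuniv _ U.
    apply: sfree_hom_ext => h /=; rewrite (fn _ _ (extU h)) (f'n _ _ (extU h)).
    by apply/eqP; exact: (valP (v h)).
  have iVE h : i (V1 h) = U h by rewrite -iV.
  exists V1; split=> [h|V2 V2E].
    apply: val_inj; apply/ffunP => l; rewrite ffunE iVE -(vU l (ltn_ord l)).
    by congr (val (v h) _); exact: val_inj.
  apply: V1_uniq; apply: sfree_hom_ext => h; rewrite UE /= -V2E.
  by rewrite /= ffunE.
- exists (da_id _), (da_id _); split; exact: da_hom_ext.
Qed.

End PresentedAlgebras.

(** Local etaleness is not part of the definition of a finite presentation; the third clause shows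
    that restricting the last one to locally etale algebras loses no finitely presented algebra. *)
Theorem corollary3p46 (k : diff_field) (K : sep_closure k) :
  is_equivalence (points_functor K) /\
  restricts_to_equivalence (points_functor K)
    (fun A => fin_sigma_generated_etale (sval A))
    (fun X => fin_sigma_generated X) /\
  (forall A : diff_algebra k,
     fin_sigma_presented_etale A -> diff_locally_etale A) /\
  restricts_to_equivalence (points_functor K)
    (fun A => fin_sigma_presented_etale (sval A))
    (fun X => fin_sigma_presented X).
Proof.
have [unit counit] := ef_functor_inverse K.
split; first by exists (ef_functor K).
split; last split; last 1 first.
- apply: (restrict_equivalence unit counit) => [A|X].
    exact: points_fin_sigma_presented.
  exact: ef_fin_sigma_presented.
- apply: (restrict_equivalence unit counit) => [A|X].
    exact: points_fin_sigma_generated.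
  exact: ef_fin_sigma_generated.
- by move=> A; exact: (presented_locally_etale K).
Qed.
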